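(* Let $\alpha>1$ and $r_0(\alpha)=1+\frac{2}{\alpha-1}$. Let $F$ be a smooth, symmetric function on the positive cone $\{(a,b)\in\mathbb{R}^2: a>0,\ b>0\}$, homogeneous of degree $\alpha$, with strictly positive partial derivative in each argument. Let $x:S^2\times[0,T)\to\mathbb{R}^3$ be a smooth family of strictly convex embeddings satisfying $$\frac{\partial x}{\partial t}(z,t)=-F(\kappa_1(z,t),\kappa_2(z,t))\,\nu(z,t).$$ If the pinching ratio of $M_0=x(S^2,0)$ is less than or equal to $r_0(\alpha)$, then for every $t\in(0,T)$ the pinching ratio of $M_t=x(S^2,t)$ is no greater than the pinching ratio of $M_0$.
   Context: Here $\nu(z,t)$ is the outward unit normal and $\kappa_1(z,t),\kappa_2(z,t)$ are the principal curvatures of $M_t$ at $x(z,t)$, with the sign convention that they are positive on strictly convex surfaces (eigenvalues of $h_{ij}=-\langle \partial_i\partial_j x,\nu\rangle$ with respect to the induced metric). An embedding is called strictly convex if both principal curvatures of its image are positive at every point. The pinching ratio of a strictly convex surface is the supremum over the surface of the ratio of the largest to the smallest principal curvature at each point. *)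

(* Defs.v *)
From HB Require Import structures.
From mathcomp Require Import all_boot all_order all_algebra.
From mathcomp Require Import all_classical all_reals all_analysis.
Set Implicit Arguments.
Unset Strict Implicit.
Unset Printing Implicit Defensive.
Import Order.TTheory GRing.Theory Num.Theory.
Import numFieldNormedType.Exports.
Local Open Scope classical_set_scope.
Local Open Scope ring_scope.

(* f is of class C^k on the open set U. In finite dimension, continuity of all
   iterated directional derivatives is the usual notion. *)
Fixpoint class_C (R : realType) (V W : normedModType R) (k : nat)
    (U : set V) (f : V -> W) : Prop :=
  match k with
  | 0%N => forall p, U p -> {for p, continuous f}
  | k'.+1 => (forall p, U p -> differentiable f p) /\
             (forall v : V, class_C k' U (fun p => 'D_v f p))
  end.

(* Smoothness on an arbitrary subset X of a vector space: near each point of X,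
   f coincides on X with a C^infinity function defined on an open set. For X
   open this is C^infinity on X. Values of f outside X are irrelevant. *)
Definition smooth_on (R : realType) (V W : normedModType R)
    (X : set V) (f : V -> W) : Prop :=
  forall p, X p -> exists (U : set V) (g : V -> W),
    [/\ open U, U p, (forall k, class_C k U g) &
        forall q, U q -> X q -> f q = g q].

(* Euclidean inner product; the library norm on row vectors is the sup norm,
   which is used here only for its topology. *)
Definition dotv (R : realType) (n : nat) (u v : 'rV[R]_n) : R :=
  (u *m v^T) 0 0.

Definition sphere2 (R : realType) : set 'rV[R]_3 :=
  [set z | dotv z z = 1].

Definition partial (R : realType) (n : nat) (W : normedModType R)
    (i : 'I_n.+1) (f : 'rV[R]_n.+1 -> W) : 'rV[R]_n.+1 -> W :=
  fun u => 'D_(delta_mx 0 i) f u.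

Definition immersive_at (R : realType) (f : 'rV[R]_2 -> 'rV[R]_3)
    (u : 'rV[R]_2) : Prop :=
  forall v, 'D_v f u = 0 -> v = 0.

(* phi gives local coordinates (u_1, u_2) in U on an open piece of the sphere *)
Definition sphere_chart (R : realType) (U : set 'rV[R]_2)
    (phi : 'rV[R]_2 -> 'rV[R]_3) : Prop :=
  [/\ open U, smooth_on U phi, phi @` U `<=` @sphere2 R, set_inj U phi &
      forall u, U u -> immersive_at phi u].

(* A surface is a map f whose restriction to sphere2 is all that matters. The
   last clause says that f is open onto its image, so that f is a
   homeomorphism from the sphere onto its image. *)
Definition sphere_embedding (R : realType) (f : 'rV[R]_3 -> 'rV[R]_3) : Prop :=
  [/\ smooth_on (@sphere2 R) f,
      set_inj (@sphere2 R) f,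
      (forall U phi, sphere_chart U phi ->
         forall u, U u -> immersive_at (f \o phi) u) &
      forall A : set 'rV[R]_3, open A -> exists2 B : set 'rV[R]_3, open B &
        f @` (@sphere2 R `&` A) = (f @` @sphere2 R) `&` B].

(* The unbounded part of the complement of M; for an embedded sphere, the
   outside. *)
Definition exterior (R : realType) (M : set 'rV[R]_3) : set 'rV[R]_3 :=
  [set p | (~` M) p /\ ~ bounded_set (connected_component (~` M) p)].

Definition outward_unit_normal (R : realType)
    (f nu : 'rV[R]_3 -> 'rV[R]_3) : Prop :=
  forall z, @sphere2 R z ->
  [/\ dotv (nu z) (nu z) = 1,
      (forall U phi u v, sphere_chart U phi -> U u -> phi u = z ->
         dotv ('D_v (f \o phi) u) (nu z) = 0) &
      \forall s \near 0^'+, exterior (f @` @sphere2 R) (f z + s *: nu z)].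

Definition first_form (R : realType) (f : 'rV[R]_3 -> 'rV[R]_3)
    (phi : 'rV[R]_2 -> 'rV[R]_3) (u : 'rV[R]_2) : 'M[R]_2 :=
  \matrix_(i, j) dotv (partial i (f \o phi) u) (partial j (f \o phi) u).

Definition second_form (R : realType) (f nu : 'rV[R]_3 -> 'rV[R]_3)
    (phi : 'rV[R]_2 -> 'rV[R]_3) (u : 'rV[R]_2) : 'M[R]_2 :=
  \matrix_(i, j) - dotv (partial i (partial j (f \o phi)) u) (nu (phi u)).

(* k1, k2 are, with multiplicity and in either order, the eigenvalues of the
   second form with respect to the first one at z. These do not depend on the
   chart around z. *)
Definition principal_curvatures (R : realType) (f nu : 'rV[R]_3 -> 'rV[R]_3)
    (z : 'rV[R]_3) (k1 k2 : R) : Prop :=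
  exists U phi u, [/\ sphere_chart U phi, U u, phi u = z &
    char_poly (invmx (first_form f phi u) *m second_form f nu phi u) =
      ('X - k1%:P) * ('X - k2%:P)].

Definition strictly_convex (R : realType)
    (f nu : 'rV[R]_3 -> 'rV[R]_3) : Prop :=
  forall z k1 k2, @sphere2 R z -> principal_curvatures f nu z k1 k2 ->
    0 < k1 /\ 0 < k2.

(* The supremum is taken in the extended reals, so that it has no default
   value. *)
Definition pinching_ratio (R : realType)
    (f nu : 'rV[R]_3 -> 'rV[R]_3) : \bar R :=
  ereal_sup [set r | exists z k1 k2,
    [/\ @sphere2 R z, principal_curvatures f nu z k1 k2 &
        r = (Num.max k1 k2 / Num.min k1 k2)%:E]].

(* S^2 x [0, T), with T possibly infinite *)
Definition spacetime (R : realType) (T : \bar R) : set ('rV[R]_3 * R) :=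
  [set p | [/\ @sphere2 R p.1, 0 <= p.2 & (p.2%:E < T)%E]].

Definition pos_cone (R : realType) : set (R * R) :=
  [set p | 0 < p.1 /\ 0 < p.2].

(* The derivative in time is two-sided for t > 0 and one-sided at t = 0. *)
Definition curvature_flow (R : realType) (F : R * R -> R) (T : \bar R)
    (x nu : 'rV[R]_3 -> R -> 'rV[R]_3) : Prop :=
  forall z t k1 k2, spacetime T (z, t) ->
    principal_curvatures (x^~ t) (nu^~ t) z k1 k2 ->
    h^-1 *: (x z (t + h) - x z t) @[h --> within [set h | 0 <= t + h] 0^']
      --> - F (k1, k2) *: nu z t.

(* Main.v *)
Require Import Defs.
From HB Require Import structures.
From mathcomp Require Import all_boot all_order all_algebra.
From mathcomp Require Import all_classical all_reals all_analysis.
From mathcomp Require Import ring lra.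
Import Order.TTheory GRing.Theory Num.Theory.
Import numFieldNormedType.Exports.
Set Implicit Arguments.
Unset Strict Implicit.
Unset Printing Implicit Defensive.
Local Open Scope classical_set_scope.
Local Open Scope ring_scope.

(* Let s = |k1 - k2| / (k1 + k2) = sqrt (1 - 4 K / H^2), with H the sum and K the
   product of the principal curvatures. The ratio of the curvatures is
   (1 + s) / (1 - s), and it is at most r0 exactly when alpha s <= 1. At a spatial
   maximum of s with 0 < s <= 1 / alpha the principal curvatures are distinct, so
   there are coordinates which at that point are orthonormal and principal and
   have vanishing Christoffel symbols. In these the evolution equations of the
   two fundamental forms, the Codazzi equations and Simons' identity express the
   time derivative of s by the Hessian of s, the gradient of H (the gradient of
   s vanishes) and the curvatures; all terms have the good sign when
   alpha s <= 1 and the zeroth order term is strictly negative, so that s decreases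
   there. Since the sphere is compact, s can therefore never exceed a level
   l <= 1 / alpha which it does not exceed at time 0: look at the infimum of
   the times at which it does. *)

(** * Smooth maps *)

(** The square s^2 = 1 - 4 K / H^2 is rational in the coefficients of the two fundamental forms,
    hence smooth even at umbilics, where the single principal curvatures need not be; its root is
    taken only near points where s = l > 0. Homogeneity gives F = H^alpha phi(s), so at a critical
    point of s the pure second derivatives of the speed contain phi and phi' but not phi'', and
    positivity of the partial derivatives of F becomes two linear inequalities for phi and phi'. The
    Hessian of H enters only through k1 H_22 - k2 H_11, which Simons' identity and the second
    derivatives of 4 K = H^2 (1 - s^2) express by the other terms. The one coefficient of doubtful
    sign, that of (H_1 / H)^2, is a positive multiple of 1 - alpha s: this is the origin of r0. Two
    obstacles shape the rest: x lives on [0, T) only, and nu is given only pointwise. Locally x is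
    replaced by a smooth extension W to all nearby times, so that the flow equation is known at
    valid times only and is differentiated only along time slices; nu is replaced by a normalized
    cross product, whose sign is forced by the positive mean curvature. *)

Section class_C_theory.
Context {R : realType}.
Implicit Types V W : normedModType R.

Lemma near_eq_differentiable V W (f g : V -> W) (x : V) :
  (\near x, f x = g x) -> differentiable f x -> differentiable g x.
Proof.
move=> fg df.
have [cdf fE] := (diff_locallyP _ _).1 df.
have gE : g \o shift x = cst (g x) + 'd f x +o_ 0 id.
  apply/eqaddoP => e e0.
  have /eqaddoP/(_ e e0) := fE; apply: filter_app.
  have : \forall h \near 0, f (h + x) = g (h + x).
    have cx : (h + x) @[h --> 0] --> x.
      by rewrite -[X in _ --> X]add0r; apply: cvgD; [exact: cvg_id|exact: cvg_cst].
    exact: cx fg.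
  apply: filterS => h /= hfg.
  by rewrite /= -![(_ + _ : _ -> _) _]/(_ + _) -![(- _ : _ -> _) _]/(- _) /cst /=
     hfg (nbhs_singleton fg).
by apply/diff_locallyP; rewrite (diff_unique cdf gE).
Qed.

Lemma open_near_eq V W (U : set V) (f g : V -> W) p :
  open U -> (forall q, U q -> f q = g q) -> U p -> \near p, f p = g p.
Proof. by move=> oU fg Up; near do apply: fg; exact: open_nbhs_nbhs. Unshelve. all: by end_near. Qed.

Lemma class_C_ext V W k (U : set V) (f g : V -> W) :
  open U -> (forall p, U p -> f p = g p) -> class_C k U f -> class_C k U g.
Proof.
move=> oU; elim: k f g => [|k IH] f g fg /=.
  move=> cf p Up; have h : f x @[x --> p] --> f p := cf p Up.
  rewrite (fg p Up) in h; apply: cvg_trans h.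
  by apply: near_eq_cvg; exact: (open_near_eq oU).
case=> df cf; split.
  by move=> p Up; apply: near_eq_differentiable (df p Up); exact: (open_near_eq oU fg Up).
move=> v; apply: IH (cf v) => p Up.
by apply: near_eq_derive; exact: (open_near_eq oU fg Up).
Qed.

Lemma class_C_sub V W k (U U' : set V) (f : V -> W) :
  U `<=` U' -> class_C k U' f -> class_C k U f.
Proof.
move=> UU'; elim: k f => [|k IH] f /=; first by move=> cf p /UU'; exact: cf.
by case=> df cf; split=> [p /UU'|v]; [exact: df|exact: IH].
Qed.

Lemma class_CW V W k (U : set V) (f : V -> W) : class_C k.+1 U f -> class_C k U f.
Proof.
elim: k f => [|k IH] f [df cf]; first by move=> p /df /differentiable_continuous.
by split=> // v; exact: IH.
Qed.

Lemma class_C_cst V W k (U : set V) (a : W) : class_C k U (fun=> a).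
Proof.
elim: k a => [|k IH] a; first by move=> p _; exact: cvg_cst.
split=> [p _|v]; first exact: differentiable_cst.
rewrite (_ : (fun p : V => 'D_v (fun=> a) p) = fun=> 0); first exact: IH.
by apply/funext => p; exact: derive_cst.
Qed.

Lemma class_C_lin V W k (U : set V) (f : {linear V -> W}) :
  continuous f -> class_C k U f.
Proof.
move=> cf; case: k => [|k]; first by move=> p _; exact: cf.
split=> [p _|v]; first exact: linear_differentiable.
rewrite (_ : (fun p : V => 'D_v f p) = fun=> f v); first exact: class_C_cst.
apply/funext => p; rewrite deriveE; last exact: linear_differentiable.
by rewrite diff_lin.
Qed.

Lemma class_C_linP V W k (U : set V) (f : V -> W) :
  linear f -> continuous f -> class_C k U f.
Proof.
move=> lf cf; pose L := GRing.isLinear.Build _ _ _ _ f lf.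
pose f' : {linear V -> W} := HB.pack f L.
exact: (@class_C_lin _ _ k U f').
Qed.

Lemma class_CD V W k (U : set V) (f g : V -> W) : open U ->
  class_C k U f -> class_C k U g -> class_C k U (fun p => f p + g p).
Proof.
move=> oU; elim: k f g => [|k IH] f g.
  by move=> cf cg p Up; apply: cvgD; [exact: cf|exact: cg].
case=> df cf [dg cg]; split=> [p Up|v].
  by apply: differentiableD; [exact: df|exact: dg].
apply: (class_C_ext oU) (IH _ _ (cf v) (cg v)) => p Up.
by rewrite [RHS](@deriveD _ _ _ f g) //; apply: diff_derivable; [exact: df|exact: dg].
Qed.

Lemma class_CM V k (U : set V) (f g : V -> R) : open U ->
  class_C k U f -> class_C k U g -> class_C k U (fun p => f p * g p).
Proof.
move=> oU; elim: k f g => [|k IH] f g.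
  by move=> cf cg p Up; apply: cvgM; [exact: cf|exact: cg].
move=> Cf Cg; have := Cf; have := Cg.
case=> dg cg [df cf]; split=> [p Up|v].
  by apply: differentiableM; [exact: df|exact: dg].
apply: (class_C_ext oU) (class_CD oU (IH _ _ (class_CW Cf) (cg v))
  (IH _ _ (class_CW Cg) (cf v))) => p Up.
by rewrite [RHS](@deriveM _ _ f g) //; apply: diff_derivable; [exact: df|exact: dg].
Qed.

Lemma class_CZl V W k (U : set V) (f : V -> R) (w : W) : open U ->
  class_C k U f -> class_C k U (fun p => f p *: w).
Proof.
move=> oU; elim: k f => [|k IH] f.
  by move=> cf p Up; apply: cvgZr_tmp; exact: cf.
case=> df cf; split=> [p Up|v].
  by apply: differentiableZl; exact: df.
apply: (class_C_ext oU) (IH _ (cf v)) => p Up.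
rewrite [RHS]deriveE; last by apply: differentiableZl; exact: df.
by rewrite diffZl ?deriveE//; exact: df.
Qed.

Lemma class_C_sum V W k (U : set V) n (f : 'I_n -> V -> W) : open U ->
  (forall i, class_C k U (f i)) -> class_C k U (fun p => \sum_i f i p).
Proof.
move=> oU; elim: n f => [|n IH] f Cf.
  apply: (class_C_ext oU) (class_C_cst k U 0) => p _; by rewrite big_ord0.
apply: (class_C_ext oU) (class_CD oU (Cf ord0) (IH _ (fun i => Cf (lift ord0 i)))).
by move=> p _; rewrite big_ord_recl.
Qed.

Lemma powR_differentiable V (f : V -> R) p a :
  0 < f p -> differentiable f p -> differentiable (fun q => f q `^ a) p.
Proof.
move=> fp df; apply: (@differentiable_comp _ _ _ _ f (fun y => y `^ a)) => //.
by apply/derivable1_diffP; have [] := is_derive1_powR a fp.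
Qed.

Lemma derive_powR V (f : V -> R) p a v :
  0 < f p -> differentiable f p ->
  'D_v (fun q => f q `^ a) p = a * f p `^ (a - 1) * 'D_v f p.
Proof.
move=> fp df; rewrite deriveE; last exact: powR_differentiable.
have dg : differentiable (fun y : R => y `^ a) (f p).
  by apply/derivable1_diffP; have [] := is_derive1_powR a fp.
rewrite (@diff_comp _ _ _ _ f (fun y => y `^ a)) //= -[in LHS](deriveE v df).
set c : R := 'D_v f p.
have -> : 'd (fun y : R => y `^ a) (f p) c = c *: 'd (fun y : R => y `^ a) (f p) 1.
  by rewrite -linearZ /= [c *: 1]mulr1.
rewrite -(deriveE (1 : R) dg).
by have [_ ->] := is_derive1_powR a fp; rewrite [LHS]mulrC.
Qed.

(** The exponent is quantified inside the induction on [k], since differentiation replaces [a] by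
    [a - 1]. *)
Lemma class_C_powR V k (U : set V) (f : V -> R) a : open U ->
  (forall p, U p -> 0 < f p) -> class_C k U f -> class_C k U (fun p => f p `^ a).
Proof.
move=> oU f0; elim: k a => [|k IH] a Cf.
  move=> p Up; apply: (@continuous_comp _ _ _ f (fun y => y `^ a)); first exact: Cf.
  apply: differentiable_continuous; apply/derivable1_diffP.
  by have [] := is_derive1_powR a (f0 p Up).
have [df cf] := Cf; split=> [p Up|v].
  by apply: powR_differentiable; [exact: f0|exact: df].
have h1 := class_CM oU (class_C_cst k U a) (IH (a - 1) (class_CW Cf)).
apply: (class_C_ext oU) (class_CM oU h1 (cf v)) => p Up.
by rewrite derive_powR //; [exact: f0|exact: df].
Qed.

(** The inner map is written in a finite system of fixed vectors [e i]: the derivative of the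
    composite is then a sum of products of scalar functions with ['D_(e i) g] taken in fixed
    directions, again composed with the same inner map, and the induction on [k] closes. *)
Lemma class_C_comp V V' k (U : set V) (U' : set V') n
    (c : 'I_n -> V -> R) (e : 'I_n -> V') (g : V' -> R) :
  open U -> open U' -> (forall p, U p -> U' (\sum_i c i p *: e i)) ->
  (forall i, class_C k U (c i)) -> class_C k U' g ->
  class_C k U (fun p => g (\sum_i c i p *: e i)).
Proof.
move=> oU oU' UU' Cc.
have Csum : class_C k U (fun p => \sum_i c i p *: e i).
  by apply: class_C_sum => // i; exact: class_CZl.
elim: k g Cc Csum => [|k IH] g Cc Csum Cg.
  move=> p Up; apply: (@continuous_comp _ _ _ (fun p => \sum_i c i p *: e i) g).
    exact: Csum.
  by apply: Cg; exact: UU'.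
have [dg cg] := Cg; have [ds cs] := Csum.
have dgc p : U p -> differentiable (fun q => g (\sum_i c i q *: e i)) p.
  move=> Up; apply: (@differentiable_comp _ _ _ _ _ g); first exact: ds.
  by apply: dg; exact: UU'.
split=> // v.
have h i : class_C k U (fun p => 'D_(e i) g (\sum_i c i p *: e i)).
  by apply: (IH ('D_(e i) g)); [move=> j|..]; [exact: class_CW|exact: class_CW|exact: cg].
apply: (class_C_ext oU) (class_C_sum oU (fun i => class_CM oU ((Cc i).2 v) (h i))).
move=> p Up /=; rewrite [RHS]deriveE; last exact: dgc.
rewrite (@diff_comp _ _ _ _ _ g) /=; [|exact: ds|by apply: dg; exact: UU'].
rewrite -[X in 'd _ _ X]deriveE; last exact: ds.
have -> : 'D_v (fun q => \sum_i c i q *: e i) p = \sum_i 'D_v (c i) p *: e i.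
  rewrite (_ : (fun q => \sum_i c i q *: e i) = \sum_i (fun q => c i q *: e i)); last first.
    by apply/funext => q; rewrite fct_sumE.
  have dc i : differentiable (c i) p by exact: (Cc i).1.
  have dce i : differentiable (fun q => c i q *: e i) p by exact: differentiableZl.
  rewrite derive_sum; last by move=> i; apply: diff_derivable.
  by apply: eq_bigr => i _; rewrite deriveE // diffZl // deriveE.
rewrite linear_sum; apply: eq_bigr => i _; rewrite linearZ /=.
by rewrite [in LHS](deriveE (e i) (dg _ (UU' _ Up))).
Qed.

End class_C_theory.

(** One open set serves for all orders [k], so that smoothness at [p] persists at all nearby
    points. *)
Definition smooth_at {R : realType} {V W : normedModType R} (f : V -> W) (p : V) :=
  exists U : set V, [/\ open U, U p & forall k, class_C k U f].

(** * Smoothness at a point: closure properties and rules of differentiation *)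

Section smooth_at_theory.
Context {R : realType}.
Implicit Types V W : normedModType R.

Lemma smooth_at_near V W (f : V -> W) p :
  smooth_at f p -> \forall q \near p, smooth_at f q.
Proof.
by case=> U [oU Up Cf]; near=> q; exists U; split => //; near: q; exact: open_nbhs_nbhs.
Unshelve. all: by end_near. Qed.

Lemma smooth_at_differentiable V W (f : V -> W) p : smooth_at f p -> differentiable f p.
Proof. by case=> U [oU Up Cf]; exact: (Cf 1%N).1. Qed.

Lemma smooth_at_derivable V W (f : V -> W) p v : smooth_at f p -> derivable f p v.
Proof. by move=> /smooth_at_differentiable; exact: diff_derivable. Qed.

Lemma smooth_at_continuous V W (f : V -> W) p : smooth_at f p -> {for p, continuous f}.
Proof. by move=> /smooth_at_differentiable; exact: differentiable_continuous. Qed.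

Lemma smooth_at_derive V W (f : V -> W) p v : smooth_at f p -> smooth_at ('D_v f) p.
Proof. by case=> U [oU Up Cf]; exists U; split => // k; exact: (Cf k.+1).2. Qed.

Lemma smooth_at_ext V W (f g : V -> W) p :
  (\forall q \near p, f q = g q) -> smooth_at f p -> smooth_at g p.
Proof.
move=> fg [U [oU Up Cf]].
have [U' [oU' U'p] U'fg] : exists2 U', open_nbhs p U' & U' `<=` [set q | f q = g q].
  by move: fg; rewrite -nbhs_nearE nbhsE.
exists (U `&` U'); split; [exact: openI|by []|move=> k].
apply: (class_C_ext (openI oU oU')) (class_C_sub _ (Cf k)) => q [Uq U'q] //.
exact: U'fg.
Qed.

Lemma smooth_at_cst V W (a : W) (p : V) : smooth_at (fun=> a) p.
Proof. by exists setT; split => //; [exact: openT|move=> k; exact: class_C_cst]. Qed.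

Lemma smooth_at_lin V W (f : V -> W) p : linear f -> continuous f -> smooth_at f p.
Proof. by exists setT; split => //; [exact: openT|move=> k; exact: class_C_linP]. Qed.

Let common V W W' (f : V -> W) (g : V -> W') p : smooth_at f p -> smooth_at g p ->
  exists U : set V, [/\ open U, U p, forall k, class_C k U f & forall k, class_C k U g].
Proof.
move=> [U [oU Up Cf]] [U' [oU' U'p Cg]]; exists (U `&` U').
split; [exact: openI|by []| |] => k.
  by apply: class_C_sub (Cf k) => ? [].
by apply: class_C_sub (Cg k) => ? [].
Qed.

Lemma smooth_atD V W (f g : V -> W) p :
  smooth_at f p -> smooth_at g p -> smooth_at (fun q => f q + g q) p.
Proof.
move=> sf sg; have [U [oU Up Cf Cg]] := common sf sg.
by exists U; split => // k; exact: class_CD.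
Qed.

Lemma smooth_atM V (f g : V -> R) p :
  smooth_at f p -> smooth_at g p -> smooth_at (fun q => f q * g q) p.
Proof.
move=> sf sg; have [U [oU Up Cf Cg]] := common sf sg.
by exists U; split => // k; exact: class_CM.
Qed.

Lemma smooth_atZl V W (f : V -> R) (w : W) p :
  smooth_at f p -> smooth_at (fun q => f q *: w) p.
Proof. by move=> [U [oU Up Cf]]; exists U; split => // k; exact: class_CZl. Qed.

Lemma smooth_atcM V (a : R) (f : V -> R) p :
  smooth_at f p -> smooth_at (fun q => a * f q) p.
Proof. by move=> sf; apply: smooth_atM => //; exact: smooth_at_cst. Qed.

Lemma smooth_atN V (f : V -> R) p :
  smooth_at f p -> smooth_at (fun q => - f q) p.
Proof.
move=> sf; apply: smooth_at_ext (smooth_atcM (-1) sf).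
by apply: nearW => q; rewrite mulN1r.
Qed.

Lemma smooth_atB V (f g : V -> R) p :
  smooth_at f p -> smooth_at g p -> smooth_at (fun q => f q - g q) p.
Proof. by move=> sf sg; apply: smooth_atD => //; exact: smooth_atN. Qed.

Lemma smooth_at_sum V W n (f : 'I_n -> V -> W) p :
  (forall i, smooth_at (f i) p) -> smooth_at (fun q => \sum_i f i q) p.
Proof.
elim: n f => [|n IH] f Cf.
  by apply: smooth_at_ext (smooth_at_cst 0 p); apply: nearW => q; rewrite big_ord0.
apply: smooth_at_ext (smooth_atD (Cf ord0) (IH _ (fun i => Cf (lift ord0 i)))).
by apply: nearW => q; rewrite big_ord_recl.
Qed.

Lemma smooth_at_near_gt V (f : V -> R) a p :
  smooth_at f p -> a < f p -> \forall q \near p, a < f q.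
Proof.
move=> /smooth_at_continuous cf; have cf' : f q @[q --> p] --> f p := cf.
exact: cvgr_gt cf' _.
Qed.

Lemma smooth_at_near_lt V (f : V -> R) a p :
  smooth_at f p -> f p < a -> \forall q \near p, f q < a.
Proof.
move=> /smooth_at_continuous cf; have cf' : f q @[q --> p] --> f p := cf.
exact: cvgr_lt cf' _.
Qed.

Lemma smooth_at_powR V (f : V -> R) a p :
  0 < f p -> smooth_at f p -> smooth_at (fun q => f q `^ a) p.
Proof.
move=> f0 sf; have := smooth_at_near_gt sf f0.
rewrite -nbhs_nearE nbhsE => -[U' [oU' U'p] U'f].
have [U [oU Up Cf]] := sf.
exists (U `&` U'); split; [exact: openI|by []|move=> k].
apply: class_C_powR; [exact: openI| by move=> q [_ /U'f]|].
by apply: class_C_sub (Cf k) => ? [].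
Qed.

(** Obtained from the real power [-1], whence positivity rather than [f p != 0]; all denominators
    that occur later are positive. *)
Lemma smooth_atV V (f : V -> R) p :
  0 < f p -> smooth_at f p -> smooth_at (fun q => (f q)^-1) p.
Proof.
move=> f0 sf; apply: smooth_at_ext (smooth_at_powR (-1) f0 sf).
by apply: filterS (smooth_at_near_gt sf f0) => q fq; rewrite powR_inv1 // ltW.
Qed.

Lemma smooth_at_sqrt V (f : V -> R) p :
  0 < f p -> smooth_at f p -> smooth_at (fun q => Num.sqrt (f q)) p.
Proof.
move=> f0 sf; apply: smooth_at_ext (smooth_at_powR (2^-1) f0 sf).
by apply: filterS (smooth_at_near_gt sf f0) => q fq; rewrite powR12_sqrt // ltW.
Qed.

(** The open set on which [g] is smooth is pulled back through the inner map, whose continuity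
    follows from that of its coefficients; there [class_C_comp] applies. *)
Lemma smooth_at_comp_basis V V' n (c : 'I_n -> V -> R) (e : 'I_n -> V') (g : V' -> R) p :
  (forall i, smooth_at (c i) p) -> smooth_at g (\sum_i c i p *: e i) ->
  smooth_at (fun q => g (\sum_i c i q *: e i)) p.
Proof.
move=> sc [U' [oU' U'p Cg]].
pose s q := \sum_i c i q *: e i.
have [U [oU Up CU]] : exists U : set V, [/\ open U, U p & forall i k, class_C k U (c i)].
  elim: n c sc {e U'p s} => [|n IH] c sc.
    by exists setT; split => //; [exact: openT|case].
  have [U [oU Up CU]] := IH _ (fun i => sc (lift ord0 i)).
  have [U0 [oU0 U0p CU0]] := sc ord0.
  exists (U `&` U0); split; [exact: openI|by []|move=> i k].
  have [j ->|->] := unliftP ord0 i.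
    by apply: class_C_sub (CU j k) => ? [].
  by apply: class_C_sub (CU0 k) => ? [].
have cs q : U q -> {for q, continuous s}.
  move=> Uq; apply: smooth_at_continuous; apply: smooth_at_sum => i.
  by apply: smooth_atZl; exists U; split.
have oUU' : open (U `&` s @^-1` U').
  rewrite openE => q [Uq U'q]; rewrite /interior.
  apply: filterI; first exact: open_nbhs_nbhs.
  by apply: cs => //; exact: open_nbhs_nbhs.
exists (U `&` s @^-1` U'); split => // k.
apply: (@class_C_comp _ _ _ _ _ U') => //; first by move=> q [].
by move=> i; apply: class_C_sub (CU i k) => ? [].
Qed.

Lemma smooth_at_comp1 V (f : V -> R) (g : R -> R) p :
  smooth_at f p -> smooth_at g (f p) -> smooth_at (fun q => g (f q)) p.
Proof.
have E q : \sum_(i < 1) f q *: (1 : R) = f q by rewrite big_ord1 [LHS]mulr1.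
move=> sf sg.
have := @smooth_at_comp_basis V R 1%N (fun=> f) (fun=> 1) g p (fun=> sf).
rewrite E => /(_ sg); apply: smooth_at_ext; apply: nearW => q.
by rewrite E.
Qed.

Lemma smooth_at_comp2 V (f h : V -> R) (g : R * R -> R) p :
  smooth_at f p -> smooth_at h p -> smooth_at g (f p, h p) ->
  smooth_at (fun q => g (f q, h q)) p.
Proof.
move=> sf sh.
pose c (i : 'I_2) := if i == 0 then f else h.
pose e (i : 'I_2) : R * R := if i == 0 then (1, 0) else (0, 1).
have E q : \sum_i c i q *: e i = (f q, h q).
  rewrite big_ord_recl big_ord1 /c /e /=.
  congr pair; [change (f q * 1 + h q * 0 = f q)|change (f q * 0 + h q * 1 = h q)];
    by ring.
have sc i : smooth_at (c i) p by rewrite /c; case: ifP.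
move=> sg; have := @smooth_at_comp_basis V _ _ c e g p sc.
by rewrite E => /(_ sg); apply: smooth_at_ext; apply: nearW => q; rewrite E.
Qed.

Lemma smooth_at_coord V n (f : V -> 'rV[R]_n) p i :
  smooth_at f p -> smooth_at (fun q => f q 0 i) p.
Proof.
move=> [U [oU Up Cf]].
have cl : continuous (fun M : 'rV[R]_n => M 0 i).
  by move=> M; apply: differentiable_continuous; exact: differentiable_coord.
suff h k (g : V -> 'rV[R]_n) : class_C k U g -> class_C k U (fun q => g q 0 i).
  by exists U; split => // k; exact: h.
elim: k g => [|k IH] g.
  by move=> cg q Uq; apply: (@continuous_comp _ _ _ g (fun M => M 0 i)); [exact: cg|exact: cl].
move=> [dg cg]; split=> [q Uq|v].
  apply: (@differentiable_comp _ _ _ _ g (fun M => M 0 i)); first exact: dg.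
  exact: differentiable_coord.
apply: (class_C_ext oU) (IH _ (cg v)) => q Uq.
by rewrite derive_mx ?mxE//; apply: diff_derivable; exact: dg.
Qed.

Lemma smooth_at_rV V n (f : V -> 'rV[R]_n) p :
  (forall i, smooth_at (fun q => f q 0 i) p) -> smooth_at f p.
Proof.
move=> sf.
pose F i q : 'rV[R]_n := f q 0 i *: delta_mx 0 i.
have sF i : smooth_at (F i) p by exact: smooth_atZl.
apply: smooth_at_ext (smooth_at_sum sF); apply: nearW => q.
by rewrite /F -row_sum_delta.
Qed.

Lemma derive_coord V n (f : V -> 'rV[R]_n) p v i : derivable f p v ->
  ('D_v f p) 0 i = 'D_v (fun q => f q 0 i) p.
Proof. by move=> df; rewrite derive_mx // mxE. Qed.

Lemma smooth_at_comp_rV V n m (f : V -> 'rV[R]_n) (g : 'rV[R]_n -> 'rV[R]_m) p :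
  smooth_at f p -> smooth_at g (f p) -> smooth_at (fun q => g (f q)) p.
Proof.
move=> sf sg; apply: smooth_at_rV => i.
have E q : \sum_j f q 0 j *: (delta_mx 0 j : 'rV[R]_n) = f q by rewrite -row_sum_delta.
have := @smooth_at_comp_basis V _ _ (fun j q => f q 0 j) (fun j => delta_mx 0 j)
  (fun M => g M 0 i) p (fun j => smooth_at_coord j sf).
rewrite E => /(_ (smooth_at_coord _ sg)); apply: smooth_at_ext.
by apply: nearW => q; rewrite E.
Qed.

Lemma smooth_at_comp_pair V n m (f : V -> 'rV[R]_n) (h : V -> R)
    (g : 'rV[R]_n * R -> 'rV[R]_m) p :
  smooth_at f p -> smooth_at h p -> smooth_at g (f p, h p) ->
  smooth_at (fun q => g (f q, h q)) p.
Proof.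
move=> sf sh sg; apply: smooth_at_rV => i.
pose c (j : 'I_n.+1) q := if unlift ord0 j is Some j' then f q 0 j' else h q.
pose e (j : 'I_n.+1) : 'rV[R]_n * R :=
  if unlift ord0 j is Some j' then (delta_mx 0 j', 0) else (0, 1).
have E q : \sum_j c j q *: e j = (f q, h q).
  rewrite big_ord_recl /c /e unlift_none.
  under eq_bigr do rewrite liftK.
  rewrite (_ : \sum_(i0 < n) _ = (f q, 0)).
    by congr pair => /=; rewrite ?scaler0 ?add0r// addr0 [LHS]mulr1.
  rewrite [in RHS](row_sum_delta (f q)).
  apply: (big_ind2 (fun (x : 'rV[R]_n * R) y => x = (y, 0))) => //.
    by move=> x1 x2 y1 y2 -> ->; congr pair; rewrite /= addr0.
  by move=> j _; congr pair; rewrite /= [LHS]mulr0.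
have sc j : smooth_at (c j) p.
  by rewrite /c; case: unliftP => [j' _|_] //; exact: smooth_at_coord.
have := @smooth_at_comp_basis V _ _ c e (fun M => g M 0 i) p sc.
rewrite E => /(_ (smooth_at_coord _ sg)); apply: smooth_at_ext.
by apply: nearW => q; rewrite E.
Qed.

Lemma smooth_at_dotv V n (f g : V -> 'rV[R]_n) p :
  smooth_at f p -> smooth_at g p -> smooth_at (fun q => dotv (f q) (g q)) p.
Proof.
move=> sf sg.
have := @smooth_at_sum V _ n (fun i q => f q 0 i * g q 0 i) p
  (fun i => smooth_atM (smooth_at_coord i sf) (smooth_at_coord i sg)).
apply: smooth_at_ext; apply: nearW => q.
by rewrite /dotv mxE; apply: eq_bigr => i _; rewrite mxE.
Qed.

Lemma derive_dotv V n (f g : V -> 'rV[R]_n) p v :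
  smooth_at f p -> smooth_at g p ->
  'D_v (fun q => dotv (f q) (g q)) p = dotv ('D_v f p) (g p) + dotv (f p) ('D_v g p).
Proof.
move=> sf sg.
rewrite (_ : (fun q => dotv (f q) (g q)) =
   \sum_(i < n) ((fun q => f q 0 i) * (fun q => g q 0 i))); last first.
  by apply/funext => q; rewrite fct_sumE /dotv mxE; apply: eq_bigr => i _; rewrite mxE.
have df i : derivable (fun q => f q 0 i) p v.
  by apply: smooth_at_derivable; exact: smooth_at_coord.
have dg i : derivable (fun q => g q 0 i) p v.
  by apply: smooth_at_derivable; exact: smooth_at_coord.
rewrite derive_sum; last by move=> i; exact: derivableM.
rewrite /dotv !mxE -big_split; apply: eq_bigr => i _ /=.
rewrite deriveM // !mxE !derive_coord; [|exact: smooth_at_derivable..].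
by rewrite addrC; congr (_ + _); rewrite [LHS]mulrC.
Qed.

Lemma deriveDs V W (f g : V -> W) p v : smooth_at f p -> smooth_at g p ->
  'D_v (fun q => f q + g q) p = 'D_v f p + 'D_v g p.
Proof. by move=> sf sg; apply: deriveD; exact: smooth_at_derivable. Qed.

Lemma deriveMs V (f g : V -> R) p v : smooth_at f p -> smooth_at g p ->
  'D_v (fun q => f q * g q) p = 'D_v f p * g p + f p * 'D_v g p.
Proof.
move=> sf sg; rewrite [LHS](@deriveM _ _ f g); [|exact: smooth_at_derivable..].
by rewrite addrC; congr (_ + _); rewrite [LHS]mulrC.
Qed.

Lemma deriveNs V (f : V -> R) p v : smooth_at f p ->
  'D_v (fun q => - f q) p = - 'D_v f p.
Proof. by move=> sf; apply: deriveN; exact: smooth_at_derivable. Qed.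

Lemma deriveBs V (f g : V -> R) p v : smooth_at f p -> smooth_at g p ->
  'D_v (fun q => f q - g q) p = 'D_v f p - 'D_v g p.
Proof. by move=> sf sg; apply: deriveB; exact: smooth_at_derivable. Qed.

Lemma derive_powRs V (f : V -> R) p a v : 0 < f p -> smooth_at f p ->
  'D_v (fun q => f q `^ a) p = a * f p `^ (a - 1) * 'D_v f p.
Proof. by move=> f0 /smooth_at_differentiable; exact: derive_powR. Qed.

Lemma derive_comp1 V (f : V -> R) (g : R -> R) p v : smooth_at f p -> smooth_at g (f p) ->
  'D_v (fun q => g (f q)) p = 'D_1 g (f p) * 'D_v f p.
Proof.
move=> /smooth_at_differentiable df /smooth_at_differentiable dg.
rewrite deriveE; last exact: (@differentiable_comp _ _ _ _ f g).
rewrite (@diff_comp _ _ _ _ f g) //= -[in LHS](deriveE v df).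
set c : R := 'D_v f p.
have -> : 'd g (f p) c = c *: 'd g (f p) 1 by rewrite -linearZ /= [c *: 1]mulr1.
by rewrite -(deriveE (1 : R) dg) [LHS]mulrC.
Qed.

End smooth_at_theory.

(** * Second derivatives and maxima along lines *)

Section lines.
Context {R : realType} {V : normedModType R}.
Implicit Types (f : V -> R) (p v w : V).

Lemma is_derive_line f p v (h : R) : derivable f (h *: v + p) v ->
  is_derive h 1 (fun s : R => f (s *: v + p)) ('D_v f (h *: v + p)).
Proof.
pose F (s : R) := f (s *: v + p); pose q := h *: v + p.
have E : (fun k : R => k^-1 *: ((F \o shift h) (k *: (1 : R)) - F h)) =
         (fun k : R => k^-1 *: ((f \o shift q) (k *: v) - f q)).
  apply/funext => k; rewrite /F /q /=; congr (_ *: (f _ - _)).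
  by rewrite [k *: 1]mulr1 scalerDl addrA.
move=> df; split; first by rewrite /derivable E.
by rewrite /derive E.
Qed.

Lemma cvg_derive {U : normedModType R} (f : V -> U) p v : derivable f p v ->
  h^-1 *: (f (h *: v + p) - f p) @[h --> (0 : R)^'] --> 'D_v f p.
Proof. by []. Qed.

Lemma line_MVT f p v (h : R) : 0 < h ->
  (forall s, 0 <= s <= h -> differentiable f (s *: v + p)) ->
  exists2 c, 0 < c < h & f (h *: v + p) - f p = h * 'D_v f (c *: v + p).
Proof.
move=> h0 df.
have dl s : 0 <= s <= h -> is_derive s 1 (fun s : R => f (s *: v + p)) ('D_v f (s *: v + p)).
  by move=> sh; apply: is_derive_line; apply: diff_derivable; exact: df.
have [||c] := @MVT R (fun s : R => f (s *: v + p)) (fun s => 'D_v f (s *: v + p)) 0 h h0.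
- by move=> s; rewrite in_itv /= => /andP[s0 sh]; apply: dl; rewrite !ltW.
- apply: derivable_within_continuous => s; rewrite in_itv /= => sh.
  by have [] := dl s sh.
by rewrite in_itv /= scale0r add0r subr0 => ch e; exists c => //; rewrite e mulrC.
Qed.

Lemma cvg_line p v : (h *: v + p) @[h --> (0 : R)] --> p.
Proof.
rewrite -[X in _ --> X]add0r -(scale0r v).
by apply: cvgD; [apply: cvgZr_tmp; exact: cvg_id|exact: cvg_cst].
Qed.

(** If the second derivative were positive, the first derivative, which vanishes at [p], would be
    positive at all nearby points [c *: v + p] with [c > 0], and the mean value theorem would
    produce a value of [f] on the line above [f p]. *)
Lemma derive_max0 f p v : smooth_at f p -> (\forall h \near (0 : R), f (h *: v + p) <= f p) ->
  'D_v f p = 0 /\ 'D_v ('D_v f) p <= 0.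
Proof.
move=> sf fmax.
have sn : \forall h \near (0 : R), smooth_at f (h *: v + p).
  have cl : (h *: v + p) @[h --> (0 : R)] --> p by exact: cvg_line.
  exact: cl (smooth_at_near sf).
have [d /= d0 H] : exists2 d : R, 0 < d & forall h, `|h| < d ->
    f (h *: v + p) <= f p /\ smooth_at f (h *: v + p).
  have /nbhs_ballP[d /= d0 dH] : \forall h \near (0 : R),
      f (h *: v + p) <= f p /\ smooth_at f (h *: v + p) by exact: filterI fmax sn.
  exists d => // h hd.
  by apply: dH; rewrite -ball_normE /ball_ /= sub0r normrN.
have D0 : 'D_v f p = 0.
  have [_ e] : is_derive (0 : R) 1 (fun s : R => f (s *: v + p)) ('D_v f p).
    rewrite -[in 'D_v f p](add0r p) -[X in X + p](scale0r v); apply: is_derive_line.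
    by rewrite scale0r add0r; exact: smooth_at_derivable.
  have [|h||h|_ e'] := @derive1_at_max R (fun s : R => f (s *: v + p)) (- d) d 0.
  - by rewrite ge0_cp // ltW.
  - rewrite in_itv /= => /andP[h1 h2]; apply: ex_derive; apply: is_derive_line.
    by apply: smooth_at_derivable; apply: (H _ _).2; rewrite ltr_norml h1.
  - by rewrite in_itv /= oppr_lt0 d0.
  - rewrite in_itv /= => /andP[h1 h2]; rewrite scale0r add0r.
    by apply: (H _ _).1; rewrite ltr_norml h1.
  exact: (etrans (esym e) e').
split => //; rewrite leNgt; apply/negP => DD.
have sD := smooth_at_derive v sf.
pose g (h : R) := h^-1 *: (('D_v f \o shift p) (h *: v) - 'D_v f p).
have cg : g h @[h --> 0^'] --> 'D_v ('D_v f) p.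
  have : derivable ('D_v f) p v by exact: smooth_at_derivable.
  exact.
have /cvgr_gt := cg => /(_ _ DD); rewrite near_withinE => /nbhs_ballP[e /= e0 eH].
pose h := Num.min d e / 2.
have m0 : 0 < Num.min d e by rewrite lt_min d0.
have h0 : 0 < h by rewrite divr_gt0.
have hm : h < Num.min d e by rewrite ltr_pdivrMr // mulr_natr mulr2n ltrDr.
have [hd he] : h < d /\ h < e by move: hm; rewrite lt_min => /andP.
have [s /andP[s0 sh]|c /andP[c0 ch] E] := @line_MVT f p v h h0.
  apply: smooth_at_differentiable; apply: (H _ _).2.
  by rewrite ger0_norm // (le_lt_trans sh).
have : 0 < g c.
  apply: eH; last by rewrite gt_eqF.
  by rewrite -ball_normE /ball_ /= sub0r normrN gtr0_norm // (lt_trans ch).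
rewrite /g /= D0 subr0 => gc.
have Dc : 0 < 'D_v f (c *: v + p).
  by move: gc; rewrite /GRing.scale /= pmulr_rgt0 // invr_gt0.
have : 0 < f (h *: v + p) - f p by rewrite E mulr_gt0.
rewrite subr_gt0 ltNge => /negP; apply; apply: (H _ _).1.
by rewrite gtr0_norm.
Qed.

Lemma derive_shiftD f (a : V) p v : 'D_v (fun q => f (q + a)) p = 'D_v f (p + a).
Proof.
rewrite /derive; congr (lim _); apply: (congr1 (fun g => g @ 0^')).
by apply/funext => k /=; rewrite addrA.
Qed.

Lemma differentiable_shiftD f (a : V) p :
  differentiable f (p + a) -> differentiable (fun q => f (q + a)) p.
Proof.
move=> df; apply: (@differentiable_comp _ _ _ _ (fun q => q + a) f) => //.
Qed.

Lemma second_difference f p v w (h : R) : 0 < h ->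
  (forall s t, 0 <= s <= h -> 0 <= t <= h -> smooth_at f (s *: v + t *: w + p)) ->
  exists c d, [/\ 0 < c < h, 0 < d < h &
    f (h *: v + h *: w + p) - f (h *: v + p) - (f (h *: w + p) - f p) =
    h * (h * 'D_w ('D_v f) (c *: v + d *: w + p))].
Proof.
move=> h0 sf.
have h00 : 0 <= (0 : R) <= h by rewrite lexx ltW.
have hh : 0 <= h <= h by rewrite lexx ltW.
have sf1 s t : 0 <= s <= h -> 0 <= t <= h -> smooth_at f (s *: v + p + t *: w).
  by move=> ? ?; rewrite addrAC; exact: sf.
pose G q := f (q + h *: w) - f q.
have [s sh|c ch] := @line_MVT G p v h h0.
  apply: differentiableB.
    by apply: differentiable_shiftD; apply: smooth_at_differentiable; exact: sf1 sh hh.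
  apply: smooth_at_differentiable.
  by have := sf1 s 0 sh h00; rewrite scale0r addr0.
rewrite /G => E.
have ch' : 0 <= c <= h by case/andP: ch => ? ?; rewrite !ltW.
have [t th|d dh E2] := @line_MVT ('D_v f) (c *: v + p) w h h0.
  apply: smooth_at_differentiable; apply: smooth_at_derive.
  by rewrite addrC; exact: sf1.
exists c, d; split => //; rewrite (addrAC (h *: v)) [h *: w + p]addrC E; congr (_ * _).
have -> : 'D_v (fun q => f (q + h *: w) - f q) (c *: v + p) =
    'D_v (fun q => f (q + h *: w)) (c *: v + p) - 'D_v f (c *: v + p).
  apply: (@deriveB _ _ _ (fun q => f (q + h *: w))).
    apply: diff_derivable; apply: differentiable_shiftD; apply: smooth_at_differentiable.
    exact: sf1 ch' hh.
  by apply: smooth_at_derivable; have := sf1 c 0 ch' h00; rewrite scale0r addr0.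
rewrite derive_shiftD (addrC (c *: v + p)) E2; congr (h * 'D_w _ _).
by rewrite addrA (addrC (d *: w)).
Qed.

(* Both mixed derivatives are limits of the same symmetric second difference. *)
Lemma derive_comm f p v w : smooth_at f p -> 'D_v ('D_w f) p = 'D_w ('D_v f) p.
Proof.
move=> sf.
suff hle v' w' : 'D_v' ('D_w' f) p <= 'D_w' ('D_v' f) p.
  by apply/eqP; rewrite eq_le; apply/andP; split; exact: hle.
move: v' w' => {}v {}w; apply/ler_addgt0Pr => e e0.
have e20 : 0 < e / 2 by rewrite divr_gt0.
have c1 := smooth_at_continuous (smooth_at_derive v (smooth_at_derive w sf)).
have c2 := smooth_at_continuous (smooth_at_derive w (smooth_at_derive v sf)).
have n1 : \forall q \near p, 'D_v ('D_w f) p - e / 2 < 'D_v ('D_w f) q.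
  by apply: smooth_at_near_gt; [do 2 apply: smooth_at_derive|rewrite ltrBlDr ltrDl].
have n2 : \forall q \near p, 'D_w ('D_v f) q < 'D_w ('D_v f) p + e / 2.
  by apply: smooth_at_near_lt; [do 2 apply: smooth_at_derive|rewrite ltrDl].
have /nbhs_ballP[d /= d0 dH] : \forall q \near p, ('D_v ('D_w f) p - e / 2 < 'D_v ('D_w f) q /\
    'D_w ('D_v f) q < 'D_w ('D_v f) p + e / 2) /\ smooth_at f q.
  exact: filterI (filterI n1 n2) (smooth_at_near sf).
pose M := `|v| + `|w| + 1.
have M0 : 0 < M by rewrite ltr_wpDl // addr_ge0.
pose h := d / M.
have h0 : 0 < h by rewrite divr_gt0.
have inb s t : 0 <= s <= h -> 0 <= t <= h -> ball p d (s *: v + t *: w + p).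
  move=> /andP[s0 sh] /andP[t0 th].
  rewrite -ball_normE /ball_ /= opprD addrCA subrr addr0 normrN.
  apply: le_lt_trans (ler_normD _ _) _; rewrite !normrZ (ger0_norm s0) (ger0_norm t0).
  apply: (@le_lt_trans _ _ (h * `|v| + h * `|w|)).
    by apply: lerD; exact: ler_wpM2r.
  by rewrite -mulrDr /h mulrAC ltr_pdivrMr // ltr_pM2l // ltrDl.
have [s t ? ?|c [c' [ch ch' E]]] := @second_difference f p v w h h0.
  by apply: (dH _ _).2; exact: inb.
have [s t ? ?|k [k' [kh kh' E']]] := @second_difference f p w v h h0.
  by rewrite (addrC (s *: w)); apply: (dH _ _).2; exact: inb.
have lew (x : R) : 0 < x < h -> 0 <= x <= h by case/andP => ? ?; rewrite !ltW.
have q1 := (dH _ (inb _ _ (lew _ ch) (lew _ ch'))).1.2.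
have q2 := (dH _ (inb _ _ (lew _ kh') (lew _ kh))).1.1.
move: E E'; rewrite (addrC (k *: w)) (addrC (h *: w) (h *: v)) => E E'.
have : h * (h * 'D_w ('D_v f) (c *: v + c' *: w + p)) =
       h * (h * 'D_v ('D_w f) (k' *: v + k *: w + p)).
  apply: (etrans (esym E)); apply: (etrans _ E').
  by move: (f (h *: v + h *: w + p)) (f (h *: v + p)) (f (h *: w + p)) (f p) => *; ring.
move=> /(mulfI (lt0r_neq0 h0)) /(mulfI (lt0r_neq0 h0)) EE.
have := lt_trans q2 (eq_ind _ (fun z => z < 'D_w ('D_v f) p + e / 2) q1 _ EE).
by rewrite ltrBlDr -addrA -splitr => /ltW.
Qed.

End lines.

Lemma derive_comm_rV {R : realType} {V : normedModType R} n (f : V -> 'rV[R]_n) p v w :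
  smooth_at f p -> 'D_v ('D_w f) p = 'D_w ('D_v f) p.
Proof.
move=> sf; apply/rowP => i.
have E v1 w1 : ('D_v1 ('D_w1 f) p) 0 i = 'D_v1 ('D_w1 (fun q => f q 0 i)) p.
  rewrite derive_coord; last by apply: smooth_at_derivable; exact: smooth_at_derive.
  apply: near_eq_derive; apply: filterS (smooth_at_near sf) => q sq.
  by rewrite derive_coord //; exact: smooth_at_derivable.
transitivity ('D_v ('D_w (fun q => f q 0 i)) p); first exact: (E v w).
transitivity ('D_w ('D_v (fun q => f q 0 i)) p); last exact: (esym (E w v)).
by apply: derive_comm; exact: smooth_at_coord.
Qed.

(** * Derivatives within time slices and in product spaces *)

Section slices.
Context {R : realType} {V W : normedModType R}.
Implicit Types (f g : V -> W) (p e : V) (A : set V).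

Lemma derive_eq_line f g p e : (\forall h \near (0 : R), f (h *: e + p) = g (h *: e + p)) ->
  'D_e f p = 'D_e g p.
Proof.
move=> fg; rewrite /derive; congr (lim _).
have p0 : f p = g p by have := nbhs_singleton fg; rewrite scale0r add0r.
have H : \forall h \near (0 : R), h^-1 *: ((f \o shift p) (h *: e) - f p) =
    h^-1 *: ((g \o shift p) (h *: e) - g p).
  by move: fg; apply: filterS => h /= fgh; rewrite fgh p0.
have H' : \forall h \near (0 : R), h^-1 *: ((g \o shift p) (h *: e) - g p) =
    h^-1 *: ((f \o shift p) (h *: e) - f p) by move: H; apply: filterS => h ->.
rewrite eqEsubset; split; apply: near_eq_cvg; rewrite near_withinE.
  by move: H'; apply: filterS.
by move: H; apply: filterS.
Qed.

(** In the applications [A] is a time slice, the place where the flow equation can be used. As [A]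
    contains the lines in direction [e], an identity on [A] may be differentiated along [e], and
    repeatedly so, since the conclusion has the shape of the hypothesis. *)
Lemma derive_eq_slice A f g p e : (forall q r, A q -> A (r *: e + q)) ->
  (\forall q \near p, A q -> f q = g q) -> \forall q \near p, A q -> 'D_e f q = 'D_e g q.
Proof.
move=> Ae fg; apply: filterS (near_join fg) => q fgq Aq; apply: derive_eq_line.
have cl : (h *: e + q) @[h --> (0 : R)] --> q by exact: cvg_line.
have H : \forall h \near (0 : R), A (h *: e + q) -> f (h *: e + q) = g (h *: e + q).
  exact: cl fgq.
by move: H; apply: filterS => h fgh; apply: fgh; exact: Ae.
Qed.

End slices.

Section product_space.
Context {R : realType} {V U : normedModType R}.

Lemma derive_slice (W : V * R -> U) (v w : V) (t : R) :
  'D_(w, 0) W (v, t) = 'D_w (fun u => W (u, t)) v.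
Proof.
rewrite /derive; apply: (congr1 (fun g => lim (g @ 0^'))); apply/funext => h /=.
by congr (_ *: (W _ - _)); congr pair; rewrite /= [h *: 0]mulr0 add0r.
Qed.

(** The two difference quotients coincide, because [psi] does not involve time. *)
Lemma derive_time_reparam {V' : normedModType R} (W : V' * R -> U) (psi : V -> V') (v : V) (t : R) :
  'D_(0, 1) (fun P => W (psi P.1, P.2)) (v, t) = 'D_(0, 1) W (psi v, t).
Proof.
rewrite /derive; apply: (congr1 (fun g => lim (g @ 0^'))); apply/funext => h /=.
have e1 : ((h *: ((0, 1) : V * R)).1 + v : V) = v by rewrite /= scaler0 add0r.
have e2 : (h *: ((0, 1) : V' * R)).1 + psi v = psi v by rewrite /= scaler0 add0r.
by congr (_ *: (W (_, _) - _)); [transitivity (psi v); [congr psi; exact: e1|exact: esym e2]].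
Qed.

End product_space.

(** * Linear algebra of the two fundamental forms *)

Lemma ord3_ind (P : 'I_3 -> Prop) : P 0 -> P 1 -> P 2%:R -> forall i, P i.
Proof.
move=> P0 P1 P2; case=> [[|[|[|//]]]] pi.
- by rewrite (_ : Ordinal pi = 0); [|exact: val_inj].
- by rewrite (_ : Ordinal pi = 1); [|exact: val_inj].
- by rewrite (_ : Ordinal pi = 2%:R); [|exact: val_inj].
Qed.

Section dot_product.
Context {R : realType}.

Section any_dim.
Context {n : nat}.
Implicit Types u v w : 'rV[R]_n.

Lemma dotv_sum u v : dotv u v = \sum_i u 0 i * v 0 i.
Proof. by rewrite /dotv mxE; apply: eq_bigr => i _; rewrite mxE. Qed.

Lemma dotvC u v : dotv u v = dotv v u.
Proof. by rewrite !dotv_sum; apply: eq_bigr => i _; rewrite mulrC. Qed.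

Lemma dotvDl u v w : dotv (u + v) w = dotv u w + dotv v w.
Proof. by rewrite /dotv mulmxDl mxE. Qed.

Lemma dotvDr u v w : dotv w (u + v) = dotv w u + dotv w v.
Proof. by rewrite dotvC dotvDl !(dotvC w). Qed.

Lemma dotvZl (k : R) u v : dotv (k *: u) v = k * dotv u v.
Proof. by rewrite /dotv -scalemxAl mxE. Qed.

Lemma dotvZr (k : R) u v : dotv v (k *: u) = k * dotv v u.
Proof. by rewrite dotvC dotvZl dotvC. Qed.

Lemma dotvNl u v : dotv (- u) v = - dotv u v.
Proof. by rewrite -scaleN1r dotvZl mulN1r. Qed.

Lemma dotv0l u : dotv 0 u = 0.
Proof. by rewrite -(scale0r u) dotvZl mul0r. Qed.

Lemma dotv0r u : dotv u 0 = 0.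
Proof. by rewrite dotvC dotv0l. Qed.

Lemma dotv_ge0 u : 0 <= dotv u u.
Proof. by rewrite dotv_sum; apply: sumr_ge0 => i _; exact: sqr_ge0. Qed.

Lemma dotv_eq0 u : dotv u u = 0 -> u = 0.
Proof.
move=> /eqP; rewrite dotv_sum psumr_eq0 => [/allP u0|i _]; last exact: sqr_ge0.
by apply/rowP => i; have := u0 i (mem_index_enum _); rewrite mulf_eq0 orbb mxE => /eqP.
Qed.

End any_dim.

Implicit Types u v w a b c : 'rV[R]_3.

Lemma dotv3E u v : dotv u v = u 0 0 * v 0 0 + u 0 1 * v 0 1 + u 0 2%:R * v 0 2%:R.
Proof.
have -> : 2%:R = lift ord0 (lift ord0 ord0) :> 'I_3 by exact: val_inj.
have -> : 1 = lift ord0 ord0 :> 'I_3 by exact: val_inj.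
by rewrite dotv_sum !big_ord_recl big_ord0 addr0 addrA.
Qed.

(* Parseval: a matrix with orthonormal rows also has orthonormal columns. *)
Lemma dotv_orthonormal a b c u v :
  dotv a a = 1 -> dotv b b = 1 -> dotv c c = 1 ->
  dotv a b = 0 -> dotv a c = 0 -> dotv b c = 0 ->
  dotv u v = dotv u a * dotv v a + dotv u b * dotv v b + dotv u c * dotv v c.
Proof.
move=> aa bb cc ab ac bc.
pose r (i : 'I_3) := if val i == 0%N then a else if val i == 1%N then b else c.
pose M : 'M[R]_3 := \matrix_i r i.
have rowM w i : (w *m M^T) 0 i = dotv w (r i).
  by rewrite dotv_sum mxE; apply: eq_bigr => j _; rewrite !mxE.
have MMT : M *m M^T = 1%:M.
  apply/matrixP => i j; rewrite !mxE.
  transitivity (dotv (r i) (r j)).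
    by rewrite dotv_sum; apply: eq_bigr => k _; rewrite !mxE.
  case: i => [[|[|[|//]]]] pi; case: j => [[|[|[|//]]]] pj;
    by rewrite /r /= ?aa ?bb ?cc ?ab ?ac ?bc // dotvC ?ab ?ac ?bc.
transitivity (dotv (u *m M^T) (v *m M^T)).
  by rewrite /dotv trmx_mul trmxK mulmxA -(mulmxA u) (mulmx1C MMT) mulmx1.
rewrite dotv3E !rowM; by [].
Qed.

Lemma orthonormal_eq a b c u v :
  dotv a a = 1 -> dotv b b = 1 -> dotv c c = 1 ->
  dotv a b = 0 -> dotv a c = 0 -> dotv b c = 0 ->
  dotv u a = dotv v a -> dotv u b = dotv v b -> dotv u c = dotv v c -> u = v.
Proof.
move=> aa bb cc ab ac bc ua ub uc; apply/eqP; rewrite -subr_eq0; apply/eqP/dotv_eq0.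
rewrite (dotv_orthonormal (u - v) (u - v) aa bb cc ab ac bc).
by rewrite !dotvDl !dotvNl ua ub uc !subrr !mul0r !addr0.
Qed.

Definition cross u v : 'rV[R]_3 :=
  \row_i if val i == 0%N then u 0 1 * v 0 2%:R - u 0 2%:R * v 0 1
         else if val i == 1%N then u 0 2%:R * v 0 0 - u 0 0 * v 0 2%:R
         else u 0 0 * v 0 1 - u 0 1 * v 0 0.

Lemma cross_orthol u v : dotv (cross u v) u = 0.
Proof. by rewrite dotv3E !mxE /=; ring. Qed.

Lemma cross_orthor u v : dotv (cross u v) v = 0.
Proof. by rewrite dotv3E !mxE /=; ring. Qed.

Lemma dotv_cross u v :
  dotv (cross u v) (cross u v) = dotv u u * dotv v v - dotv u v ^+ 2.
Proof. by rewrite !dotv3E !mxE /=; ring. Qed.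

(* Expansion of the triple products N x (m x N), where N = u x v and
   m x N = u <m, v> - v <m, u> vanishes. *)
Lemma cross_normal u v m : dotv m u = 0 -> dotv m v = 0 ->
  dotv (cross u v) (cross u v) *: m = dotv (cross u v) m *: cross u v.
Proof.
move=> mu mv; apply/eqP; rewrite -subr_eq0; apply/eqP.
transitivity (dotv m v *: cross (cross u v) u - dotv m u *: cross (cross u v) v).
  by apply/rowP; apply: ord3_ind; rewrite !dotv3E !mxE /=; ring.
by rewrite mu mv !scale0r subr0.
Qed.

End dot_product.

Section second_order_forms.
Context {R : realType}.

(** With [a], [b], [c] the entries of the first form and [p], [q], [r] those of the second, this is
    the trace of the inverse of the first times the second: the sum, not the average, of the
    principal curvatures. [gaussc] is the determinant of the same matrix, their product. *)
Definition meanc (a b c p q r : R) := (c * p - 2 * b * q + a * r) / (a * c - b ^+ 2).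
Definition gaussc (a b c p q r : R) := (p * r - q ^+ 2) / (a * c - b ^+ 2).

(** A change of coordinates transforms both forms by the same congruence, under which numerator and
    denominator each acquire the square of the Jacobian determinant. *)
Lemma meanc_congruence (j11 j12 j21 j22 a b c p q r : R) :
  j11 * j22 - j12 * j21 != 0 -> a * c - b ^+ 2 != 0 ->
  meanc (j11 ^+ 2 * a + 2 * j11 * j12 * b + j12 ^+ 2 * c)
        (j11 * j21 * a + (j11 * j22 + j12 * j21) * b + j12 * j22 * c)
        (j21 ^+ 2 * a + 2 * j21 * j22 * b + j22 ^+ 2 * c)
        (j11 ^+ 2 * p + 2 * j11 * j12 * q + j12 ^+ 2 * r)
        (j11 * j21 * p + (j11 * j22 + j12 * j21) * q + j12 * j22 * r)
        (j21 ^+ 2 * p + 2 * j21 * j22 * q + j22 ^+ 2 * r) = meanc a b c p q r.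
Proof.
move=> J0 D0; rewrite /meanc.
set N := (X in X / _ = _); set M := (X in _ / X = _).
have -> : N = (j11 * j22 - j12 * j21) ^+ 2 * (c * p - 2 * b * q + a * r) by rewrite /N; ring.
have -> : M = (j11 * j22 - j12 * j21) ^+ 2 * (a * c - b ^+ 2) by rewrite /M; ring.
by rewrite -mulf_div divff ?mul1r// expf_neq0.
Qed.

Lemma gaussc_congruence (j11 j12 j21 j22 a b c p q r : R) :
  j11 * j22 - j12 * j21 != 0 -> a * c - b ^+ 2 != 0 ->
  gaussc (j11 ^+ 2 * a + 2 * j11 * j12 * b + j12 ^+ 2 * c)
        (j11 * j21 * a + (j11 * j22 + j12 * j21) * b + j12 * j22 * c)
        (j21 ^+ 2 * a + 2 * j21 * j22 * b + j22 ^+ 2 * c)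
        (j11 ^+ 2 * p + 2 * j11 * j12 * q + j12 ^+ 2 * r)
        (j11 * j21 * p + (j11 * j22 + j12 * j21) * q + j12 * j22 * r)
        (j21 ^+ 2 * p + 2 * j21 * j22 * q + j22 ^+ 2 * r) = gaussc a b c p q r.
Proof.
move=> J0 D0; rewrite /gaussc.
set N := (X in X / _ = _); set M := (X in _ / X = _).
have -> : N = (j11 * j22 - j12 * j21) ^+ 2 * (p * r - q ^+ 2) by rewrite /N; ring.
have -> : M = (j11 * j22 - j12 * j21) ^+ 2 * (a * c - b ^+ 2) by rewrite /M; ring.
by rewrite -mulf_div divff ?mul1r// expf_neq0.
Qed.

(* The second form is congruent to (p, q', r') in the basis (e1, a e2 - b e1),
   where the first form is diagonal. *)
Lemma meanc_gaussc_discr (a b c p q r : R) : 0 < a -> 0 < a * c - b ^+ 2 ->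
  0 <= meanc a b c p q r ^+ 2 - 4 * gaussc a b c p q r.
Proof.
move=> a0 D0; rewrite /meanc /gaussc; set D := a * c - b ^+ 2.
pose r' := a ^+ 2 * r - 2 * a * b * q + b ^+ 2 * p.
pose q' := a * q - b * p.
have -> : ((c * p - 2 * b * q + a * r) / D) ^+ 2 - 4 * ((p * r - q ^+ 2) / D) =
   ((D * p - r') ^+ 2 + 4 * D * q' ^+ 2) / (a * D) ^+ 2.
  by rewrite /r' /q' /D; field; rewrite !gt_eqF.
apply: divr_ge0; last exact: sqr_ge0.
apply: addr_ge0; first exact: sqr_ge0.
by apply: mulr_ge0; [apply: mulr_ge0 => //; exact: ltW|exact: sqr_ge0].
Qed.

Lemma det2 (M : 'M[R]_2) : \det M = M 0 0 * M 1 1 - M 0 1 * M 1 0.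
Proof.
rewrite (expand_det_row _ 0) !big_ord_recl big_ord0 addr0 /cofactor !det_mx11 !mxE /=.
rewrite expr0 expr1 mul1r mulN1r mulrN.
have e1 : lift ord0 ord0 = 1 :> 'I_2 by exact: val_inj.
have e2 : lift 1 0 = 0 :> 'I_2 by exact: val_inj.
have e3 : lift 0 0 = 1 :> 'I_2 by exact: val_inj.
by rewrite !(e1, e2, e3).
Qed.

Lemma char_poly2 (M : 'M[R]_2) (k1 k2 : R) :
  char_poly M = ('X - k1%:P) * ('X - k2%:P) <->
  k1 + k2 = \tr M /\ k1 * k2 = \det M.
Proof.
have c2 : char_poly M = 'X^2 - (\tr M)%:P * 'X + (\det M)%:P.
  apply/polyP => i; rewrite coefD coefB coefXn coefCM coefX coefC.
  have sz := size_char_poly M.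
  case: i => [|[|[|i]]] /=.
  - by rewrite char_poly_det; ring.
  - by rewrite (char_poly_trace M) //; ring.
  - have := char_poly_monic M; rewrite monicE lead_coefE sz /= => /eqP ->; ring.
  - by rewrite nth_default ?sz //; ring.
have -> : ('X - k1%:P) * ('X - k2%:P) = 'X^2 - (k1 + k2)%:P * 'X + (k1 * k2)%:P.
  by rewrite polyCD polyCM; ring.
rewrite c2; split=> [e|[-> ->]//].
have := congr1 (fun p : {poly R} => p`_0) e; have := congr1 (fun p : {poly R} => p`_1) e.
rewrite !coefE /=; lra.
Qed.

(** The inverse is never computed. The matrix [M] is known through [G *m M = H] only: determinants
    give the product of the roots, and pairing the entries with the adjugate of [G] gives [\det G]
    times the trace. *)
Lemma char_poly_forms (G H : 'M[R]_2) (k1 k2 : R) :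
  G 1 0 = G 0 1 -> H 1 0 = H 0 1 -> \det G != 0 ->
  char_poly (invmx G *m H) = ('X - k1%:P) * ('X - k2%:P) <->
  k1 + k2 = meanc (G 0 0) (G 0 1) (G 1 1) (H 0 0) (H 0 1) (H 1 1) /\
  k1 * k2 = gaussc (G 0 0) (G 0 1) (G 1 1) (H 0 0) (H 0 1) (H 1 1).
Proof.
move=> sG sH G0; rewrite char_poly2.
have uG : G \in unitmx by rewrite unitmxE unitfE.
have : G *m (invmx G *m H) = H by rewrite mulmxA mulmxV // mul1mx.
move: (invmx G *m H) => M GM.
have e i j : G i 0 * M 0 j + G i 1 * M 1 j = H i j.
  rewrite -GM mxE !big_ord_recl big_ord0 addr0.
  by rewrite (_ : lift ord0 ord0 = 1 :> 'I_2); last exact: val_inj.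
have trM : \tr M = M 0 0 + M 1 1.
  by rewrite /mxtrace !big_ord_recl big_ord0 addr0 (_ : lift ord0 ord0 = 1 :> 'I_2); last exact: val_inj.
have dG : \det G = G 0 0 * G 1 1 - G 0 1 ^+ 2 by rewrite det2 sG.
have dM : \det M = gaussc (G 0 0) (G 0 1) (G 1 1) (H 0 0) (H 0 1) (H 1 1).
  apply: (mulfI G0); rewrite -det_mulmx GM /gaussc -dG (det2 H) sH; field.
  exact: G0.
have tM : \tr M = meanc (G 0 0) (G 0 1) (G 1 1) (H 0 0) (H 0 1) (H 1 1).
  apply: (mulfI G0); rewrite /meanc -dG mulrCA divff // mulr1 trM dG.
  have -> : G 1 1 * H 0 0 - 2 * G 0 1 * H 0 1 + G 0 0 * H 1 1 =
      G 1 1 * H 0 0 - G 0 1 * H 1 0 - G 0 1 * H 0 1 + G 0 0 * H 1 1 by rewrite sH; ring.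
  by rewrite -(e 0 0) -(e 1 0) -(e 0 1) -(e 1 1) sG; ring.
by rewrite dM tM.
Qed.

End second_order_forms.

Ltac smooth :=
  lazymatch goal with
  | |- smooth_at (fun q => @?f q + - (@?g q)) _ => apply: (@smooth_atB _ _ f g); smooth
  | |- smooth_at (fun q => @?f q + @?g q) _ => apply: (@smooth_atD _ _ _ f g); smooth
  | |- smooth_at (fun q => - (@?f q)) _ => apply: (@smooth_atN _ _ f); smooth
  | |- smooth_at (fun q => @?f q * @?g q) _ => apply: (@smooth_atM _ _ f g); smooth
  | |- smooth_at (fun q => dotv (@?f q) (@?g q)) _ =>
      apply: (@smooth_at_dotv _ _ _ f g); smooth
  | |- smooth_at (fun q => derive ?f q ?v) _ => apply: (@smooth_at_derive _ _ _ f); smooth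
  | |- _ => first [assumption | exact: smooth_at_cst | idtac]
  end.

(** * Second derivatives of products and of the mean and Gauss curvature *)

Section product_rules.
Context {R : realType} {V : normedModType R}.
Implicit Types (f g : V -> R) (p v w : V).

Lemma derivecMs (k : R) f p v : smooth_at f p -> 'D_v (fun q => k * f q) p = k * 'D_v f p.
Proof. by move=> sf; apply: deriveZ; exact: smooth_at_derivable. Qed.

Lemma derive2D f g p v : smooth_at f p -> smooth_at g p ->
  'D_v ('D_v (fun q => f q + g q)) p = 'D_v ('D_v f) p + 'D_v ('D_v g) p.
Proof.
move=> sf sg; transitivity ('D_v (fun q => 'D_v f q + 'D_v g q) p).
  apply: near_eq_derive; apply: filterS2 (smooth_at_near sf) (smooth_at_near sg) => q.
  exact: deriveDs.
by apply: deriveDs; smooth.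
Qed.

Lemma derive2N f p v : smooth_at f p ->
  'D_v ('D_v (fun q => - f q)) p = - 'D_v ('D_v f) p.
Proof.
move=> sf; transitivity ('D_v (fun q => - 'D_v f q) p).
  apply: near_eq_derive; apply: filterS (smooth_at_near sf) => q.
  exact: deriveNs.
by apply: deriveNs; smooth.
Qed.

Lemma derive2B f g p v : smooth_at f p -> smooth_at g p ->
  'D_v ('D_v (fun q => f q - g q)) p = 'D_v ('D_v f) p - 'D_v ('D_v g) p.
Proof.
move=> sf sg; have sgN : smooth_at (fun q => - g q) p by smooth.
by rewrite (derive2D v sf sgN) (derive2N v sg).
Qed.

Lemma derive2cM (k : R) f p v : smooth_at f p ->
  'D_v ('D_v (fun q => k * f q)) p = k * 'D_v ('D_v f) p.
Proof.
move=> sf; transitivity ('D_v (fun q => k * 'D_v f q) p).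
  apply: near_eq_derive; apply: filterS (smooth_at_near sf) => q.
  exact: derivecMs.
by apply: derivecMs; smooth.
Qed.

Lemma derive2M f g p v : smooth_at f p -> smooth_at g p ->
  'D_v ('D_v (fun q => f q * g q)) p =
  'D_v ('D_v f) p * g p + 2 * ('D_v f p * 'D_v g p) + f p * 'D_v ('D_v g) p.
Proof.
move=> sf sg; transitivity ('D_v (fun q => 'D_v f q * g q + f q * 'D_v g q) p).
  apply: near_eq_derive; apply: filterS2 (smooth_at_near sf) (smooth_at_near sg) => q.
  exact: deriveMs.
have sf' : smooth_at ('D_v f) p by smooth.
have sg' : smooth_at ('D_v g) p by smooth.
have s1 : smooth_at (fun q => 'D_v f q * g q) p by smooth.
have s2 : smooth_at (fun q => f q * 'D_v g q) p by smooth.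
apply: (etrans (deriveDs v s1 s2)).
apply: (etrans (congr2 +%R (deriveMs v sf' sg) (deriveMs v sf sg'))).
by move: ('D_v ('D_v f) p) ('D_v ('D_v g) p) ('D_v f p) ('D_v g p) => *; ring.
Qed.

Lemma derive2_dotv n (f g : V -> 'rV[R]_n) p v w : smooth_at f p -> smooth_at g p ->
  'D_v ('D_w (fun q => dotv (f q) (g q))) p =
  dotv ('D_v ('D_w f) p) (g p) + dotv ('D_w f p) ('D_v g p) +
  (dotv ('D_v f p) ('D_w g p) + dotv (f p) ('D_v ('D_w g) p)).
Proof.
move=> sf sg; transitivity ('D_v (fun q => dotv ('D_w f q) (g q) + dotv (f q) ('D_w g q)) p).
  apply: near_eq_derive; apply: filterS2 (smooth_at_near sf) (smooth_at_near sg) => q.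
  exact: derive_dotv.
have sf' : smooth_at ('D_w f) p by smooth.
have sg' : smooth_at ('D_w g) p by smooth.
have s1 : smooth_at (fun q => dotv ('D_w f q) (g q)) p by smooth.
have s2 : smooth_at (fun q => dotv (f q) ('D_w g q)) p by smooth.
apply: (etrans (deriveDs v s1 s2)).
exact: (congr2 +%R (derive_dotv v sf' sg) (derive_dotv v sf sg')).
Qed.

End product_rules.

(** The zeros are the values at the point of [b], [Q] and the first derivatives of the first form;
    the remaining derivatives have become variables. *)
Lemma derive2_meanc_algebra {R : realType} (k1 k2 H a b c P Q S P1 Q1 S1 : R) :
  H + (k1 + k2) * (a + c) =
    c * k1 + 2 * (0 * P1) + 1 * P - 2 * (b * 0 + 2 * (0 * Q1) + 0 * Q)
    + (a * k2 + 2 * (0 * S1) + 1 * S) ->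
  H = P + S - k1 * a - k2 * c.
Proof. lra. Qed.

Lemma derive2_gaussc_algebra {R : realType} (k1 k2 K a c P Q S P1 Q1 S1 : R) :
  K + k1 * k2 * (a + c) =
    P * k2 + 2 * (P1 * S1) + k1 * S - (Q * 0 + 2 * (Q1 * Q1) + 0 * Q) ->
  K = k2 * P + k1 * S + 2 * (P1 * S1) - 2 * (Q1 * Q1) - k1 * k2 * (a + c).
Proof. lra. Qed.

Section curvature_jets.
Context {R : realType} {V : normedModType R}.
Variables (a b c P Q S H K : V -> R) (p : V) (k1 k2 : R).
Hypotheses (sa : smooth_at a p) (sb : smooth_at b p) (sc : smooth_at c p)
  (sP : smooth_at P p) (sQ : smooth_at Q p) (sS : smooth_at S p)
  (sH : smooth_at H p) (sK : smooth_at K p).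
Hypotheses (ap : a p = 1) (bp : b p = 0) (cp : c p = 1)
  (Pp : P p = k1) (Qp : Q p = 0) (Sp : S p = k2).
Hypothesis HE : \forall q \near p,
  H q * (a q * c q - b q * b q) = c q * P q - 2 * (b q * Q q) + a q * S q.
Hypothesis KE : \forall q \near p,
  K q * (a q * c q - b q * b q) = P q * S q - Q q * Q q.

Lemma meanc_value : H p = k1 + k2.
Proof. by have := nbhs_singleton HE; rewrite ap bp cp Pp Qp Sp; lra. Qed.

Lemma gaussc_value : K p = k1 * k2.
Proof. by have := nbhs_singleton KE; rewrite ap bp cp Pp Qp Sp; lra. Qed.

(** The quotient defining [H] enters as [HE], with its denominator cleared, so that product rules
    suffice. At [p] the first form is the identity and [b], [Q] vanish, hence the derivatives of [b]
    and [Q] drop out. *)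
Lemma derive_meanc v :
  'D_v H p = 'D_v P p + 'D_v S p - k1 * 'D_v a p - k2 * 'D_v c p.
Proof.
have := near_eq_derive v HE.
do 4! (rewrite ?deriveDs ?deriveNs ?derivecMs ?deriveMs; try smooth).
rewrite ap bp cp Pp Qp Sp meanc_value.
move: ('D_v H p) ('D_v P p) ('D_v S p) ('D_v a p) ('D_v b p) ('D_v c p) ('D_v Q p) => *; lra.
Qed.

Lemma derive_gaussc v :
  'D_v K p = k2 * 'D_v P p + k1 * 'D_v S p - k1 * k2 * ('D_v a p + 'D_v c p).
Proof.
have := near_eq_derive v KE.
do 4! (rewrite ?deriveDs ?deriveNs ?derivecMs ?deriveMs; try smooth).
rewrite ap bp cp Pp Qp Sp gaussc_value.
move: ('D_v K p) ('D_v P p) ('D_v S p) ('D_v a p) ('D_v b p) ('D_v c p) ('D_v Q p) => *; lra.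
Qed.

Section second_order.
Variable v : V.
Hypotheses (av : 'D_v a p = 0) (bv : 'D_v b p = 0) (cv : 'D_v c p = 0).

Let D := fun q => a q * c q - b q * b q.
Let sac : smooth_at (fun q => a q * c q) p. Proof. by smooth. Qed.
Let sbb : smooth_at (fun q => b q * b q) p. Proof. by smooth. Qed.
Let sD : smooth_at D p. Proof. by rewrite /D; smooth. Qed.

Let D1 : 'D_v D p = 0.
Proof.
rewrite (deriveBs v sac sbb) (deriveMs v sa sc) (deriveMs v sb sb) av bv cv.
by rewrite !(mul0r, mulr0, addr0, subr0).
Qed.

Let D2 : 'D_v ('D_v D) p = 'D_v ('D_v a) p + 'D_v ('D_v c) p.
Proof.
apply: (etrans (derive2B v sac sbb)).
apply: (etrans (congr2 (fun x y => x - y) (derive2M v sa sc) (derive2M v sb sb))).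
rewrite av bv cv ap bp cp.
by move: ('D_v ('D_v a) p) ('D_v ('D_v c) p) ('D_v ('D_v b) p) => *; ring.
Qed.

(** The determinant [D] has value 1 and vanishing first derivative at [p], so the Leibniz formula
    has no cross term. *)
Let prodD (f g : V -> R) : smooth_at f p -> (\forall q \near p, f q * D q = g q) ->
  'D_v ('D_v f) p + f p * ('D_v ('D_v a) p + 'D_v ('D_v c) p) = 'D_v ('D_v g) p.
Proof.
move=> sf fg.
have e : 'D_v ('D_v (fun q => f q * D q)) p = 'D_v ('D_v g) p.
  by apply: near_eq_derive; apply: filterS (near_join fg) => q; exact: near_eq_derive.
apply: (etrans _ e); apply: esym; apply: (etrans (derive2M v sf sD)).
rewrite D1 D2 /D ap bp cp.
by move: ('D_v ('D_v a) p) ('D_v ('D_v c) p) ('D_v ('D_v f) p) => *; ring.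
Qed.

Lemma derive2_meanc :
  'D_v ('D_v H) p = 'D_v ('D_v P) p + 'D_v ('D_v S) p
    - k1 * 'D_v ('D_v a) p - k2 * 'D_v ('D_v c) p.
Proof.
have scP : smooth_at (fun q => c q * P q) p by smooth.
have sbQ : smooth_at (fun q => b q * Q q) p by smooth.
have s2bQ : smooth_at (fun q => 2 * (b q * Q q)) p by smooth.
have scB : smooth_at (fun q => c q * P q - 2 * (b q * Q q)) p by smooth.
have saS : smooth_at (fun q => a q * S q) p by smooth.
have e1 := etrans (derive2D v scB saS) (congr2 (fun x y => x + y)
  (etrans (derive2B v scP s2bQ) (congr2 (fun x y => x - y) (derive2M v sc sP)
     (etrans (derive2cM 2 v sbQ) (congr1 (fun x => 2 * x) (derive2M v sb sQ)))))
  (derive2M v sa sS)).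
have := etrans (prodD sH HE) e1; rewrite av bv cv ap bp cp Pp Qp Sp meanc_value.
exact: derive2_meanc_algebra.
Qed.

(** Unlike that of the mean curvature, the numerator is quadratic in the second form, so first
    derivatives of [P], [Q], [S] survive; they become gradient terms in the evolution of the
    pinching. *)
Lemma derive2_gaussc :
  'D_v ('D_v K) p = k2 * 'D_v ('D_v P) p + k1 * 'D_v ('D_v S) p
    + 2 * ('D_v P p * 'D_v S p) - 2 * ('D_v Q p * 'D_v Q p)
    - k1 * k2 * ('D_v ('D_v a) p + 'D_v ('D_v c) p).
Proof.
have sPS : smooth_at (fun q => P q * S q) p by smooth.
have sQQ : smooth_at (fun q => Q q * Q q) p by smooth.
have e1 := etrans (derive2B v sPS sQQ) (congr2 (fun x y => x - y)
  (derive2M v sP sS) (derive2M v sQ sQ)).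
have := etrans (prodD sK KE) e1; rewrite Pp Qp Sp gaussc_value.
exact: derive2_gaussc_algebra.
Qed.

End second_order.
End curvature_jets.

(** * Stereographic charts *)

Lemma smooth_at_eq {R : realType} {V W : normedModType R} (f g : V -> W) p :
  (forall q, f q = g q) -> smooth_at f p -> smooth_at g p.
Proof. by move=> /funext ->. Qed.

Section stereographic.
Context {R : realType}.
Implicit Types (eps : R) (v : 'rV[R]_2) (z : 'rV[R]_3).

Definition sqn v : R := v 0 0 * v 0 0 + v 0 1 * v 0 1.

(* Stereographic projection from the pole (0, 0, - eps). *)
Definition stereo eps v : 'rV[R]_3 :=
  \row_i if val i == 0%N then 2 * v 0 0 * (1 + sqn v)^-1
         else if val i == 1%N then 2 * v 0 1 * (1 + sqn v)^-1
         else eps * (1 - sqn v) * (1 + sqn v)^-1.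

Definition unstereo eps z : 'rV[R]_2 :=
  \row_i if val i == 0%N then z 0 0 * (1 + eps * z 0 2%:R)^-1
         else z 0 1 * (1 + eps * z 0 2%:R)^-1.

Lemma sqn_ge0 v : 0 <= sqn v.
Proof. by apply: addr_ge0; exact: sqr_ge0. Qed.

Lemma sqn1_gt0 v : 0 < 1 + sqn v.
Proof. by rewrite ltr_pwDl // sqn_ge0. Qed.

Lemma stereo_sphere eps v : eps * eps = 1 -> sphere2 (stereo eps v).
Proof.
move=> e1; rewrite /sphere2 /= dotv3E !mxE /=.
have := sqn1_gt0 v; set q := sqn v => q0.
have qE : q = v 0 0 * v 0 0 + v 0 1 * v 0 1 by [].
move: (v 0 0) (v 0 1) qE => a b qE.
have -> : 2 * a * (1 + q)^-1 * (2 * a * (1 + q)^-1) + 2 * b * (1 + q)^-1 * (2 * b * (1 + q)^-1)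
  + eps * (1 - q) * (1 + q)^-1 * (eps * (1 - q) * (1 + q)^-1) =
  (4 * (a * a + b * b) + eps * eps * (1 - q) ^+ 2) / (1 + q) ^+ 2.
  by field; rewrite gt_eqF.
by rewrite -qE e1; field; rewrite gt_eqF.
Qed.

Lemma stereo_denominator eps v : eps * eps = 1 ->
  1 + eps * stereo eps v 0 2%:R = 2 * (1 + sqn v)^-1.
Proof.
move=> e1; rewrite !mxE /=; have := sqn1_gt0 v; move: (sqn v) => q q0.
rewrite !mulrA e1 mul1r; by field; rewrite gt_eqF.
Qed.

Lemma stereoK eps v : eps * eps = 1 -> unstereo eps (stereo eps v) = v.
Proof.
move=> e1; apply/rowP => i; rewrite mxE (stereo_denominator v e1) !mxE /=.
have := sqn1_gt0 v; move: (sqn v) => q q0.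
have h (x : R) : 2 * x * (1 + q)^-1 * (2 * (1 + q)^-1)^-1 = x by field; rewrite gt_eqF.
case: i => [[|[|//]]] pi; rewrite /= h; congr (v _ _); exact: val_inj.
Qed.

Lemma unstereoK eps z : eps * eps = 1 -> sphere2 z -> 0 < 1 + eps * z 0 2%:R ->
  stereo eps (unstereo eps z) = z.
Proof.
rewrite /sphere2 /= dotv3E => e1 zz z0.
have qE : sqn (unstereo eps z) = 2 * (1 + eps * z 0 2%:R)^-1 - 1.
  rewrite /sqn !mxE /=; move: zz z0.
  move: (z 0 0) (z 0 1) (z 0 2%:R) => a b c abc c0.
  have -> : a * (1 + eps * c)^-1 * (a * (1 + eps * c)^-1) +
    b * (1 + eps * c)^-1 * (b * (1 + eps * c)^-1) =
    ((a * a + b * b + c * c) - eps * eps * c * c + (eps * eps - 1) * c * c) * (1 + eps * c)^-2.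
    by field; rewrite gt_eqF.
  have -> : a * a + b * b + c * c - eps * eps * c * c + (eps * eps - 1) * c * c =
    (1 - eps * c) * (1 + eps * c).
    have -> : (1 - eps * c) * (1 + eps * c) = 1 - eps * eps * c * c by ring.
    by rewrite abc e1; ring.
  by field; rewrite gt_eqF.
have q1 : (1 + sqn (unstereo eps z))^-1 = (1 + eps * z 0 2%:R) / 2.
  by rewrite qE addrCA subrr addr0 invfM invrK mulrC.
apply/rowP; apply: ord3_ind; rewrite mxE /= q1 ?mxE /=.
- by move: (z 0 2%:R) z0 => c c0; field; rewrite gt_eqF.
- by move: (z 0 2%:R) z0 => c c0; field; rewrite gt_eqF.
rewrite qE; move: (z 0 2%:R) z0 => c c0.
have -> : eps * (1 - (2 * (1 + eps * c)^-1 - 1)) * ((1 + eps * c) / 2) = eps * eps * c.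
  by field; rewrite gt_eqF.
by rewrite e1 mul1r.
Qed.

(** Each of the two projections misses one pole; the sign of the last coordinate of [z] selects a
    projection whose pole is not [z]. *)
Lemma sphere_pole z : sphere2 z -> exists2 eps : R, eps * eps = 1 & 0 < 1 + eps * z 0 2%:R.
Proof.
move=> _; have [z0|z0] := leP 0 (z 0 2%:R).
  by exists 1; rewrite ?mulr1 // mul1r ltr_pwDl.
by exists (-1); rewrite ?mulrNN ?mulr1 // mulN1r ltr_wpDr // oppr_ge0 ltW.
Qed.

Lemma smooth_at_stereo eps v : smooth_at (stereo eps) v.
Proof.
have s0 : smooth_at (fun u : 'rV[R]_2 => u 0 0) v.
  by apply: (@smooth_at_coord _ _ _ id); apply: smooth_at_lin => // ? ?.
have s1 : smooth_at (fun u : 'rV[R]_2 => u 0 1) v.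
  by apply: (@smooth_at_coord _ _ _ id); apply: smooth_at_lin => // ? ?.
have sq : smooth_at sqn v by rewrite /sqn; smooth.
have si : smooth_at (fun u => (1 + sqn u)^-1) v.
  by apply: smooth_atV; [exact: sqn1_gt0|smooth].
have s2 (c : R) : smooth_at (fun=> c) v by exact: smooth_at_cst.
have h0 : smooth_at (fun u : 'rV[R]_2 => 2 * u 0 0 * (1 + sqn u)^-1) v by smooth.
have h1 : smooth_at (fun u : 'rV[R]_2 => 2 * u 0 1 * (1 + sqn u)^-1) v by smooth.
have h2 : smooth_at (fun u => eps * (1 - sqn u) * (1 + sqn u)^-1) v by smooth.
apply: smooth_at_rV; apply: (@ord3_ind (fun i => smooth_at (fun q => stereo eps q 0 i) v)).
- by apply: smooth_at_eq h0 => u; rewrite mxE.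
- by apply: smooth_at_eq h1 => u; rewrite mxE.
- by apply: smooth_at_eq h2 => u; rewrite mxE.
Qed.

Lemma smooth_at_unstereo eps z : 0 < 1 + eps * z 0 2%:R -> smooth_at (unstereo eps) z.
Proof.
move=> z0.
have sc i : smooth_at (fun u : 'rV[R]_3 => u 0 i) z.
  by apply: (@smooth_at_coord _ _ _ id); apply: smooth_at_lin => // ? ?.
have s2 (c : R) : smooth_at (fun _ : 'rV[R]_3 => c) z by exact: smooth_at_cst.
have := sc 0; have := sc 1; have := sc 2%:R => sc2 sc1 sc0.
have si : smooth_at (fun u : 'rV[R]_3 => (1 + eps * u 0 2%:R)^-1) z.
  by apply: smooth_atV => //; smooth.
have h0 : smooth_at (fun u : 'rV[R]_3 => u 0 0 * (1 + eps * u 0 2%:R)^-1) z by smooth.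
have h1 : smooth_at (fun u : 'rV[R]_3 => u 0 1 * (1 + eps * u 0 2%:R)^-1) z by smooth.
apply: smooth_at_rV => i; case: i => [[|[|//]]] pi.
- by apply: smooth_at_eq h0 => u; rewrite mxE.
- by apply: smooth_at_eq h1 => u; rewrite mxE.
Qed.

Lemma stereo_chart eps : eps * eps = 1 -> sphere_chart setT (stereo eps).
Proof.
move=> e1; split.
- exact: openT.
- move=> v _; have [U [oU Uv CU]] := smooth_at_stereo eps v.
  by exists U, (stereo eps); split.
- by move=> _ [v _ <-]; exact: stereo_sphere.
- by move=> u v _ _ /(congr1 (unstereo eps)); rewrite !stereoK.
move=> v _ w Dw.
have zv : 0 < 1 + eps * stereo eps v 0 2%:R.
  by rewrite stereo_denominator // mulr_gt0 // invr_gt0 sqn1_gt0.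
have du := smooth_at_differentiable (smooth_at_unstereo zv).
have ds := smooth_at_differentiable (smooth_at_stereo eps v).
(* The left inverse proves immersivity: the composite is the identity, whose derivative along [w] is
   [w]. *)
have : 'D_w (fun u => unstereo eps (stereo eps u)) v = 0.
  rewrite deriveE; last exact: (@differentiable_comp _ _ _ _ (stereo eps) (unstereo eps)).
  rewrite (@diff_comp _ _ _ _ (stereo eps) (unstereo eps)) //=.
  by rewrite -(deriveE w ds) Dw linear0.
have -> : (fun u => unstereo eps (stereo eps u)) = id by apply/funext => u; rewrite stereoK.
by rewrite derive_id.
Qed.

End stereographic.

(** * Simons' identity and evolution equations *)

#[local] Opaque derive dotv.

Lemma derive_dot_cst {R : realType} {V : normedModType R} m v (f g : V -> 'rV[R]_m) (k : R) p :
  smooth_at f p -> smooth_at g p -> (\forall q \near p, dotv (f q) (g q) = k) ->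
  dotv ('D_v f p) (g p) = - dotv (f p) ('D_v g p).
Proof.
move=> sf sg fg.
have e : 'D_v (fun q => dotv (f q) (g q)) p = 0.
  exact: (etrans (near_eq_derive v fg) (derive_cst k p v)).
have := etrans (esym (derive_dotv v sf sg)) e.
by move/eqP; rewrite addr_eq0 => /eqP.
Qed.

(** Leibniz rule for the second derivative of the product of [Y22] with [n]; [A] and [B] are the
    second and first derivatives of [Y22]. The last product is [l * k ^+ 2] because [Y22] is normal
    and the normal component of [n11] is [- k ^+ 2], the field [n] having constant length. *)
Lemma simons_algebra {R : realType} (A B n n1 n11 Y1 Y22 Z : 'rV[R]_3) (k l : R) :
  B = Z -> n1 = k *: Y1 -> Y22 = - l *: n -> dotv n11 n = - dotv n1 n1 -> dotv Y1 Y1 = 1 ->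
  dotv A n + 2 * dotv B n1 + dotv n11 Y22 = dotv A n + 2 * (k * dotv Z Y1) + l * k ^+ 2.
Proof.
by move=> -> -> -> h Y11; rewrite !dotvZr h !(dotvZl, dotvZr) Y11; congr (_ + _); ring.
Qed.

(** The fourth derivatives [u] and [v] cancel, and the third order terms [y], [z] are half the
    second derivatives of the metric coefficients. The intrinsic curvature thus never appears by
    itself. *)
Lemma simons_sum {R : realType} (k l S P c a u v y z : R) :
  S = - (u + 2 * (k * y) + l * k ^+ 2) -> P = - (v + 2 * (l * z) + k * l ^+ 2) ->
  c = 2 * z -> a = 2 * y -> u = v -> S - P - l * c + k * a = - (k * l * (k - l)).
Proof. by move=> -> -> -> -> ->; ring. Qed.

Section normal_coordinates.
Context {R : realType} {V : normedModType R}.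
Variables (Y n : V -> 'rV[R]_3) (e1 e2 : V) (p : V) (k1 k2 : R).
Local Notation Y1 := ('D_e1 Y).
Local Notation Y2 := ('D_e2 Y).
Hypotheses (sY : smooth_at Y p) (sn : smooth_at n p).
Hypothesis nn : \forall q \near p, dotv (n q) (n q) = 1.
Hypothesis nY1 : \forall q \near p, dotv (n q) (Y1 q) = 0.
Hypothesis nY2 : \forall q \near p, dotv (n q) (Y2 q) = 0.
Hypotheses (Y11p : dotv (Y1 p) (Y1 p) = 1) (Y12p : dotv (Y1 p) (Y2 p) = 0)
  (Y22p : dotv (Y2 p) (Y2 p) = 1).
Hypotheses (DY11 : 'D_e1 Y1 p = - k1 *: n p) (DY12 : 'D_e1 Y2 p = 0)
  (DY22 : 'D_e2 Y2 p = - k2 *: n p).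

Let sY1 : smooth_at Y1 p. Proof. exact: (smooth_at_derive e1 sY). Qed.
Let sY2 : smooth_at Y2 p. Proof. exact: (smooth_at_derive e2 sY). Qed.
Let sY11 : smooth_at ('D_e1 Y1) p. Proof. exact: (smooth_at_derive e1 sY1). Qed.
Let sY12 : smooth_at ('D_e1 Y2) p. Proof. exact: (smooth_at_derive e1 sY2). Qed.
Let sY22 : smooth_at ('D_e2 Y2) p. Proof. exact: (smooth_at_derive e2 sY2). Qed.

Let nnp : dotv (n p) (n p) = 1. Proof. exact: nbhs_singleton nn. Qed.
Let nY1p : dotv (n p) (Y1 p) = 0. Proof. exact: nbhs_singleton nY1. Qed.
Let nY2p : dotv (n p) (Y2 p) = 0. Proof. exact: nbhs_singleton nY2. Qed.

Let DY21 : 'D_e2 Y1 p = 0.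
Proof. exact: (etrans (derive_comm_rV e2 e1 sY) DY12). Qed.

Lemma dotv_derive_normal v : dotv ('D_v n p) (n p) = 0.
Proof. by have := derive_dot_cst v sn sn nn; rewrite [dotv (n p) _]dotvC; lra. Qed.

Let frame_eq (u v : 'rV[R]_3) : dotv u (Y1 p) = dotv v (Y1 p) ->
  dotv u (Y2 p) = dotv v (Y2 p) -> dotv u (n p) = dotv v (n p) -> u = v.
Proof.
exact: (orthonormal_eq Y11p Y22p nnp Y12p (etrans (dotvC _ _) nY1p)
  (etrans (dotvC _ _) nY2p)).
Qed.

(** The components in the frame [Y1], [Y2], [n] come from differentiating the relations of [n] with
    [Y1], [Y2] and itself. The sign is positive because the second form carries a minus sign. *)
Lemma weingarten1 : 'D_e1 n p = k1 *: Y1 p.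
Proof.
apply: frame_eq; rewrite dotvZl.
- by rewrite (derive_dot_cst _ sn sY1 nY1) DY11 Y11p dotvZr nnp; lra.
- by rewrite (derive_dot_cst _ sn sY2 nY2) DY12 Y12p dotv0r; lra.
- by rewrite dotv_derive_normal [dotv (Y1 p) _]dotvC nY1p; lra.
Qed.

Lemma weingarten2 : 'D_e2 n p = k2 *: Y2 p.
Proof.
apply: frame_eq; rewrite dotvZl.
- by rewrite (derive_dot_cst _ sn sY1 nY1) DY21 [dotv (Y2 p) _]dotvC Y12p dotv0r; lra.
- by rewrite (derive_dot_cst _ sn sY2 nY2) DY22 Y22p dotvZr nnp; lra.
- by rewrite dotv_derive_normal [dotv (Y2 p) _]dotvC nY2p; lra.
Qed.

Let a q := dotv (Y1 q) (Y1 q).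
Let b q := dotv (Y1 q) (Y2 q).
Let c q := dotv (Y2 q) (Y2 q).
Let P q := - dotv ('D_e1 Y1 q) (n q).
Let Q q := - dotv ('D_e1 Y2 q) (n q).
Let S q := - dotv ('D_e2 Y2 q) (n q).

Lemma second_form_values : [/\ P p = k1, Q p = 0 & S p = k2].
Proof. by rewrite /P /Q /S DY11 DY12 DY22 !dotvZl dotv0l nnp; split; lra. Qed.

Let dot_normal (f g : V -> 'rV[R]_3) v (k l : R) : smooth_at f p -> smooth_at g p ->
  'D_v f p = k *: n p -> 'D_v g p = l *: n p ->
  dotv (n p) (f p) = 0 -> dotv (n p) (g p) = 0 ->
  'D_v (fun q => dotv (f q) (g q)) p = 0.
Proof.
move=> sf sg fn gn nf ng; apply: (etrans (derive_dotv v sf sg)).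
by rewrite fn gn dotvZl dotvZr ng [dotv (f p) _]dotvC nf; lra.
Qed.

Let z21 : 'D_e2 Y1 p = 0 *: n p. Proof. by rewrite scale0r; exact: DY21. Qed.
Let z12 : 'D_e1 Y2 p = 0 *: n p. Proof. by rewrite scale0r; exact: DY12. Qed.

(** At [p] the second derivatives of [Y] are normal and the first ones tangential: the vanishing of
    the Christoffel symbols, read off the metric. *)
Lemma first_form_derive1 : [/\ 'D_e1 a p = 0, 'D_e1 b p = 0 & 'D_e1 c p = 0].
Proof.
split; [exact: (dot_normal sY1 sY1 DY11 DY11 nY1p nY1p)|
  exact: (dot_normal sY1 sY2 DY11 z12 nY1p nY2p)|exact: (dot_normal sY2 sY2 z12 z12 nY2p nY2p)].
Qed.

Lemma first_form_derive2 : [/\ 'D_e2 a p = 0, 'D_e2 b p = 0 & 'D_e2 c p = 0].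
Proof.
split; [exact: (dot_normal sY1 sY1 z21 z21 nY1p nY1p)|
  exact: (dot_normal sY1 sY2 z21 DY22 nY1p nY2p)|exact: (dot_normal sY2 sY2 DY22 DY22 nY2p nY2p)].
Qed.

Let near_comm : \forall q \near p, 'D_e2 Y1 q = 'D_e1 Y2 q.
Proof. by apply: filterS (smooth_at_near sY) => q; exact: derive_comm_rV. Qed.

Let D2Y11 : 'D_e2 ('D_e1 Y1) p = 'D_e1 ('D_e1 Y2) p.
Proof. exact: (etrans (derive_comm_rV e2 e1 sY1) (near_eq_derive e1 near_comm)). Qed.

Let D1Y22 : 'D_e1 ('D_e2 Y2) p = 'D_e2 ('D_e2 Y1) p.
Proof.
exact: (etrans (derive_comm_rV e1 e2 sY2) (esym (near_eq_derive e2 near_comm))).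
Qed.

Let form_derive (f : V -> 'rV[R]_3) v : smooth_at f p -> dotv (f p) ('D_v n p) = 0 ->
  'D_v (fun q => - dotv (f q) (n q)) p = - dotv ('D_v f p) (n p).
Proof.
move=> sf fn; apply: (etrans (deriveNs v (smooth_at_dotv sf sn))).
by congr (- _); apply: (etrans (derive_dotv v sf sn)); rewrite fn addr0.
Qed.

(** At [p] the second derivatives of [Y] are normal and the derivatives of [n] tangential, so on
    both sides only a third derivative of [Y] paired with [n] is left, and the order of
    differentiation is immaterial. *)
Lemma codazzi1 : 'D_e1 Q p = 'D_e2 P p.
Proof.
have z1 : dotv ('D_e1 Y1 p) ('D_e2 n p) = 0.
  by rewrite DY11 weingarten2 dotvZl dotvZr nY2p; lra.
have z2 : dotv ('D_e1 Y2 p) ('D_e1 n p) = 0 by rewrite DY12 dotv0l.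
apply: (etrans (form_derive sY12 z2)); apply: esym; apply: (etrans (form_derive sY11 z1)).
exact: (congr1 (fun x => - dotv x (n p)) D2Y11).
Qed.

Lemma codazzi2 : 'D_e2 Q p = 'D_e1 S p.
Proof.
have z1 : dotv ('D_e2 Y2 p) ('D_e1 n p) = 0.
  by rewrite DY22 weingarten1 dotvZl dotvZr nY1p; lra.
have z2 : dotv ('D_e1 Y2 p) ('D_e2 n p) = 0 by rewrite DY12 dotv0l.
apply: (etrans (form_derive sY12 z2)); apply: esym; apply: (etrans (form_derive sY22 z1)).
exact: (congr1 (fun x => - dotv x (n p)) (derive_comm_rV e1 e2 sY2)).
Qed.

Let dotv_derive2_normal v : dotv ('D_v ('D_v n) p) (n p) = - dotv ('D_v n p) ('D_v n p).
Proof.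
have snv : smooth_at ('D_v n) p := smooth_at_derive v sn.
have h : \forall q \near p, dotv ('D_v n q) (n q) = 0.
  apply: filterS2 (smooth_at_near sn) (near_join nn) => q snq nnq.
  by have := derive_dot_cst v snq snq nnq; rewrite [dotv (n q) _]dotvC; lra.
exact: (derive_dot_cst v snv sn h).
Qed.

Let dot_derive2 (f g : V -> 'rV[R]_3) v : smooth_at f p -> smooth_at g p ->
  'D_v ('D_v (fun q => dotv (f q) (g q))) p =
  dotv ('D_v ('D_v f) p) (g p) + 2 * dotv ('D_v f p) ('D_v g p) + dotv ('D_v ('D_v g) p) (f p).
Proof.
move=> sf sg; apply: (etrans (derive2_dotv v v sf sg)).
by rewrite [dotv (f p) _]dotvC mulr2n mulrDl !mul1r !addrA.
Qed.

(* Commuting the fourth derivatives of Y: the trace of Simons' identity. *)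
Lemma simons : 'D_e1 ('D_e1 S) p - 'D_e2 ('D_e2 P) p - k2 * 'D_e1 ('D_e1 c) p
  + k1 * 'D_e2 ('D_e2 a) p = - (k1 * k2 * (k1 - k2)).
Proof.
have eS : 'D_e1 ('D_e1 S) p = - (dotv ('D_e1 ('D_e1 ('D_e2 Y2)) p) (n p)
    + 2 * (k1 * dotv ('D_e2 ('D_e2 Y1) p) (Y1 p)) + k2 * k1 ^+ 2).
  apply: (etrans (derive2N e1 (smooth_at_dotv sY22 sn))); congr (- _).
  apply: (etrans (dot_derive2 e1 sY22 sn)).
  exact: (simons_algebra _ D1Y22 weingarten1 DY22 (dotv_derive2_normal e1) Y11p).
have eP : 'D_e2 ('D_e2 P) p = - (dotv ('D_e2 ('D_e2 ('D_e1 Y1)) p) (n p)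
    + 2 * (k2 * dotv ('D_e1 ('D_e1 Y2) p) (Y2 p)) + k1 * k2 ^+ 2).
  apply: (etrans (derive2N e2 (smooth_at_dotv sY11 sn))); congr (- _).
  apply: (etrans (dot_derive2 e2 sY11 sn)).
  exact: (simons_algebra _ D2Y11 weingarten2 DY11 (dotv_derive2_normal e2) Y22p).
have ec : 'D_e1 ('D_e1 c) p = 2 * dotv ('D_e1 ('D_e1 Y2) p) (Y2 p).
  apply: (etrans (dot_derive2 e1 sY2 sY2)).
  by rewrite DY12 dotv0l; move: (dotv _ _) => ?; ring.
have ea : 'D_e2 ('D_e2 a) p = 2 * dotv ('D_e2 ('D_e2 Y1) p) (Y1 p).
  apply: (etrans (dot_derive2 e2 sY1 sY1)).
  by rewrite DY21 dotv0l; move: (dotv _ _) => ?; ring.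
have e4 : 'D_e1 ('D_e1 ('D_e2 Y2)) p = 'D_e2 ('D_e2 ('D_e1 Y1)) p.
  transitivity ('D_e1 ('D_e2 ('D_e2 Y1)) p).
    apply: near_eq_derive; apply: filterS2 (smooth_at_near sY2) (near_join near_comm) => q sq nq.
    exact: (etrans (derive_comm_rV e1 e2 sq) (esym (near_eq_derive e2 nq))).
  have sY21 : smooth_at ('D_e2 Y1) p := smooth_at_derive e2 sY1.
  apply: (etrans (derive_comm_rV e1 e2 sY21)); apply: near_eq_derive.
  by apply: filterS (smooth_at_near sY1) => q sq; exact: (derive_comm_rV e1 e2 sq).
exact: (simons_sum eS eP ec ea (congr1 (fun x => dotv x (n p)) e4)).
Qed.

End normal_coordinates.

(** * Evolution of the fundamental forms under the flow *)

Lemma evolution_algebra1 {R : realType} (DX DZ X Z n : 'rV[R]_3) (k f : R) :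
  DZ = - k *: n -> X = - f *: n -> dotv n n = 1 -> dotv DX Z + dotv X DZ = 0 ->
  dotv DX Z = - (f * k).
Proof. by move=> -> -> nn; rewrite dotvZl dotvZr nn; lra. Qed.

Lemma evolution_algebra2 {R : realType} (DDX DX X Z n n1 n11 : 'rV[R]_3) (k f ddf : R) :
  n1 = k *: Z -> dotv DX Z = - (f * k) -> X = - f *: n -> dotv n n11 = - k ^+ 2 ->
  dotv DDX n + dotv DX n1 + (dotv DX n1 + dotv X n11) = - ddf ->
  dotv DDX n = - ddf + f * k ^+ 2.
Proof. by move=> -> h -> h'; rewrite dotvZr h dotvZl h'; lra. Qed.

Section evolution.
Context {R : realType} {V : normedModType R}.
Variables (Y n : V -> 'rV[R]_3) (Phi : V -> R) (e et : V) (p : V) (k : R) (A : set V).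
Local Notation Z := ('D_e Y).
Local Notation X := ('D_et Y).
Hypotheses (sY : smooth_at Y p) (sn : smooth_at n p) (sPhi : smooth_at Phi p).
Hypothesis nn : \forall q \near p, dotv (n q) (n q) = 1.
Hypothesis nZ : \forall q \near p, dotv (n q) (Z q) = 0.
Hypotheses (ZZ : dotv (Z p) (Z p) = 1).
Hypotheses (DZ : 'D_e Z p = - k *: n p) (Dn : 'D_e n p = k *: Z p).
Hypotheses (Ap : A p) (Ae : forall q r, A q -> A (r *: e + q)).
Hypothesis flow : \forall q \near p, A q -> X q = - Phi q *: n q.

Let sZ : smooth_at Z p := smooth_at_derive e sY.
Let sX : smooth_at X p := smooth_at_derive et sY.
Let sDZ : smooth_at ('D_e Z) p := smooth_at_derive e sZ.

Let nnp : dotv (n p) (n p) = 1. Proof. exact: nbhs_singleton nn. Qed.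
Let Xp : X p = - Phi p *: n p. Proof. exact: nbhs_singleton flow Ap. Qed.

(** The velocity is normal on the slice [A] and [e] is tangent to [A], so its orthogonality to [Z]
    can be differentiated along [e], although nothing is known of [X] off [A]. *)
Let DXZ : dotv ('D_e X p) (Z p) = - (Phi p * k).
Proof.
have h : \forall q \near p, A q -> dotv (X q) (Z q) = 0.
  apply: filterS2 flow nZ => q fl nq Aq.
  by rewrite (fl Aq) dotvZl nq mulr0.
have E := nbhs_singleton (derive_eq_slice Ae h) Ap.
have e1 := derive_dotv e sX sZ; have e2 := @derive_cst _ _ _ (0 : R) p e.
exact: (evolution_algebra1 DZ Xp nnp (etrans (esym e1) (etrans E e2))).
Qed.

(** The time derivative of [Z] is the space derivative of the velocity [X]; through this exchange
    the flow equation is used on the slice alone. *)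
Lemma first_form_evolution : 'D_et (fun q => dotv (Z q) (Z q)) p = - 2 * (Phi p * k).
Proof.
apply: (etrans (derive_dotv et sZ sZ)).
have E := etrans (congr1 (fun x => dotv x (Z p)) (derive_comm_rV et e sY)) DXZ.
apply: (etrans (congr2 +%R E (etrans (dotvC _ _) E))); ring.
Qed.

Lemma dotv_derive_n_zero v : dotv (n p) ('D_v n p) = 0.
Proof.
have := derive_dot_cst v sn sn nn; rewrite [dotv ('D_v n p) _]dotvC.
by move: (dotv _ _) => *; lra.
Qed.

Let D2n : dotv (n p) ('D_e ('D_e n) p) = - k ^+ 2.
Proof.
have snv : smooth_at ('D_e n) p := smooth_at_derive e sn.
have h : \forall q \near p, dotv (n q) ('D_e n q) = 0.
  apply: filterS2 (smooth_at_near sn) (near_join nn) => q snq nnq.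
  by have := derive_dot_cst e snq snq nnq; rewrite [dotv ('D_e n q) _]dotvC;
     move: (dotv _ _) => *; lra.
have := derive_dot_cst e sn snv h; rewrite Dn dotvZl dotvZr ZZ.
move: (dotv _ _) => *; lra.
Qed.

Let D2X : dotv ('D_e ('D_e X) p) (n p) = - 'D_e ('D_e Phi) p + Phi p * k ^+ 2.
Proof.
have h : \forall q \near p, A q -> dotv (X q) (n q) = - Phi q.
  apply: filterS2 flow nn => q fl nq Aq.
  by rewrite (fl Aq) dotvZl nq mulr1.
have E := nbhs_singleton (derive_eq_slice Ae (derive_eq_slice Ae h)) Ap.
have e1 := derive2_dotv e e sX sn; have e2 := derive2N e sPhi.
exact: (evolution_algebra2 Dn DXZ Xp D2n (etrans (esym e1) (etrans E e2))).
Qed.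

(** At [p] the vector ['D_e Z] is normal while ['D_et n] is tangential, so the rotation of the
    normal contributes nothing; what remains is the second space derivative of the velocity paired
    with [n]. *)
Lemma second_form_evolution :
  'D_et (fun q => - dotv ('D_e Z q) (n q)) p = 'D_e ('D_e Phi) p - Phi p * k ^+ 2.
Proof.
apply: (etrans (deriveNs et (smooth_at_dotv sDZ sn))).
have c : 'D_et ('D_e Z) p = 'D_e ('D_e X) p.
  apply: (etrans (derive_comm_rV et e sZ)); apply: near_eq_derive.
  by apply: filterS (smooth_at_near sY) => q; exact: derive_comm_rV.
have e1 := derive_dotv et sDZ sn.
have e2 := congr1 (fun x => dotv x (n p)) c.
have e3 : dotv ('D_e Z p) ('D_et n p) = 0.
  by rewrite DZ dotvZl dotv_derive_n_zero mulr0.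
apply: (etrans (congr1 -%R (etrans e1 (congr2 +%R (etrans e2 D2X) e3)))).
by move: ('D_e ('D_e Phi) p) => *; ring.
Qed.

End evolution.

(* The sign of the evolution of the pinching at a spatial maximum. With
   d = k1 - k2 and w_i = H_i / H the derivatives of (k1, k2) are w_i (k1, k2),
   and the bracket below is a sum of nonnegative terms, the first one positive. *)
Lemma pinching_algebra {R : realType} (al k1 k2 f0 f1 A0 H s P1 S1 P2 S2
    H1 H2 H11 H22 K1 K2 K11 K22 P11 S11 P22 S22 a11 c11 a22 c22 s11 s22
    Ht Kt Pt St at' ct st Phi Phi11 Phi22 : R) :
  1 < al -> 0 < k2 -> k2 < k1 -> 0 < f0 -> 0 < A0 ->
  H = k1 + k2 -> s = (k1 - k2) / (k1 + k2) ->
  0 < al * f0 + (1 - s) * f1 -> 0 < al * f0 - (1 + s) * f1 ->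
  (al - 1) * (k1 - k2) <= 2 * k2 ->
  H1 = P1 + S1 -> K1 = k2 * P1 + k1 * S1 -> 4 * K1 = 2 * (H * H1) * (1 - s ^+ 2) ->
  H2 = P2 + S2 -> K2 = k2 * P2 + k1 * S2 -> 4 * K2 = 2 * (H * H2) * (1 - s ^+ 2) ->
  4 * K11 = 2 * (H1 ^+ 2 + H * H11) * (1 - s ^+ 2) - 2 * H ^+ 2 * s * s11 ->
  4 * K22 = 2 * (H2 ^+ 2 + H * H22) * (1 - s ^+ 2) - 2 * H ^+ 2 * s * s22 ->
  H11 = P11 + S11 - k1 * a11 - k2 * c11 ->
  K11 = k2 * P11 + k1 * S11 + 2 * (P1 * S1) - 2 * (P2 * P2) - k1 * k2 * (a11 + c11) ->
  H22 = P22 + S22 - k1 * a22 - k2 * c22 ->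
  K22 = k2 * P22 + k1 * S22 + 2 * (P2 * S2) - 2 * (S1 * S1) - k1 * k2 * (a22 + c22) ->
  S11 - P22 - k2 * c11 + k1 * a22 = - (k1 * k2 * (k1 - k2)) ->
  Ht = Pt + St - k1 * at' - k2 * ct ->
  Kt = k2 * Pt + k1 * St - k1 * k2 * (at' + ct) ->
  4 * Kt = 2 * (H * Ht) * (1 - s ^+ 2) - 2 * H ^+ 2 * s * st ->
  at' = - 2 * (Phi * k1) -> ct = - 2 * (Phi * k2) ->
  Pt = Phi11 - Phi * k1 ^+ 2 -> St = Phi22 - Phi * k2 ^+ 2 ->
  Phi = A0 * f0 ->
  Phi11 = A0 * (f0 * al * (al - 1) * (H1 / H) ^+ 2 + f0 * al * (H11 / H) + f1 * s11) ->
  Phi22 = A0 * (f0 * al * (al - 1) * (H2 / H) ^+ 2 + f0 * al * (H22 / H) + f1 * s22) ->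
  s11 <= 0 -> s22 <= 0 -> st < 0.
Proof.
move=> al1 k20 k21 f00 A00 HE sE par1 par2 pinch H1E K1E K1s H2E K2E K2s K11s K22s
  H11E K11E H22E K22E sim HtE KtE Kts atE ctE PtE StE PhiE Phi11E Phi22E s11le s22le.
have H0 : 0 < H by rewrite HE; lra.
have k10 : 0 < k1 by lra.
have d0 : 0 < k1 - k2 by lra.
have kk_neq : k1 + k2 != 0 by rewrite -HE gt_eqF.
have H_neq : H != 0 by rewrite gt_eqF.
have s0 : 0 < s by rewrite sE; apply: divr_gt0; lra.
have k1s : k1 = H * (1 + s) / 2 by rewrite sE HE; field.
have k2s : k2 = H * (1 - s) / 2 by rewrite sE HE; field.
have s2 : 1 - s ^+ 2 = 4 * (k1 * k2) / H ^+ 2.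
  by rewrite sE HE; field.
pose w1 := H1 / H; pose w2 := H2 / H.
have H1w : H1 = H * w1 by rewrite /w1 mulrC divfK // gt_eqF.
have H2w : H2 = H * w2 by rewrite /w2 mulrC divfK // gt_eqF.
have K1w : K1 = 2 * (k1 * k2) * w1.
  have : 4 * K1 = 4 * (2 * (k1 * k2) * w1) by rewrite K1s s2 H1w; field.
  lra.
have K2w : K2 = 2 * (k1 * k2) * w2.
  have : 4 * K2 = 4 * (2 * (k1 * k2) * w2) by rewrite K2s s2 H2w; field.
  lra.
(* Criticality of [s] gives two linear equations for [P1], [S1], with determinant [k1 - k2]; their
   solution says that both curvatures vary proportionally to [H]. The same holds in the second
   direction. *)
have d_neq : k1 - k2 != 0 by rewrite gt_eqF.
have S1w : S1 = k2 * w1.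
  apply: (mulfI d_neq).
  have -> : (k1 - k2) * S1 = K1 - k2 * H1 by rewrite K1E H1E; ring.
  by rewrite K1w H1w HE; ring.
have P1w : P1 = k1 * w1.
  have -> : P1 = H1 - S1 by rewrite H1E; ring.
  by rewrite H1w S1w HE; ring.
have S2w : S2 = k2 * w2.
  apply: (mulfI d_neq).
  have -> : (k1 - k2) * S2 = K2 - k2 * H2 by rewrite K2E H2E; ring.
  by rewrite K2w H2w HE; ring.
have P2w : P2 = k1 * w2.
  have -> : P2 = H2 - S2 by rewrite H2E; ring.
  by rewrite H2w S2w HE; ring.
have X1 : K11 - k2 * H11 = k2 * H11 * (k1 - k2) / H + 2 * (k1 * k2) * w1 ^+ 2
    - H * (k1 - k2) * s11 / 2.
  have : 4 * (K11 - k2 * H11) = 4 * (k2 * H11 * (k1 - k2) / H + 2 * (k1 * k2) * w1 ^+ 2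
    - H * (k1 - k2) * s11 / 2); last by lra.
  by rewrite mulrBr K11s s2 H1w sE HE; field.
have X2 : K22 - k1 * H22 = - k1 * H22 * (k1 - k2) / H + 2 * (k1 * k2) * w2 ^+ 2
    - H * (k1 - k2) * s22 / 2.
  have : 4 * (K22 - k1 * H22) = 4 * (- k1 * H22 * (k1 - k2) / H + 2 * (k1 * k2) * w2 ^+ 2
    - H * (k1 - k2) * s22 / 2); last by lra.
  by rewrite mulrBr K22s s2 H2w sE HE; field.
(* In this combination [P11] and [S22] cancel, and the second derivatives of the two forms that
   remain are [k1 - k2] times the left side of Simons' identity. *)
have X3 : (K11 - k2 * H11) + (K22 - k1 * H22) =
    (k1 - k2) * (- (k1 * k2 * (k1 - k2))) + 2 * (k1 * k2) * (w1 ^+ 2 + w2 ^+ 2)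
    - 2 * (k1 * w2) ^+ 2 - 2 * (k2 * w1) ^+ 2.
  by rewrite -sim K11E H11E K22E H22E P1w S1w P2w S2w; ring.
(* The previous relations are solved for the combination of [H11] and [H22] that occurs in
   [k1 * Phi22 - k2 * Phi11]. *)
have X4 : (k1 * H22 - k2 * H11) / H = k1 * k2 * (k1 - k2)
    + 2 * ((k1 * w2) ^+ 2 + (k2 * w1) ^+ 2) / (k1 - k2) - H * (s11 + s22) / 2.
  apply: (mulfI d_neq).
  have -> : (k1 - k2) * ((k1 * H22 - k2 * H11) / H) =
      - (k2 * H11 * (k1 - k2) / H) - (- k1 * H22 * (k1 - k2) / H).
    by field.
  have -> : k2 * H11 * (k1 - k2) / H = K11 - k2 * H11 - 2 * (k1 * k2) * w1 ^+ 2
    + H * (k1 - k2) * s11 / 2 by rewrite X1; ring.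
  have -> : - k1 * H22 * (k1 - k2) / H = K22 - k1 * H22 - 2 * (k1 * k2) * w2 ^+ 2
    + H * (k1 - k2) * s22 / 2 by rewrite X2; ring.
  have -> : K22 - k1 * H22 = (k1 - k2) * (- (k1 * k2 * (k1 - k2)))
    + 2 * (k1 * k2) * (w1 ^+ 2 + w2 ^+ 2)
    - 2 * (k1 * w2) ^+ 2 - 2 * (k2 * w1) ^+ 2 - (K11 - k2 * H11) by rewrite -X3; ring.
  by field.
(* Up to the positive factor [A0] and a negative one in [stE], [T] governs the time derivative of
   [s], the Hessian of [H] being eliminated by [X4]. *)
pose T := f0 * (al - 1) * (k1 * k2 * (k1 - k2))
  + f0 * al * (w2 ^+ 2 * ((al - 1) * k1 + 2 * k1 ^+ 2 / (k1 - k2))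
               + w1 ^+ 2 * (k2 * (2 * k2 - (al - 1) * (k1 - k2)) / (k1 - k2)))
  + (- s11) * (H / 2 * (al * f0 + (1 - s) * f1))
  + (- s22) * (H / 2 * (al * f0 - (1 + s) * f1)).
have T0 : 0 < T.
  rewrite /T -!addrA; apply: ltr_wpDr; last by rewrite !mulr_gt0 // subr_gt0.
  rewrite !addr_ge0 //; apply: mulr_ge0; rewrite ?oppr_ge0 //.
  - by rewrite mulr_ge0 // ltW //; lra.
  - apply: addr_ge0; apply: mulr_ge0; rewrite ?sqr_ge0 //.
      apply: addr_ge0; first by rewrite mulr_ge0 // ltW //; lra.
      by rewrite divr_ge0 ?mulr_ge0 ?sqr_ge0 // ltW.
    (* The hypothesis [pinch] decides the sign of this coefficient; its bracket is
       [H * (1 - al * s)]. *)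
    by rewrite divr_ge0 ?(ltW d0) // mulr_ge0 ?(ltW k20) // subr_ge0.
  - by rewrite mulr_ge0 ?divr_ge0 ?(ltW H0) ?(ltW par1).
  - by rewrite mulr_ge0 ?divr_ge0 ?(ltW H0) ?(ltW par2).
have TE : k1 * Phi22 - k2 * Phi11 - Phi * (k1 * k2) * (k1 - k2) = A0 * T.
  rewrite Phi11E Phi22E PhiE -/w1 -/w2.
  have -> : k1 * (A0 * (f0 * al * (al - 1) * w2 ^+ 2 + f0 * al * (H22 / H) + f1 * s22)) -
    k2 * (A0 * (f0 * al * (al - 1) * w1 ^+ 2 + f0 * al * (H11 / H) + f1 * s11)) -
    A0 * f0 * (k1 * k2) * (k1 - k2) =
    A0 * (f0 * al * ((al - 1) * (k1 * w2 ^+ 2 - k2 * w1 ^+ 2) + (k1 * H22 - k2 * H11) / H)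
      + f1 * (k1 * s22 - k2 * s11) - f0 * (k1 * k2) * (k1 - k2)).
    by field.
  congr (A0 * _); rewrite X4 /T.
  have -> : H / 2 * (al * f0 + (1 - s) * f1) = f0 * al * H / 2 + f1 * k2.
    by rewrite k2s; field.
  have -> : H / 2 * (al * f0 - (1 + s) * f1) = f0 * al * H / 2 - f1 * k1.
    by rewrite k1s; field.
  by field.
have stE : H ^+ 3 * s * st = - 2 * (k1 - k2) * (A0 * T).
  rewrite -TE.
  have -> : H ^+ 3 * s * st = H / 2 * (2 * H ^+ 2 * s * st) by field.
  have -> : 2 * H ^+ 2 * s * st = 2 * (H * Ht) * (1 - s ^+ 2) - 4 * Kt by rewrite Kts; ring.
  by rewrite s2 HtE KtE atE ctE PtE StE HE; field.
have : H ^+ 3 * s * st < 0.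
  by rewrite stE mulNr mulNr oppr_lt0 !mulr_gt0.
by rewrite pmulr_rlt0 // mulr_gt0 // exprn_gt0.
Qed.

(** * Second derivatives of the speed and of the relation between H, K and s *)

Section composite_jets.
Context {R : realType} {V : normedModType R}.
Variables (p v : V).

Lemma powR_B1 (x al : R) : 0 < x -> x `^ (al - 1) = x `^ al / x.
Proof. by move=> x0; rewrite powRB ?(gt_eqF x0) ?implybT // powRr1 // ltW. Qed.

Lemma derive2_powR (H : V -> R) al : smooth_at H p -> 0 < H p ->
  'D_v ('D_v (fun q => H q `^ al)) p =
  H p `^ al * (al * (al - 1) * ('D_v H p / H p) ^+ 2 + al * ('D_v ('D_v H) p / H p)).
Proof.
move=> sH H0.
have e : 'D_v ('D_v (fun q => H q `^ al)) p =
    'D_v (fun q => al * H q `^ (al - 1) * 'D_v H q) p.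
  apply: near_eq_derive.
  apply: filterS2 (smooth_at_near sH) (smooth_at_near_gt sH H0) => q sq q0.
  exact: derive_powRs.
have s1 : smooth_at (fun q => H q `^ (al - 1)) p by exact: smooth_at_powR.
have s2 : smooth_at (fun q => al * H q `^ (al - 1)) p by exact: smooth_atcM.
have s3 : smooth_at ('D_v H) p := smooth_at_derive v sH.
apply: (etrans e); apply: (etrans (deriveMs v s2 s3)).
have e2 := etrans (derivecMs al v s1) (congr1 ( *%R al) (derive_powRs (al - 1) v H0 sH)).
apply: (etrans (congr1 (fun x => x * 'D_v H p + al * H p `^ (al - 1) * 'D_v ('D_v H) p) e2)).
rewrite !powR_B1 //; move: ('D_v H p) ('D_v ('D_v H) p) (H p `^ al) => x y z.
by field; rewrite gt_eqF.
Qed.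

(** The term with the second derivative of [phi] carries the square of ['D_v s p] and disappears;
    only [phi] and its first derivative reach the evolution equation. *)
Lemma derive2_comp_critical (phi : R -> R) (s : V -> R) :
  smooth_at s p -> smooth_at phi (s p) -> 'D_v s p = 0 ->
  'D_v (fun q => phi (s q)) p = 0 /\
  'D_v ('D_v (fun q => phi (s q))) p = 'D_1 phi (s p) * 'D_v ('D_v s) p.
Proof.
move=> ss sphi s0.
have e0 := derive_comp1 v ss sphi.
split; first by apply: (etrans e0); rewrite s0 mulr0.
have cs : s q @[q --> p] --> s p := smooth_at_continuous ss.
have ns : \forall q \near p, smooth_at phi (s q) := cs _ (smooth_at_near sphi).
have sD : smooth_at ('D_1 phi) (s p) := smooth_at_derive (1 : R) sphi.
have s1 : smooth_at (fun q => 'D_1 phi (s q)) p := smooth_at_comp1 ss sD.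
have s2 : smooth_at ('D_v s) p := smooth_at_derive v ss.
have e : 'D_v ('D_v (fun q => phi (s q))) p = 'D_v (fun q => 'D_1 phi (s q) * 'D_v s q) p.
  apply: near_eq_derive; apply: filterS2 (smooth_at_near ss) ns => q.
  exact: derive_comp1.
apply: (etrans e); apply: (etrans (deriveMs v s1 s2)).
by rewrite s0 mulr0 add0r.
Qed.

Lemma derive2_speed (H s : V -> R) (phi : R -> R) al :
  smooth_at H p -> 0 < H p -> smooth_at s p -> smooth_at phi (s p) -> 'D_v s p = 0 ->
  'D_v ('D_v (fun q => H q `^ al * phi (s q))) p =
  H p `^ al * (phi (s p) * al * (al - 1) * ('D_v H p / H p) ^+ 2 +
     phi (s p) * al * ('D_v ('D_v H) p / H p) + 'D_1 phi (s p) * 'D_v ('D_v s) p).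
Proof.
move=> sH H0 ss sphi s0.
have s1 : smooth_at (fun q => H q `^ al) p by exact: smooth_at_powR.
have s2 : smooth_at (fun q => phi (s q)) p := smooth_at_comp1 ss sphi.
have [c1 c2] := derive2_comp_critical ss sphi s0.
apply: (etrans (derive2M v s1 s2)).
rewrite c1 c2 (derive2_powR al sH H0).
move: ('D_v H p) ('D_v ('D_v H) p) (H p `^ al) ('D_1 phi (s p)) ('D_v ('D_v s) p)
  ('D_v (fun q => H q `^ al) p) => x y z u w t.
ring.
Qed.

Section pinching_relation.
Variables (H K s : V -> R).
Hypotheses (sH : smooth_at H p) (sK : smooth_at K p) (ss : smooth_at s p).
Hypothesis KE : \forall q \near p, 4 * K q = H q * H q * (1 - s q * s q).

Let sHH : smooth_at (fun q => H q * H q) p := smooth_atM sH sH.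
Let sss : smooth_at (fun q => s q * s q) p := smooth_atM ss ss.
Let s1 : smooth_at (fun=> 1 : R) p := smooth_at_cst (1 : R) p.
Let sB : smooth_at (fun q => 1 - s q * s q) p := smooth_atB s1 sss.

Lemma derive_pinching :
  4 * 'D_v K p = 2 * (H p * 'D_v H p) * (1 - s p ^+ 2) - 2 * H p ^+ 2 * s p * 'D_v s p.
Proof.
have e1 := derivecMs 4 v sK.
have e2 := etrans (deriveMs v sHH sB) (congr2 (fun x y => x * (1 - s p * s p) + H p * H p * y)
  (deriveMs v sH sH) (etrans (deriveBs v s1 sss)
    (congr2 (fun x y => x - y) (derive_cst (1 : R) p v) (deriveMs v ss ss)))).
apply: (etrans (esym e1)); apply: (etrans (near_eq_derive v KE)); apply: (etrans e2).
by move: ('D_v H p) ('D_v s p) => x y; ring.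
Qed.

Lemma derive2_pinching : 'D_v s p = 0 ->
  4 * 'D_v ('D_v K) p = 2 * ('D_v H p ^+ 2 + H p * 'D_v ('D_v H) p) * (1 - s p ^+ 2)
    - 2 * H p ^+ 2 * s p * 'D_v ('D_v s) p.
Proof.
move=> s0.
have e1 := derive2cM 4 v sK.
have e : 'D_v ('D_v (fun q => 4 * K q)) p =
    'D_v ('D_v (fun q => H q * H q * (1 - s q * s q))) p.
  by apply: near_eq_derive; apply: filterS (near_join KE) => q; exact: near_eq_derive.
have dB : 'D_v (fun q => 1 - s q * s q) p = 0.
  apply: (etrans (deriveBs v s1 sss)).
  apply: (etrans (congr2 (fun x y => x - y) (derive_cst (1 : R) p v) (deriveMs v ss ss))).
  by rewrite s0; ring.
have d1 : 'D_v ('D_v (fun=> 1 : R)) p = 0.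
  apply: (etrans _ (derive_cst (0 : R) p v)); apply: near_eq_derive.
  by apply: nearW => q; exact: derive_cst.
have ddB : 'D_v ('D_v (fun q => 1 - s q * s q)) p = - (2 * s p * 'D_v ('D_v s) p).
  apply: (etrans (derive2B v s1 sss)).
  apply: (etrans (congr2 (fun x y => x - y) d1 (derive2M v ss ss))).
  by rewrite s0; move: ('D_v ('D_v s) p) => x; ring.
apply: (etrans (esym e1)); apply: (etrans e); apply: (etrans (derive2M v sHH sB)).
rewrite dB ddB (derive2M v sH sH).
by move: ('D_v H p) ('D_v ('D_v H) p) ('D_v ('D_v s) p) ('D_v (fun q => H q * H q) p) =>
  x y z w; ring.
Qed.

End pinching_relation.
End composite_jets.

Lemma meanc_mul {R : realType} (a b c p q r : R) : a * c - b * b != 0 ->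
  meanc a b c p q r * (a * c - b * b) = c * p - 2 * (b * q) + a * r.
Proof. by move=> d0; rewrite /meanc expr2 divfK // mulrA. Qed.

Lemma gaussc_mul {R : realType} (a b c p q r : R) : a * c - b * b != 0 ->
  gaussc a b c p q r * (a * c - b * b) = p * r - q * q.
Proof. by move=> d0; rewrite /gaussc !expr2 divfK. Qed.

(** Collects the identities at the origin of normal coordinates for [pinching_algebra]. The flow
    equation and the maximality of [s] are required on the slice [A] only, since the extended
    surface is arbitrary beyond valid times. The relations among [H], [K] and [s] hold in a full
    neighbourhood, so they may be differentiated in time as well. *)
Lemma pinching_decreases {R : realType} {V : normedModType R}
    (Y n : V -> 'rV[R]_3) (e1 e2 et p : V) (A : set V) (H K s : V -> R)
    (phi : R -> R) (al k1 k2 : R) :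
  smooth_at Y p -> smooth_at n p -> smooth_at H p -> smooth_at K p -> smooth_at s p ->
  smooth_at phi (s p) ->
  (\forall q \near p, dotv (n q) (n q) = 1) ->
  (\forall q \near p, dotv (n q) ('D_e1 Y q) = 0) ->
  (\forall q \near p, dotv (n q) ('D_e2 Y q) = 0) ->
  dotv ('D_e1 Y p) ('D_e1 Y p) = 1 -> dotv ('D_e1 Y p) ('D_e2 Y p) = 0 ->
  dotv ('D_e2 Y p) ('D_e2 Y p) = 1 ->
  'D_e1 ('D_e1 Y) p = - k1 *: n p -> 'D_e1 ('D_e2 Y) p = 0 ->
  'D_e2 ('D_e2 Y) p = - k2 *: n p ->
  A p -> (forall q r, A q -> A (r *: e1 + q)) -> (forall q r, A q -> A (r *: e2 + q)) ->
  (\forall q \near p, A q -> 'D_et Y q = - (H q `^ al * phi (s q)) *: n q) ->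
  (\forall q \near p, H q = meanc
     (dotv ('D_e1 Y q) ('D_e1 Y q)) (dotv ('D_e1 Y q) ('D_e2 Y q)) (dotv ('D_e2 Y q) ('D_e2 Y q))
     (- dotv ('D_e1 ('D_e1 Y) q) (n q)) (- dotv ('D_e1 ('D_e2 Y) q) (n q))
     (- dotv ('D_e2 ('D_e2 Y) q) (n q))) ->
  (\forall q \near p, K q = gaussc
     (dotv ('D_e1 Y q) ('D_e1 Y q)) (dotv ('D_e1 Y q) ('D_e2 Y q)) (dotv ('D_e2 Y q) ('D_e2 Y q))
     (- dotv ('D_e1 ('D_e1 Y) q) (n q)) (- dotv ('D_e1 ('D_e2 Y) q) (n q))
     (- dotv ('D_e2 ('D_e2 Y) q) (n q))) ->
  (\forall q \near p, 4 * K q = H q * H q * (1 - s q * s q)) ->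
  (\forall q \near p, A q -> s q <= s p) ->
  1 < al -> 0 < k2 -> k2 < k1 -> s p = (k1 - k2) / (k1 + k2) ->
  0 < phi (s p) -> 0 < al * phi (s p) + (1 - s p) * 'D_1 phi (s p) ->
  0 < al * phi (s p) - (1 + s p) * 'D_1 phi (s p) ->
  (al - 1) * (k1 - k2) <= 2 * k2 ->
  'D_et s p < 0.
Proof.
move=> sY sn sH sK ss sphi nn nY1 nY2 Y11 Y12 Y22 D11 D12 D22 Ap Ae1 Ae2 flow HE KE KsE smax
  al1 k20 k21 sp phi0 par1 par2 pinch.
have sY1 : smooth_at ('D_e1 Y) p := smooth_at_derive e1 sY.
have sY2 : smooth_at ('D_e2 Y) p := smooth_at_derive e2 sY.
have sY11 : smooth_at ('D_e1 ('D_e1 Y)) p := smooth_at_derive e1 sY1.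
have sY12 : smooth_at ('D_e1 ('D_e2 Y)) p := smooth_at_derive e1 sY2.
have sY22 : smooth_at ('D_e2 ('D_e2 Y)) p := smooth_at_derive e2 sY2.
pose a q := dotv ('D_e1 Y q) ('D_e1 Y q).
pose b q := dotv ('D_e1 Y q) ('D_e2 Y q).
pose c q := dotv ('D_e2 Y q) ('D_e2 Y q).
pose P q := - dotv ('D_e1 ('D_e1 Y) q) (n q).
pose Q q := - dotv ('D_e1 ('D_e2 Y) q) (n q).
pose S q := - dotv ('D_e2 ('D_e2 Y) q) (n q).
have sa : smooth_at a p := smooth_at_dotv sY1 sY1.
have sb : smooth_at b p := smooth_at_dotv sY1 sY2.
have sc : smooth_at c p := smooth_at_dotv sY2 sY2.
have sP : smooth_at P p := smooth_atN (smooth_at_dotv sY11 sn).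
have sQ : smooth_at Q p := smooth_atN (smooth_at_dotv sY12 sn).
have sS : smooth_at S p := smooth_atN (smooth_at_dotv sY22 sn).
have sdet : smooth_at (fun q => a q * c q - b q * b q) p.
  exact: smooth_atB (smooth_atM sa sc) (smooth_atM sb sb).
have det0 : \forall q \near p, a q * c q - b q * b q != 0.
  have : 0 < a p * c p - b p * b p.
    have [-> -> ->] : [/\ a p = 1, b p = 0 & c p = 1] := And3 Y11 Y12 Y22.
    by rewrite mulr1 mulr0 subr0 ltr01.
  by move=> /(smooth_at_near_gt sdet); apply: filterS => q ?; rewrite gt_eqF.
have HE' : \forall q \near p,
    H q * (a q * c q - b q * b q) = c q * P q - 2 * (b q * Q q) + a q * S q.
  move: HE det0; apply: filterS2 => q hq d0.
  exact: etrans (congr1 (fun x => x * _) hq) (meanc_mul _ _ _ d0).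
have KE' : \forall q \near p,
    K q * (a q * c q - b q * b q) = P q * S q - Q q * Q q.
  move: KE det0; apply: filterS2 => q hq d0.
  exact: etrans (congr1 (fun x => x * _) hq) (gaussc_mul _ _ _ d0).
have ap : a p = 1 := Y11.
have bp : b p = 0 := Y12.
have cp : c p = 1 := Y22.
have [Pp Qp Sp] : [/\ P p = k1, Q p = 0 & S p = k2] := second_form_values nn D11 D12 D22.
have [a1 b1 c1] : [/\ 'D_e1 a p = 0, 'D_e1 b p = 0 & 'D_e1 c p = 0] :=
  first_form_derive1 sY nY1 nY2 D11 D12.
have [a2 b2 c2] : [/\ 'D_e2 a p = 0, 'D_e2 b p = 0 & 'D_e2 c p = 0] :=
  first_form_derive2 sY nY1 nY2 D12 D22.
have w1 := weingarten1 sY sn nn nY1 nY2 Y11 Y12 Y22 D11 D12.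
have w2 := weingarten2 sY sn nn nY1 nY2 Y11 Y12 Y22 D12 D22.
have cod1 : 'D_e1 Q p = 'D_e2 P p :=
  codazzi1 sY sn nn nY1 nY2 Y11 Y12 Y22 D11 D12 D22.
have cod2 : 'D_e2 Q p = 'D_e1 S p :=
  codazzi2 sY sn nn nY1 nY2 Y11 Y12 Y22 D11 D12 D22.
have sim : 'D_e1 ('D_e1 S) p - 'D_e2 ('D_e2 P) p - k2 * 'D_e1 ('D_e1 c) p
    + k1 * 'D_e2 ('D_e2 a) p = - (k1 * k2 * (k1 - k2)) :=
  simons sY sn nn nY1 nY2 Y11 Y12 Y22 D11 D12 D22.
have Hp := meanc_value ap bp cp Pp Qp Sp HE'.
have H0 : 0 < H p := eq_ind_r (fun x => 0 < x) (addr_gt0 (lt_trans k20 k21) k20) Hp.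
pose Phi q := H q `^ al * phi (s q).
have sPhi : smooth_at Phi p :=
  smooth_atM (smooth_at_powR al H0 sH) (smooth_at_comp1 ss sphi).
have flow' : \forall q \near p, A q -> 'D_et Y q = - Phi q *: n q := flow.
have at' : 'D_et a p = - 2 * (Phi p * k1) :=
  first_form_evolution sY nn nY1 D11 Ap Ae1 flow'.
have ct : 'D_et c p = - 2 * (Phi p * k2) :=
  first_form_evolution sY nn nY2 D22 Ap Ae2 flow'.
have Pt : 'D_et P p = 'D_e1 ('D_e1 Phi) p - Phi p * k1 ^+ 2 :=
  second_form_evolution sY sn sPhi nn nY1 Y11 D11 w1 Ap Ae1 flow'.
have St : 'D_et S p = 'D_e2 ('D_e2 Phi) p - Phi p * k2 ^+ 2 :=
  second_form_evolution sY sn sPhi nn nY2 Y22 D22 w2 Ap Ae2 flow'.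
clear HE KE det0 sdet w1 w2 flow flow' D11 D12 D22 Y11 Y12 Y22 nn nY1 nY2 sY1 sY2 sY11 sY12 sY22.
clearbody a b c P Q S.
have lmax e : (forall q r, A q -> A (r *: e + q)) ->
    \forall h \near (0 : R), s (h *: e + p) <= s p.
  move=> Ae.
  have cl : (h *: e + p) @[h --> (0 : R)] --> p by exact: cvg_line.
  have h : \forall h \near (0 : R), A (h *: e + p) -> s (h *: e + p) <= s p by exact: cl smax.
  by move: h; apply: filterS => h; apply; exact: Ae.
have [s1 s11] := derive_max0 ss (lmax e1 Ae1).
have [s2 s22] := derive_max0 ss (lmax e2 Ae2).
have H1 := derive_meanc sa sb sc sP sQ sS sH ap bp cp Pp Qp Sp HE' e1.
have H2 := derive_meanc sa sb sc sP sQ sS sH ap bp cp Pp Qp Sp HE' e2.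
have Ht := derive_meanc sa sb sc sP sQ sS sH ap bp cp Pp Qp Sp HE' et.
have K1 := derive_gaussc sa sb sc sP sQ sS sK ap bp cp Pp Qp Sp KE' e1.
have K2 := derive_gaussc sa sb sc sP sQ sS sK ap bp cp Pp Qp Sp KE' e2.
have Kt := derive_gaussc sa sb sc sP sQ sS sK ap bp cp Pp Qp Sp KE' et.
have H11 := derive2_meanc sa sb sc sP sQ sS sH ap bp cp Pp Qp Sp HE' a1 b1 c1.
have H22 := derive2_meanc sa sb sc sP sQ sS sH ap bp cp Pp Qp Sp HE' a2 b2 c2.
have K11 := derive2_gaussc sa sb sc sP sQ sS sK ap bp cp Pp Qp Sp KE' a1 b1 c1.
have K22 := derive2_gaussc sa sb sc sP sQ sS sK ap bp cp Pp Qp Sp KE' a2 b2 c2.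
have R1 := derive_pinching e1 sH sK ss KsE.
have R2 := derive_pinching e2 sH sK ss KsE.
have Rt := derive_pinching et sH sK ss KsE.
have R11 := derive2_pinching sH sK ss KsE s1.
have R22 := derive2_pinching sH sK ss KsE s2.
have F11 := derive2_speed al sH H0 ss sphi s1.
have F22 := derive2_speed al sH H0 ss sphi s2.
(* The Codazzi equations turn the derivatives of the off-diagonal coefficient [Q] into those of [P]
   and [S]. *)
rewrite cod1 in K11; rewrite cod2 in K22.
have A0 : 0 < H p `^ al by exact: powR_gt0.
rewrite a1 c1 !mulr0 !subr0 in H1; rewrite a2 c2 !mulr0 !subr0 in H2.
rewrite a1 c1 addr0 mulr0 subr0 in K1; rewrite a2 c2 addr0 mulr0 subr0 in K2.
rewrite s1 mulr0 subr0 in R1; rewrite s2 mulr0 subr0 in R2.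
exact: (pinching_algebra al1 k20 k21 phi0 A0 Hp sp par1 par2 pinch H1 K1 R1 H2 K2 R2
  R11 R22 H11 K11 H22 K22 sim Ht Kt Rt at' ct Pt St (erefl (Phi p)) F11 F22 s11 s22).
Qed.

(** * Change of coordinates *)

Section reparametrization.
Context {R : realType}.
Local Notation E := ('rV[R]_2 * R)%type.

Definition espace (i : 'I_2) : E := (delta_mx 0 i, 0).
Definition etime : E := (0, 1).

(** The normal enters as a single vector [m], so that the formula applies both to [nu], of which no
    smoothness is known, and to a smooth local normal. *)
Definition mean_at {V : normedModType R} (Y : V -> 'rV[R]_3) (m : 'rV[R]_3) (e1 e2 p : V) : R :=
  meanc (dotv ('D_e1 Y p) ('D_e1 Y p)) (dotv ('D_e1 Y p) ('D_e2 Y p))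
    (dotv ('D_e2 Y p) ('D_e2 Y p))
    (- dotv ('D_e1 ('D_e1 Y) p) m) (- dotv ('D_e1 ('D_e2 Y) p) m)
    (- dotv ('D_e2 ('D_e2 Y) p) m).

Definition gauss_at {V : normedModType R} (Y : V -> 'rV[R]_3) (m : 'rV[R]_3) (e1 e2 p : V) : R :=
  gaussc (dotv ('D_e1 Y p) ('D_e1 Y p)) (dotv ('D_e1 Y p) ('D_e2 Y p))
    (dotv ('D_e2 Y p) ('D_e2 Y p))
    (- dotv ('D_e1 ('D_e1 Y) p) m) (- dotv ('D_e1 ('D_e2 Y) p) m)
    (- dotv ('D_e2 ('D_e2 Y) p) m).

Definition first_det {V : normedModType R} (Y : V -> 'rV[R]_3) (e1 e2 p : V) : R :=
  dotv ('D_e1 Y p) ('D_e1 Y p) * dotv ('D_e2 Y p) ('D_e2 Y p) - dotv ('D_e1 Y p) ('D_e2 Y p) ^+ 2.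

Lemma row2E (u : 'rV[R]_2) : u = u 0 0 *: delta_mx 0 0 + u 0 1 *: delta_mx 0 1.
Proof.
rewrite [LHS]row_sum_delta !big_ord_recl big_ord0 addr0.
by rewrite (_ : lift ord0 ord0 = 1 :> 'I_2); last exact: val_inj.
Qed.

Lemma dotv_comb2 n (x y : R) (u v m : 'rV[R]_n) :
  dotv (x *: u + y *: v) m = x * dotv u m + y * dotv v m.
Proof. by rewrite dotvDl !dotvZl. Qed.

(** [M0] and [M1] are the products of the tangent vectors with the normal; their vanishing removes
    the second derivatives of the coordinate change, and a congruence by the Jacobian is left. *)
Lemma mean_gauss_reparam_algebra (Ya Yb W0 W1 : 'rV[R]_3) 
    (j11 j12 j21 j22 P Q S h1 h2 h3 M0 M1 x1 y1 x2 y2 x3 y3 : R) :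
  Ya = j11 *: W0 + j12 *: W1 -> Yb = j21 *: W0 + j22 *: W1 ->
  M0 = 0 -> M1 = 0 ->
  h1 = x1 * M0 + j11 * (j11 * P + j12 * Q) + (y1 * M1 + j12 * (j11 * Q + j12 * S)) ->
  h2 = x2 * M0 + j21 * (j11 * P + j12 * Q) + (y2 * M1 + j22 * (j11 * Q + j12 * S)) ->
  h3 = x3 * M0 + j21 * (j21 * P + j22 * Q) + (y3 * M1 + j22 * (j21 * Q + j22 * S)) ->
  j11 * j22 - j12 * j21 != 0 -> dotv W0 W0 * dotv W1 W1 - dotv W0 W1 ^+ 2 != 0 ->
  meanc (dotv Ya Ya) (dotv Ya Yb) (dotv Yb Yb) (- h1) (- h2) (- h3) =
    meanc (dotv W0 W0) (dotv W0 W1) (dotv W1 W1) (- P) (- Q) (- S) /\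
  gaussc (dotv Ya Ya) (dotv Ya Yb) (dotv Yb Yb) (- h1) (- h2) (- h3) =
    gaussc (dotv W0 W0) (dotv W0 W1) (dotv W1 W1) (- P) (- Q) (- S).
Proof.
move=> -> -> -> -> -> -> ->; rewrite !(dotvDl, dotvDr, dotvZl, dotvZr) (dotvC W1 W0).
move: (dotv W0 W0) (dotv W0 W1) (dotv W1 W1) => A B C J D.
have e1 := @meanc_congruence R j11 j12 j21 j22 A B C (- P) (- Q) (- S) J D.
have e2 := @gaussc_congruence R j11 j12 j21 j22 A B C (- P) (- Q) (- S) J D.
by rewrite -e1 -e2; split; [congr meanc|congr gaussc]; ring.
Qed.

Section chain_rule.
Context {V : normedModType R}.
Variables (psi : V -> 'rV[R]_2) (tau : V -> R).

Lemma derive_reparam (W : E -> 'rV[R]_3) p v :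
  smooth_at W (psi p, tau p) -> smooth_at psi p -> smooth_at tau p -> 'D_v tau p = 0 ->
  'D_v (fun q => W (psi q, tau q)) p =
  ('D_v psi p) 0 0 *: 'D_(espace 0) W (psi p, tau p) + ('D_v psi p) 0 1 *: 'D_(espace 1) W (psi p, tau p).
Proof.
move=> /smooth_at_differentiable dW /smooth_at_differentiable dpsi
  /smooth_at_differentiable dtau t0.
have dP : differentiable (fun q => (psi q, tau q)) p by exact: differentiable_pair.
rewrite deriveE; last exact: (@differentiable_comp _ _ _ _ (fun q => (psi q, tau q)) W).
rewrite (@diff_comp _ _ _ _ (fun q => (psi q, tau q)) W) //=.
rewrite diff_pair //= -(deriveE v dpsi) -(deriveE v dtau) t0.
have -> : ('D_v psi p, 0) = ('D_v psi p) 0 0 *: espace 0 + ('D_v psi p) 0 1 *: espace 1 :> E.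
  rewrite [in LHS](row2E ('D_v psi p)); congr pair.
  by change (0 = ('D_v psi p) 0 0 * 0 + ('D_v psi p) 0 1 * 0 :> R); rewrite !mulr0 addr0.
by rewrite linearD !linearZ /= !deriveE.
Qed.

Variables (W : E -> 'rV[R]_3) (p : V).
Hypotheses (sW : smooth_at W (psi p, tau p)) (spsi : smooth_at psi p) (stau : smooth_at tau p).

Lemma smooth_at_reparam : smooth_at (fun q => W (psi q, tau q)) p.
Proof. exact: smooth_at_comp_pair. Qed.

Lemma near_reparam (A : E -> Prop) :
  (\forall P \near (psi p, tau p), A P) -> \forall q \near p, A (psi q, tau q).
Proof.
have dP : differentiable (fun q => (psi q, tau q)) p.
  exact: differentiable_pair (smooth_at_differentiable spsi) (smooth_at_differentiable stau).
have c : (psi q, tau q) @[q --> p] --> (psi p, tau p) := differentiable_continuous dP.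
by move=> h; exact: c h.
Qed.

(** Pairing with the fixed vector [m] before the second differentiation leaves only sums and
    products of scalar functions to differentiate. *)
Lemma derive2_reparam (m : 'rV[R]_3) v w :
  (\forall q \near p, 'D_v tau q = 0) -> (\forall q \near p, 'D_w tau q = 0) ->
  dotv ('D_w ('D_v (fun q => W (psi q, tau q))) p) m =
  ('D_w ('D_v psi) p) 0 0 * dotv ('D_(espace 0) W (psi p, tau p)) m + ('D_v psi p) 0 0 *
    (('D_w psi p) 0 0 * dotv ('D_(espace 0) ('D_(espace 0) W) (psi p, tau p)) m +
     ('D_w psi p) 0 1 * dotv ('D_(espace 0) ('D_(espace 1) W) (psi p, tau p)) m) +
  (('D_w ('D_v psi) p) 0 1 * dotv ('D_(espace 1) W (psi p, tau p)) m + ('D_v psi p) 0 1 *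
    (('D_w psi p) 0 0 * dotv ('D_(espace 0) ('D_(espace 1) W) (psi p, tau p)) m +
     ('D_w psi p) 0 1 * dotv ('D_(espace 1) ('D_(espace 1) W) (psi p, tau p)) m)).
Proof.
move=> tv tw.
pose Y q := W (psi q, tau q).
have sY : smooth_at Y p := smooth_at_reparam.
have sYv : smooth_at ('D_v Y) p := smooth_at_derive v sY.
have e0 : dotv ('D_w ('D_v Y) p) m = 'D_w (fun q => dotv ('D_v Y q) m) p.
  have h := derive_dotv w sYv (smooth_at_cst m p).
  have z : dotv ('D_v Y p) ('D_w (fun=> m) p) = 0.
    exact: etrans (congr1 (dotv _) (derive_cst m p w)) (dotv0r _).
  by apply: esym; apply: (etrans h); apply: (etrans (congr1 (fun x => _ + x) z)); exact: addr0.
have sW0 : smooth_at ('D_(espace 0) W) (psi p, tau p) := smooth_at_derive (espace 0) sW.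
have sW1 : smooth_at ('D_(espace 1) W) (psi p, tau p) := smooth_at_derive (espace 1) sW.
have sV0 : smooth_at (fun q => 'D_(espace 0) W (psi q, tau q)) p := smooth_at_comp_pair spsi stau sW0.
have sV1 : smooth_at (fun q => 'D_(espace 1) W (psi q, tau q)) p := smooth_at_comp_pair spsi stau sW1.
have sm : smooth_at (fun=> m) p := smooth_at_cst m p.
have sd0 := smooth_at_dotv sV0 sm; have sd1 := smooth_at_dotv sV1 sm.
have spv : smooth_at ('D_v psi) p := smooth_at_derive v spsi.
have sc0 := smooth_at_coord 0 spv; have sc1 := smooth_at_coord 1 spv.
have e1 : 'D_w (fun q => dotv ('D_v Y q) m) p =
   'D_w (fun q => ('D_v psi q) 0 0 * dotv ('D_(espace 0) W (psi q, tau q)) m +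
                  ('D_v psi q) 0 1 * dotv ('D_(espace 1) W (psi q, tau q)) m) p.
  apply: near_eq_derive.
  have n1 := near_reparam (smooth_at_near sW).
  have n2 := smooth_at_near spsi; have n3 := smooth_at_near stau.
  apply: filterS3 (filterI n1 n2) n3 tv => q [sq1 sq2] sq3 tq.
  exact: (etrans (congr1 (fun x => dotv x m) (derive_reparam sq1 sq2 sq3 tq))
    (dotv_comb2 _ _ _ _ _)).
have e2 := etrans (deriveDs w (smooth_atM sc0 sd0) (smooth_atM sc1 sd1))
  (congr2 +%R (deriveMs w sc0 sd0) (deriveMs w sc1 sd1)).
have dd (Z : E -> 'rV[R]_3) : smooth_at Z (psi p, tau p) ->
    'D_w (fun q => dotv (Z (psi q, tau q)) m) p =
    ('D_w psi p) 0 0 * dotv ('D_(espace 0) Z (psi p, tau p)) m +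
    ('D_w psi p) 0 1 * dotv ('D_(espace 1) Z (psi p, tau p)) m.
  move=> sZ.
  have h := derive_dotv w (smooth_at_comp_pair spsi stau sZ) sm.
  have z : dotv (Z (psi p, tau p)) ('D_w (fun=> m) p) = 0.
    exact: etrans (congr1 (dotv _) (derive_cst m p w)) (dotv0r _).
  apply: (etrans h); apply: (etrans (congr1 (fun x => _ + x) z)); apply: (etrans (addr0 _)).
  exact: (etrans (congr1 (fun x => dotv x m)
    (derive_reparam sZ spsi stau (nbhs_singleton tw))) (dotv_comb2 _ _ _ _ _)).
apply: (etrans e0); apply: (etrans e1); apply: (etrans e2).
have dp : derivable ('D_v psi) p w := smooth_at_derivable spv.
have g0 := etrans (dd _ sW0) (congr1 (fun x => _ + _ * dotv x m)
  (derive_comm_rV (espace 1) (espace 0) sW)).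
exact: (congr2 (fun x y => x + y)
  (congr2 (fun x y => x * _ + _ * y) (esym (derive_coord 0 dp)) g0)
  (congr2 (fun x y => x * _ + _ * y) (esym (derive_coord 1 dp)) (dd _ sW1))).
Qed.

Variables (a b : V) (m : 'rV[R]_3).
Hypotheses (ta : \forall q \near p, 'D_a tau q = 0) (tb : \forall q \near p, 'D_b tau q = 0).
Hypotheses (m0 : dotv ('D_(espace 0) W (psi p, tau p)) m = 0)
  (m1 : dotv ('D_(espace 1) W (psi p, tau p)) m = 0).
Hypothesis J0 : ('D_a psi p) 0 0 * ('D_b psi p) 0 1 - ('D_a psi p) 0 1 * ('D_b psi p) 0 0 != 0.
Hypothesis D0 : first_det W (espace 0) (espace 1) (psi p, tau p) != 0.

(** Serves twice: to compare an arbitrary chart of the sphere with the stereographic one, and to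
    pass to normal coordinates at a spatial maximum. *)
Lemma mean_gauss_reparam :
  mean_at (fun q => W (psi q, tau q)) m a b p = mean_at W m (espace 0) (espace 1) (psi p, tau p) /\
  gauss_at (fun q => W (psi q, tau q)) m a b p = gauss_at W m (espace 0) (espace 1) (psi p, tau p).
Proof.
have ea := derive_reparam sW spsi stau (nbhs_singleton ta).
have eb := derive_reparam sW spsi stau (nbhs_singleton tb).
have eaa := derive2_reparam m ta ta.
have eab := derive2_reparam m tb ta.
have ebb := derive2_reparam m tb tb.
exact: (mean_gauss_reparam_algebra ea eb m0 m1 eaa eab ebb J0 D0).
Qed.

End chain_rule.
End reparametrization.

(** * Independence of the principal curvatures of the chart *)

Section charts.
Context {R : realType}.
Local Notation E := ('rV[R]_2 * R)%type.
Local Notation d0 := (delta_mx 0 0 : 'rV[R]_2).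
Local Notation d1 := (delta_mx 0 1 : 'rV[R]_2).

Lemma derive_comb {V W : normedModType R} (f : V -> W) p (x y : R) (a b : V) :
  differentiable f p -> 'D_(x *: a + y *: b) f p = x *: 'D_a f p + y *: 'D_b f p.
Proof.
move=> df; rewrite (deriveE (x *: a + y *: b) df) (deriveE a df) (deriveE b df).
by rewrite linearD !linearZ.
Qed.

Lemma comb_eq0 (x y : R) : x *: d0 + y *: d1 = 0 -> x = 0 /\ y = 0.
Proof.
move=> e; split.
  by have := congr1 (fun v : 'rV[R]_2 => v 0 0) e; rewrite !mxE /= mulr1 mulr0 addr0.
by have := congr1 (fun v : 'rV[R]_2 => v 0 1) e; rewrite !mxE /= mulr1 mulr0 add0r.
Qed.

(** If the determinant vanished, both [r1 0 0 *: r0 - r0 0 0 *: r1] and its analogue for the other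
    column would be zero. Injectivity would make all their coefficients vanish, hence [r0 = 0],
    which contradicts injectivity. *)
Lemma immersive_jacobian (psi : 'rV[R]_2 -> 'rV[R]_2) u :
  differentiable psi u -> (forall w, 'D_w psi u = 0 -> w = 0) ->
  ('D_d0 psi u) 0 0 * ('D_d1 psi u) 0 1 - ('D_d0 psi u) 0 1 * ('D_d1 psi u) 0 0 != 0.
Proof.
move=> dpsi inj; apply/negP => /eqP J0.
move r0E : ('D_d0 psi u) J0 => r0; move r1E : ('D_d1 psi u) => r1 J0.
have h x y : x *: r0 + y *: r1 = 0 -> x = 0 /\ y = 0.
  by move=> e; apply: comb_eq0; apply: inj; rewrite derive_comb // r0E r1E.
have [|a1 /eqP] := h (r1 0 0) (- r0 0 0).
  apply/rowP => i; rewrite !mxE.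
  have [->|->] : i = 0 \/ i = 1 by case: i => [[|[|//]]] pi; [left|right]; exact: val_inj.
    by ring.
  by rewrite -[RHS]oppr0 -J0; ring.
rewrite oppr_eq0 => /eqP a2.
have [|a3 /eqP] := h (r1 0 1) (- r0 0 1).
  apply/rowP => i; rewrite !mxE.
  have [->|->] : i = 0 \/ i = 1 by case: i => [[|[|//]]] pi; [left|right]; exact: val_inj.
    by rewrite -J0; ring.
  by ring.
rewrite oppr_eq0 => /eqP a4.
have r00 : r0 = 0 by rewrite (row2E r0) a2 a4 !scale0r addr0.
have [|/eqP] := h 1 0; first by rewrite r00 scaler0 scale0r addr0.
by rewrite oner_eq0.
Qed.

Lemma first_det_ge0 (u v : 'rV[R]_3) : 0 <= dotv u u * dotv v v - dotv u v ^+ 2.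
Proof. by rewrite -dotv_cross dotv_ge0. Qed.

(** The Gram determinant is a squared length by Lagrange's identity. If it vanished, so would the
    vector [dotv r1 r1 *: r0 - dotv r0 r1 *: r1], a linear relation excluded by injectivity. *)
Lemma immersive_first_det (f : 'rV[R]_2 -> 'rV[R]_3) v :
  differentiable f v -> immersive_at f v -> 0 < first_det f d0 d1 v.
Proof.
move=> df inj; rewrite /first_det lt_neqAle first_det_ge0 andbT eq_sym.
apply/negP => /eqP D0.
move r0E : ('D_d0 f v) D0 => r0; move r1E : ('D_d1 f v) => r1 D0.
have h x y : x *: r0 + y *: r1 = 0 -> x = 0 /\ y = 0.
  by move=> e; apply: comb_eq0; apply: inj; rewrite derive_comb // r0E r1E.
have [|a1 _] := h (dotv r1 r1) (- dotv r0 r1).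
  apply: dotv_eq0; rewrite !(dotvDl, dotvDr, dotvZl, dotvZr) (dotvC r1 r0).
  have -> : forall a b c : R, c * (c * a) + c * (- b * b) + (- b * (c * b) + - b * (- b * c)) =
     c * (a * c - b ^+ 2) by move=> *; ring.
  by rewrite D0 mulr0.
have r10 : r1 = 0 by exact: dotv_eq0.
have [|_ /eqP] := h 0 1; first by rewrite r10 scaler0 scale0r addr0.
by rewrite oner_eq0.
Qed.

Lemma first_det_slice (W : E -> 'rV[R]_3) v t :
  first_det W (espace 0) (espace 1) (v, t) = first_det (fun u => W (u, t)) d0 d1 v.
Proof. by rewrite /first_det /espace !derive_slice. Qed.

Lemma first_det_algebra (Ya Yb W0 W1 : 'rV[R]_3) (j11 j12 j21 j22 : R) :
  Ya = j11 *: W0 + j12 *: W1 -> Yb = j21 *: W0 + j22 *: W1 ->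
  dotv Ya Ya * dotv Yb Yb - dotv Ya Yb ^+ 2 =
  (j11 * j22 - j12 * j21) ^+ 2 * (dotv W0 W0 * dotv W1 W1 - dotv W0 W1 ^+ 2).
Proof. by move=> -> ->; rewrite !(dotvDl, dotvDr, dotvZl, dotvZr) (dotvC W1 W0); ring. Qed.

Lemma char_poly_entries (G H : 'M[R]_2) (k1 k2 a b c p q r : R) :
  G 0 0 = a -> G 0 1 = b -> G 1 0 = b -> G 1 1 = c ->
  H 0 0 = p -> H 0 1 = q -> H 1 0 = q -> H 1 1 = r -> a * c - b ^+ 2 != 0 ->
  char_poly (invmx G *m H) = ('X - k1%:P) * ('X - k2%:P) <->
  k1 + k2 = meanc a b c p q r /\ k1 * k2 = gaussc a b c p q r.
Proof.
move=> <- <- Gs <- <- <- Hs <- D.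
by apply: char_poly_forms => //; rewrite det2 Gs -expr2.
Qed.

Lemma eq_and_iff (x y a b a' b' : R) : a = a' -> b = b' ->
  (x = a /\ y = b) <-> (x = a' /\ y = b').
Proof. by move=> -> ->. Qed.

Section one_chart.
Variables (U : set 'rV[R]_2) (phi : 'rV[R]_2 -> 'rV[R]_3) (u : 'rV[R]_2) (eps : R).
Hypotheses (chU : sphere_chart U phi) (Uu : U u) (e1 : eps * eps = 1)
  (z0 : 0 < 1 + eps * phi u 0 2%:R).
Let psi q := unstereo eps (phi q).

Lemma smooth_at_chart : smooth_at phi u.
Proof.
have [oU sphi _ _ _] := chU.
have [U' [g [oU' U'u Cg gE]]] := sphi u Uu.
apply: (@smooth_at_ext _ _ _ g); last by exists U'.
have n1 : \forall q \near u, U q by exact: open_nbhs_nbhs.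
have n2 : \forall q \near u, U' q by exact: open_nbhs_nbhs.
by move: n1 n2; apply: filterS2 => q Uq U'q; rewrite gE.
Qed.

Lemma smooth_at_chart_lift : smooth_at psi u.
Proof. exact: smooth_at_comp_rV smooth_at_chart (smooth_at_unstereo z0). Qed.

Lemma chart_liftK : \forall q \near u, stereo eps (psi q) = phi q.
Proof.
have [oU _ Uphi _ _] := chU.
have n1 : \forall q \near u, U q by exact: open_nbhs_nbhs.
have s1 : smooth_at (fun q => 1 + eps * phi q 0 2%:R) u.
  apply: smooth_atD; first exact: smooth_at_cst.
  by apply: smooth_atcM; apply: smooth_at_coord; exact: smooth_at_chart.
move: n1 (smooth_at_near_gt s1 z0); apply: filterS2 => q Uq q0.
by apply: unstereoK => //; apply: Uphi; exists q.
Qed.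

Lemma chart_lift_jacobian :
  ('D_d0 psi u) 0 0 * ('D_d1 psi u) 0 1 - ('D_d0 psi u) 0 1 * ('D_d1 psi u) 0 0 != 0.
Proof.
have dpsi := smooth_at_differentiable smooth_at_chart_lift.
apply: immersive_jacobian => // w Dw.
have [_ _ _ _ imm] := chU; apply: (imm u Uu).
have ds : differentiable (stereo eps) (psi u).
  exact: smooth_at_differentiable (smooth_at_stereo eps (psi u)).
have e : 'D_w phi u = 'D_w (fun q => stereo eps (psi q)) u.
  by apply: near_eq_derive; apply: filterS chart_liftK => q.
apply: (etrans e); rewrite deriveE; last exact: (@differentiable_comp _ _ _ _ psi (stereo eps)).
by rewrite (@diff_comp _ _ _ _ psi (stereo eps)) //= -(deriveE w dpsi) Dw linear0.
Qed.

Variables (f nu : 'rV[R]_3 -> 'rV[R]_3) (W : E -> 'rV[R]_3) (t : R).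
Let P := (psi u, t).
Hypotheses (sW : smooth_at W P) (fW : \forall v \near psi u, f (stereo eps v) = W (v, t)).
Hypotheses (D0 : first_det W (espace 0) (espace 1) P != 0)
  (m0 : dotv ('D_(espace 0) W P) (nu (phi u)) = 0)
  (m1 : dotv ('D_(espace 1) W P) (nu (phi u)) = 0).

(** Near [u] the chart factors as [stereo eps] after [psi], so its forms are those of [W] after a
    change of coordinates. The right side depends only on the point of the surface, hence all charts
    around it give the same curvatures. *)
Lemma chart_curvatures (k1 k2 : R) :
  char_poly (invmx (first_form f phi u) *m second_form f nu phi u) =
    ('X - k1%:P) * ('X - k2%:P) <->
  k1 + k2 = mean_at W (nu (phi u)) (espace 0) (espace 1) P /\
  k1 * k2 = gauss_at W (nu (phi u)) (espace 0) (espace 1) P.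
Proof.
have spsi := smooth_at_chart_lift.
pose Y q := W (psi q, t).
have st : smooth_at (fun=> t) u := smooth_at_cst t u.
have sY : smooth_at Y u := smooth_at_comp_pair spsi st sW.
have fY : \forall q \near u, (f \o phi) q = Y q.
  have cpsi : psi q @[q --> u] --> psi u := smooth_at_continuous spsi.
  have n1 : \forall q \near u, f (stereo eps (psi q)) = W (psi q, t) by exact: cpsi fW.
  move: n1 chart_liftK; apply: filterS2 => q h lk.
  exact: etrans (congr1 f (esym lk)) h.
have fYn i : \forall q \near u, partial i (f \o phi) q = 'D_(delta_mx 0 i) Y q.
  by move: (near_join fY); apply: filterS => q; exact: near_eq_derive.
have f1 i : partial i (f \o phi) u = 'D_(delta_mx 0 i) Y u := nbhs_singleton (fYn i).
have f2 i j : partial i (partial j (f \o phi)) u = 'D_(delta_mx 0 i) ('D_(delta_mx 0 j) Y) u.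
  exact: near_eq_derive.
have G i j : first_form f phi u i j =
    dotv ('D_(delta_mx 0 i) Y u) ('D_(delta_mx 0 j) Y u).
  rewrite mxE; exact: (congr2 (@dotv R 3) (f1 i) (f1 j)).
have H i j : second_form f nu phi u i j =
    - dotv ('D_(delta_mx 0 i) ('D_(delta_mx 0 j) Y) u) (nu (phi u)).
  by rewrite mxE; exact: (congr1 (fun x => - dotv x _) (f2 i j)).
have tv v : \forall q \near u, 'D_v (fun=> t) q = 0.
  by near=> q; exact: derive_cst.
have tv0 v : 'D_v (fun=> t) u = 0 by exact: derive_cst.
have [eH eK] := mean_gauss_reparam sW spsi st (tv d0) (tv d1) m0 m1 chart_lift_jacobian D0.
have ea := derive_reparam sW spsi st (tv0 d0).
have eb := derive_reparam sW spsi st (tv0 d1).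
have D1 : dotv ('D_d0 Y u) ('D_d0 Y u) * dotv ('D_d1 Y u) ('D_d1 Y u)
      - dotv ('D_d0 Y u) ('D_d1 Y u) ^+ 2 != 0.
  have h := first_det_algebra ea eb.
  apply: (eq_ind_r (fun x => x != 0) _ h); apply: mulf_neq0; last exact: D0.
  by apply: expf_neq0; exact: chart_lift_jacobian.
have eH' : mean_at Y (nu (phi u)) d0 d1 u = mean_at W (nu (phi u)) (espace 0) (espace 1) P := eH.
have eK' : gauss_at Y (nu (phi u)) d0 d1 u = gauss_at W (nu (phi u)) (espace 0) (espace 1) P := eK.
have h := char_poly_entries k1 k2 (G 0 0) (G 0 1) (etrans (G 1 0) (dotvC _ _)) (G 1 1)
  (H 0 0) (H 0 1) (etrans (H 1 0) (congr1 (fun x => - dotv x _) (derive_comm_rV d1 d0 sY)))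
  (H 1 1) D1.
apply: (iff_trans h).
exact: (eq_and_iff _ _ eH' eK').

Unshelve. all: by end_near. Qed.

End one_chart.
End charts.

(** * Smoothness of the curvature functions and a smooth unit normal *)

Lemma meanc_scale {R : realType} (a b c p q r p' q' r' k : R) :
  p' = k * p -> q' = k * q -> r' = k * r ->
  meanc a b c (- p') (- q') (- r') = k * meanc a b c (- p) (- q) (- r).
Proof. by move=> -> -> ->; rewrite /meanc; move: (_ ^-1) => d; ring. Qed.

Section smooth_curvature_functions.
Context {R : realType} {V : normedModType R}.
Variables (Y n : V -> 'rV[R]_3) (e1 e2 p : V).
Hypotheses (sY : smooth_at Y p) (sn : smooth_at n p) (D0 : 0 < first_det Y e1 e2 p).

Let sY1 : smooth_at ('D_e1 Y) p := smooth_at_derive e1 sY.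
Let sY2 : smooth_at ('D_e2 Y) p := smooth_at_derive e2 sY.
Let sa : smooth_at (fun q => dotv ('D_e1 Y q) ('D_e1 Y q)) p := smooth_at_dotv sY1 sY1.
Let sb : smooth_at (fun q => dotv ('D_e1 Y q) ('D_e2 Y q)) p := smooth_at_dotv sY1 sY2.
Let sc : smooth_at (fun q => dotv ('D_e2 Y q) ('D_e2 Y q)) p := smooth_at_dotv sY2 sY2.
Let sP : smooth_at (fun q => - dotv ('D_e1 ('D_e1 Y) q) (n q)) p :=
  smooth_atN (smooth_at_dotv (smooth_at_derive e1 sY1) sn).
Let sQ : smooth_at (fun q => - dotv ('D_e1 ('D_e2 Y) q) (n q)) p :=
  smooth_atN (smooth_at_dotv (smooth_at_derive e1 sY2) sn).
Let sS : smooth_at (fun q => - dotv ('D_e2 ('D_e2 Y) q) (n q)) p :=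
  smooth_atN (smooth_at_dotv (smooth_at_derive e2 sY2) sn).

Lemma smooth_at_first_det : smooth_at (first_det Y e1 e2) p.
Proof.
apply: smooth_at_eq (smooth_atB (smooth_atM sa sc) (smooth_atM sb sb)) => q.
by rewrite /first_det expr2.
Qed.

Lemma smooth_at_mean : smooth_at (fun q => mean_at Y (n q) e1 e2 q) p.
Proof.
have sN := smooth_atD (smooth_atB (smooth_atM sc sP) (smooth_atM (smooth_atcM 2 sb) sQ))
  (smooth_atM sa sS).
exact: (smooth_atM sN (smooth_atV D0 smooth_at_first_det)).
Qed.

Lemma smooth_at_gauss : smooth_at (fun q => gauss_at Y (n q) e1 e2 q) p.
Proof.
have sN := smooth_atB (smooth_atM sP sS) (smooth_atM sQ sQ).
have := smooth_atM sN (smooth_atV D0 smooth_at_first_det).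
by apply: smooth_at_eq => q; rewrite /gauss_at /gaussc expr2.
Qed.

Lemma mean_atZ (c : R) m : mean_at Y (c *: m) e1 e2 p = c * mean_at Y m e1 e2 p.
Proof. exact: (meanc_scale _ _ _ (dotvZr _ _ _) (dotvZr _ _ _) (dotvZr _ _ _)). Qed.

End smooth_curvature_functions.

Lemma smooth_at_cross {R : realType} {V : normedModType R} (f g : V -> 'rV[R]_3) p :
  smooth_at f p -> smooth_at g p -> smooth_at (fun q => cross (f q) (g q)) p.
Proof.
move=> sf sg; have sfi i := smooth_at_coord i sf; have sgi i := smooth_at_coord i sg.
have h i j : smooth_at (fun q => f q 0 i * g q 0 j - f q 0 j * g q 0 i) p.
  exact: smooth_atB (smooth_atM (sfi i) (sgi j)) (smooth_atM (sfi j) (sgi i)).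
apply: smooth_at_rV.
apply: (@ord3_ind (fun i => smooth_at (fun q => cross (f q) (g q) 0 i) p)).
- by apply: smooth_at_eq (h 1 2%:R) => q; rewrite mxE.
- by apply: smooth_at_eq (h 2%:R 0) => q; rewrite mxE.
- by apply: smooth_at_eq (h 0 1) => q; rewrite mxE.
Qed.

Lemma smooth_atZ {R : realType} {V : normedModType R} n (c : V -> R) (f : V -> 'rV[R]_n) p :
  smooth_at c p -> smooth_at f p -> smooth_at (fun q => c q *: f q) p.
Proof.
move=> sc sf; apply: smooth_at_rV => i.
by apply: smooth_at_eq (smooth_atM sc (smooth_at_coord i sf)) => q; rewrite mxE.
Qed.

Lemma smooth_at_fst {R : realType} {V : normedModType R} (p : V * R) :
  smooth_at (fun q : V * R => q.1) p.
Proof. by apply: smooth_at_lin => // q; exact: cvg_fst. Qed.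

Lemma smooth_at_snd {R : realType} {V : normedModType R} (p : V * R) :
  smooth_at (fun q : V * R => q.2) p.
Proof. by apply: smooth_at_lin => // q; exact: cvg_snd. Qed.

Section unit_normal.
Context {R : realType}.
Implicit Types u v m : 'rV[R]_3.

(** The radicand is the squared length of [cross u v], by Lagrange's identity. *)
Definition unormal u v : 'rV[R]_3 :=
  (Num.sqrt (dotv u u * dotv v v - dotv u v ^+ 2))^-1 *: cross u v.

Lemma unormal_facts u v : 0 < dotv u u * dotv v v - dotv u v ^+ 2 ->
  [/\ dotv (unormal u v) (unormal u v) = 1, dotv (unormal u v) u = 0 & dotv (unormal u v) v = 0].
Proof.
move=> D0; rewrite /unormal !dotvZl !dotvZr cross_orthol cross_orthor !mulr0; split => //.
rewrite dotv_cross; set D := _ - _ in D0 *.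
by rewrite mulrA -invfM -expr2 sqr_sqrtr ?(ltW D0) // mulVf // gt_eqF.
Qed.

Lemma unormal_factsZ u v (c : R) : c ^+ 2 = 1 -> 0 < dotv u u * dotv v v - dotv u v ^+ 2 ->
  [/\ dotv (c *: unormal u v) (c *: unormal u v) = 1, dotv (c *: unormal u v) u = 0 &
      dotv (c *: unormal u v) v = 0].
Proof.
move=> c2 /unormal_facts; move: (unormal u v) => N [h1 h2 h3].
by rewrite !dotvZl !dotvZr h1 h2 h3 !mulr0 mulr1 -expr2.
Qed.

Lemma unormal_unique u v m : 0 < dotv u u * dotv v v - dotv u v ^+ 2 ->
  dotv m m = 1 -> dotv u m = 0 -> dotv v m = 0 ->
  exists2 c : R, c ^+ 2 = 1 & m = c *: unormal u v.
Proof.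
move=> D0 mm um vm.
have [N1 _ _] := unormal_facts D0.
have mu : dotv m u = 0 by rewrite dotvC.
have mv : dotv m v = 0 by rewrite dotvC.
have := cross_normal mu mv; rewrite dotv_cross; set D := _ - _ in D0 * => h.
have sD : Num.sqrt D != 0 by rewrite gt_eqF // sqrtr_gt0.
have sDD : D = Num.sqrt D * Num.sqrt D by rewrite -expr2 sqr_sqrtr // ltW.
pose c := dotv (cross u v) m / Num.sqrt D.
have mE : m = c *: unormal u v.
  apply: (@scalerI _ _ D); first by rewrite gt_eqF.
  rewrite h /unormal -/D !scalerA; congr (_ *: _).
  by rewrite /c {1}sDD; field.
exists c => //; move: mm; rewrite {1 2}mE dotvZl dotvZr N1 mulr1 => <-; exact: expr2.
Qed.

End unit_normal.

Lemma quadratic_roots {R : realType} (M G : R) : 0 <= M ^+ 2 - 4 * G ->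
  exists k1 k2 : R, k1 + k2 = M /\ k1 * k2 = G.
Proof.
move=> d0; exists ((M + Num.sqrt (M ^+ 2 - 4 * G)) / 2), ((M - Num.sqrt (M ^+ 2 - 4 * G)) / 2).
have e := sqr_sqrtr d0; split; first by field.
have -> : forall s : R, (M + s) / 2 * ((M - s) / 2) = (M ^+ 2 - s ^+ 2) / 4.
  by move=> s; field.
by rewrite e; field.
Qed.

Lemma first_det_norm_gt0 {R : realType} (u v : 'rV[R]_3) :
  0 < dotv u u * dotv v v - dotv u v ^+ 2 -> 0 < dotv u u.
Proof.
move=> D0; rewrite lt_neqAle dotv_ge0 andbT eq_sym; apply/negP => /eqP/dotv_eq0 u0.
by move: D0; rewrite u0 !dotv0l mul0r expr0n subr0 ltxx.
Qed.

(** Fixes the sign of the local normal: of the two unit normals at a point only one makes the mean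
    curvature [M] positive. *)
Lemma sign_unique {R : realType} (c c0 M : R) :
  c ^+ 2 = 1 -> c0 ^+ 2 = 1 -> 0 < c * M -> 0 < c0 * M -> c = c0.
Proof.
move=> c2 c02 h h0; have : c ^+ 2 == c0 ^+ 2 by rewrite c2 c02.
rewrite eqf_sqr => /orP[/eqP//|/eqP cN].
by move: h; rewrite cN mulNr oppr_gt0 ltNge ltW.
Qed.

(** * The evolving surface in a stereographic chart *)

Section evolving_surface.
Context {R : realType}.
Local Notation E := ('rV[R]_2 * R)%type.
Local Notation e0 := (espace (0 : 'I_2)).
Local Notation e1 := (espace (1 : 'I_2)).
Local Notation sphere2 := (@sphere2 R).
Variables (T : \bar R) (x nu : 'rV[R]_3 -> R -> 'rV[R]_3).
Hypotheses (xsmooth : smooth_on (spacetime T) (fun p => x p.1 p.2))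
  (xembedding : forall t : R, 0 <= t -> (t%:E < T)%E -> sphere_embedding (x^~ t))
  (nunormal : forall t : R, 0 <= t -> (t%:E < T)%E ->
     outward_unit_normal (x^~ t) (nu^~ t))
  (xconvex : forall t : R, 0 <= t -> (t%:E < T)%E -> strictly_convex (x^~ t) (nu^~ t)).

Local Notation PC z t := (principal_curvatures (x^~ t) (nu^~ t) z).

Definition valid_time (P : E) := 0 <= P.2 /\ (P.2%:E < T)%E.

Lemma valid_spacetime eps P : eps * eps = 1 -> valid_time P -> spacetime T (stereo eps P.1, P.2).
Proof. by move=> h [h1 h2]; split => //=; exact: stereo_sphere. Qed.

Lemma smooth_at_stereo_time eps (P : E) : smooth_at (fun Q : E => stereo eps Q.1) P.
Proof. exact: (smooth_at_comp_rV (smooth_at_fst P) (smooth_at_stereo eps P.1)). Qed.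

(** Composes the extension provided by [smooth_on] with the stereographic chart. [W] is smooth in a
    full neighbourhood, including negative times when [P0.2 = 0], but represents [x] only at valid
    times. *)
Lemma local_extension eps (P0 : E) : eps * eps = 1 -> valid_time P0 ->
  exists2 W : E -> 'rV[R]_3, smooth_at W P0 &
    \forall P \near P0, valid_time P -> x (stereo eps P.1) P.2 = W P.
Proof.
move=> ee v0.
have [Q [g [oQ Q0 Cg gE]]] := xsmooth (valid_spacetime ee v0).
pose sig (P : E) := (stereo eps P.1, P.2).
have s1 := smooth_at_stereo_time eps P0; have s2 := smooth_at_snd P0.
have sg : smooth_at g (sig P0) by exists Q.
exists (fun P => g (sig P)); first exact: smooth_at_comp_pair s1 s2 sg.
have dsig : differentiable sig P0.
  exact: differentiable_pair (smooth_at_differentiable s1) (smooth_at_differentiable s2).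
have c : sig P @[P --> P0] --> sig P0 := differentiable_continuous dsig.
have nQ : \forall q \near sig P0, Q q by exact: open_nbhs_nbhs.
have n : \forall P \near P0, Q (sig P) by exact: c nQ.
by move: n; apply: filterS => P QP vP; exact: (gE (sig P) QP (valid_spacetime ee vP)).
Qed.

Section at_valid_point.
Variables (eps : R) (ee : eps * eps = 1) (W : E -> 'rV[R]_3) (P : E).
Hypotheses (vP : valid_time P) (sW : smooth_at W P)
  (WE : \forall P' \near P, valid_time P' -> x (stereo eps P'.1) P'.2 = W P').
Local Notation z := (stereo eps P.1).
Local Notation m := (nu z P.2).

Lemma slice_eq : \forall v \near P.1, x (stereo eps v) P.2 = W (v, P.2).
Proof.
have s1 := @smooth_at_lin R _ _ (@idfun 'rV[R]_2) P.1 (fun _ _ _ => erefl) (fun _ => cvg_id).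
have d : differentiable (fun v => (v, P.2)) P.1.
  exact: differentiable_pair (smooth_at_differentiable s1)
    (smooth_at_differentiable (smooth_at_cst P.2 P.1)).
have c : (v, P.2) @[v --> P.1] --> (P.1, P.2) := differentiable_continuous d.
have WE' : \forall P' \near (P.1, P.2), valid_time P' -> x (stereo eps P'.1) P'.2 = W P'.
  by case: (P) WE.
have n : \forall v \near P.1, valid_time (v, P.2) -> x (stereo eps v) P.2 = W (v, P.2).
  exact: c WE'.
by move: n; apply: filterS => v; apply.
Qed.

Let sWslice : smooth_at (fun v => W (v, P.2)) P.1.
Proof.
have s1 := @smooth_at_lin R _ _ (@idfun 'rV[R]_2) P.1 (fun _ _ _ => erefl) (fun _ => cvg_id).
apply: (smooth_at_comp_pair s1 (smooth_at_cst P.2 P.1)).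
by case: (P) sW.
Qed.

Let derive_surface w : 'D_w (x^~ P.2 \o stereo eps) P.1 = 'D_w (fun v => W (v, P.2)) P.1.
Proof. exact: near_eq_derive slice_eq. Qed.

Lemma surface_first_det : 0 < first_det W e0 e1 P.
Proof.
rewrite (surjective_pairing P) first_det_slice.
apply: immersive_first_det; first exact: smooth_at_differentiable sWslice.
move=> w /(etrans (derive_surface w)).
have [_ _ imm _] := xembedding vP.1 vP.2.
exact: (imm _ _ (stereo_chart ee) P.1 I).
Qed.

Lemma surface_normal : [/\ dotv m m = 1, dotv ('D_e0 W P) m = 0 & dotv ('D_e1 W P) m = 0].
Proof.
have zS : sphere2 z by exact: stereo_sphere.
have [mm orth _] := nunormal vP.1 vP.2 zS.
have h w : dotv ('D_w (fun v => W (v, P.2)) P.1) m = 0.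
  rewrite -derive_surface.
  exact: (orth setT (stereo eps) P.1 w (stereo_chart ee) I erefl).
have hi i : dotv ('D_(espace i) W P) m = 0.
  by rewrite {1}(surjective_pairing P) /espace derive_slice; exact: h.
by split.
Qed.

(** From left to right the chart is arbitrary and [chart_curvatures] compares it with [W];
    conversely the stereographic chart is a witness. *)
Lemma surface_curvatures k1 k2 : PC z P.2 k1 k2 <->
  k1 + k2 = mean_at W m e0 e1 P /\ k1 * k2 = gauss_at W m e0 e1 P.
Proof.
have [mm m0 m1] := surface_normal.
have D0 : first_det W e0 e1 P != 0 by rewrite gt_eqF // surface_first_det.
have key U phi u : sphere_chart U phi -> U u -> phi u = z ->
  char_poly (invmx (first_form (x^~ P.2) phi u) *m second_form (x^~ P.2) (nu^~ P.2) phi u) =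
    ('X - k1%:P) * ('X - k2%:P) <->
  k1 + k2 = mean_at W m e0 e1 P /\ k1 * k2 = gauss_at W m e0 e1 P.
  move=> chU Uu phiu.
  have z0 : 0 < 1 + eps * phi u 0 2%:R.
    by rewrite phiu stereo_denominator // mulr_gt0 // invr_gt0 sqn1_gt0.
  have psiu : unstereo eps (phi u) = P.1 by rewrite phiu stereoK.
  have PE : (unstereo eps (phi u), P.2) = P by rewrite psiu -surjective_pairing.
  have := @chart_curvatures R U phi u eps chU Uu ee z0 (x^~ P.2) (nu^~ P.2) W P.2.
  by rewrite PE psiu phiu => h; exact: (h sW slice_eq D0 m0 m1).
split.
  by case=> U [phi [u [chU Uu phiu]]] /(key U phi u chU Uu phiu).
move=> h; exists setT, (stereo eps), P.1; split => //; first exact: stereo_chart.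
exact/(key _ _ _ (stereo_chart ee) I erefl).
Qed.

Lemma surface_curvatures_exist : exists k1 k2, PC z P.2 k1 k2.
Proof.
have D0 := surface_first_det.
have a0 : 0 < dotv ('D_e0 W P) ('D_e0 W P) := first_det_norm_gt0 D0.
have := meanc_gaussc_discr (- dotv ('D_e0 ('D_e0 W) P) m) (- dotv ('D_e0 ('D_e1 W) P) m)
  (- dotv ('D_e1 ('D_e1 W) P) m) a0 D0.
move=> /quadratic_roots[k1 [k2 [h1 h2]]].
by exists k1, k2; apply/surface_curvatures; split.
Qed.

Lemma surface_mean_gauss_gt0 :
  [/\ 0 < mean_at W m e0 e1 P, 0 < gauss_at W m e0 e1 P &
      4 * gauss_at W m e0 e1 P <= mean_at W m e0 e1 P ^+ 2].
Proof.
have [k1 [k2 h]] := surface_curvatures_exist.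
have [k10 k20] := xconvex vP.1 vP.2 (stereo_sphere P.1 ee) h.
have [<- <-] := (surface_curvatures k1 k2).1 h.
split; [exact: addr_gt0|exact: mulr_gt0|].
by rewrite -subr_ge0 (_ : _ - _ = (k1 - k2) ^+ 2) ?sqr_ge0 //; ring.
Qed.

End at_valid_point.

(** These facts concern the extension alone and hold in a full neighbourhood, whereas
    [surface_facts] ties it to [x] and [nu] and holds at valid times only. *)
Definition frame_facts (W n : E -> 'rV[R]_3) (P : E) :=
  [/\ smooth_at W P, smooth_at n P & 0 < first_det W e0 e1 P] /\
  [/\ dotv (n P) (n P) = 1, dotv (n P) ('D_e0 W P) = 0, dotv (n P) ('D_e1 W P) = 0 &
      0 < mean_at W (n P) e0 e1 P].

Definition surface_facts eps (W n : E -> 'rV[R]_3) (P : E) :=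
  [/\ x (stereo eps P.1) P.2 = W P, nu (stereo eps P.1) P.2 = n P,
     (forall k1 k2, PC (stereo eps P.1) P.2 k1 k2 <->
       k1 + k2 = mean_at W (n P) e0 e1 P /\ k1 * k2 = gauss_at W (n P) e0 e1 P),
     0 < gauss_at W (n P) e0 e1 P &
     4 * gauss_at W (n P) e0 e1 P <= mean_at W (n P) e0 e1 P ^+ 2].

(** The smooth normal is [c0] times the normalized cross product, with the sign [c0] read off [nu]
    at [P0]. At a nearby valid point [nu] is the same vector up to a sign [c]. Strict convexity
    makes the mean curvature positive for [c], continuity makes it positive for [c0], so the signs
    agree and [nu] coincides with [n] there. *)
Lemma local_surface eps (P0 : E) : eps * eps = 1 -> valid_time P0 ->
  exists W n : E -> 'rV[R]_3,
    (\forall P \near P0, frame_facts W n P) /\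
    (\forall P \near P0, valid_time P -> surface_facts eps W n P).
Proof.
move=> ee v0.
have [W sW WE] := local_extension ee v0.
have sWn := smooth_at_near sW; have WEn := near_join WE.
have D0 := surface_first_det ee v0 sW WE.
pose n0 P := unormal ('D_e0 W P) ('D_e1 W P).
have sn0 : smooth_at n0 P0.
  have sD := smooth_at_first_det e0 e1 sW.
  have sr : smooth_at (fun P => Num.sqrt (first_det W e0 e1 P)) P0 by exact: smooth_at_sqrt.
  have sv : smooth_at (fun P => (Num.sqrt (first_det W e0 e1 P))^-1) P0.
    by apply: smooth_atV => //; rewrite sqrtr_gt0.
  exact: smooth_atZ sv (smooth_at_cross (smooth_at_derive e0 sW) (smooth_at_derive e1 sW)).
have [mm0 m00 m10] := surface_normal ee v0 WE.
have [c0 c02 mE0] := unormal_unique D0 mm0 m00 m10.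
pose n P := c0 *: n0 P.
have sn : smooth_at n P0.
  exact: smooth_atZ (smooth_at_cst c0 P0) sn0.
have sMn := smooth_at_mean sW sn D0.
have M0 : 0 < mean_at W (n P0) e0 e1 P0.
  have [h _ _] := surface_mean_gauss_gt0 ee v0 sW WE.
  by rewrite /n /n0 -mE0.
have near_frame : \forall P \near P0, frame_facts W n P.
  have nD := smooth_at_near_gt (smooth_at_first_det e0 e1 sW) D0.
  have nM := smooth_at_near_gt sMn M0.
  have nA : \forall P \near P0, smooth_at W P /\ smooth_at n P.
    exact: filterI sWn (smooth_at_near sn).
  have nB : \forall P \near P0, 0 < first_det W e0 e1 P /\ 0 < mean_at W (n P) e0 e1 P.
    exact: filterI nD nM.
  move: nA nB; apply: filterS2 => P [sWP snP] [DP MP]; split; first by [].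
  have [h1 h2 h3] := unormal_factsZ c02 DP.
  exact: And4 h1 h2 h3 MP.
exists W, n; split => //.
have nA : \forall P \near P0, frame_facts W n P /\
    (valid_time P -> x (stereo eps P.1) P.2 = W P) by exact: filterI near_frame WE.
have nB : \forall P \near P0, smooth_at W P /\
    \forall P' \near P, valid_time P' -> x (stereo eps P'.1) P'.2 = W P'.
  exact: filterI sWn WEn.
move: nA nB; apply: filterS2 => P [[[_ _ DP] [_ _ _ MP]] WP] [sWP WEP] vP.
have [mm m0 m1] := surface_normal ee vP WEP.
have [c c2 mE] := unormal_unique DP mm m0 m1.
have [M1 G1 MG] := surface_mean_gauss_gt0 ee vP sWP WEP.
pose N := unormal ('D_e0 W P) ('D_e1 W P).
have MP' : 0 < c0 * mean_at W N e0 e1 P.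
  exact: (eq_ind _ (fun y => 0 < y) MP _ (mean_atZ W e0 e1 P c0 N)).
have M1' : 0 < c * mean_at W N e0 e1 P.
  exact: (eq_ind _ (fun y => 0 < y) M1 _
    (etrans (congr1 (fun y => mean_at W y e0 e1 P) mE) (mean_atZ W e0 e1 P c N))).
have cc := sign_unique c2 c02 M1' MP'.
have mn : nu (stereo eps P.1) P.2 = n P := etrans mE (congr1 (fun c => c *: N) cc).
split; [exact: WP|exact: mn| | |].
- exact: (eq_ind _ (fun y => forall k1 k2, PC (stereo eps P.1) P.2 k1 k2 <->
    k1 + k2 = mean_at W y e0 e1 P /\ k1 * k2 = gauss_at W y e0 e1 P)
    (surface_curvatures ee vP sWP WEP) _ mn).
- exact: (eq_ind _ (fun y => 0 < gauss_at W y e0 e1 P) G1 _ mn).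
- exact: (eq_ind _ (fun y => 4 * gauss_at W y e0 e1 P <= mean_at W y e0 e1 P ^+ 2) MG _ mn).
Qed.

End evolving_surface.

(** * The pinching at a spatial maximum *)

Section diagonalization.
Context {R : realType}.
Implicit Types (a b c d : R).

(** The row [(m11, m12)] turned by a right angle is a kernel vector, unless the row vanishes, when
    the first coordinate vector is one. *)
Lemma kernel2 (m11 m12 m22 : R) : m11 * m22 = m12 ^+ 2 ->
  exists x y : R, [/\ (x != 0) || (y != 0), x * m11 + y * m12 = 0 & x * m12 + y * m22 = 0].
Proof.
move=> d0; have [m0|m0] := boolP ((m11 == 0) && (m12 == 0)).
  move/andP: m0 => [/eqP -> /eqP m12_0]; exists 1, 0; rewrite m12_0 oner_eq0; split => //; ring.
exists m12, (- m11); split; [|ring|by rewrite mulNr d0 expr2 subrr].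
by move: m0; rewrite negb_and oppr_eq0 orbC.
Qed.

Definition bilin2 (A B C x0 x1 y0 y1 : R) : R :=
  x0 * (y0 * A + y1 * B) + x1 * (y0 * B + y1 * C).

Lemma bilin2_gt0 (A B C x y : R) : 0 < A -> 0 < A * C - B ^+ 2 -> (x != 0) || (y != 0) ->
  0 < bilin2 A B C x y x y.
Proof.
move=> A0 D0 xy.
have -> : bilin2 A B C x y x y = ((A * x + B * y) ^+ 2 + (A * C - B ^+ 2) * y ^+ 2) / A.
  by rewrite /bilin2; field; rewrite gt_eqF.
apply: divr_gt0 => //; have [y0|y0] := eqVneq y 0.
  rewrite y0 mulr0 addr0 expr0n mulr0 addr0 exprn_even_gt0 //=.
  by apply: mulf_neq0; [rewrite gt_eqF|move: xy; rewrite y0 eqxx orbF].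
by apply: ltr_wpDl; [exact: sqr_ge0|rewrite mulr_gt0 // exprn_even_gt0].
Qed.

(** The hypothesis says that the second form minus [k] times the first is singular; a kernel vector
    is normalized by its length in the first form. *)
Lemma unit_eigenvector (A B C P Q S k : R) : 0 < A -> 0 < A * C - B ^+ 2 ->
  (P - k * A) * (S - k * C) = (Q - k * B) ^+ 2 ->
  exists x y : R, bilin2 A B C x y x y = 1 /\
    forall u v, bilin2 P Q S u v x y = k * bilin2 A B C u v x y.
Proof.
move=> A0 D0 /kernel2[x [y [xy h1 h2]]].
have G0 := bilin2_gt0 A0 D0 xy; set G := bilin2 _ _ _ _ _ _ _ in G0.
have r0 : Num.sqrt G != 0 by rewrite gt_eqF // sqrtr_gt0.
have rr : Num.sqrt G ^+ 2 = G by rewrite sqr_sqrtr // ltW.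
exists (x / Num.sqrt G), (y / Num.sqrt G); split.
  have -> : bilin2 A B C (x / Num.sqrt G) (y / Num.sqrt G) (x / Num.sqrt G) (y / Num.sqrt G) =
     G / Num.sqrt G ^+ 2 by rewrite /G /bilin2; field.
  by rewrite rr divff // gt_eqF.
move=> u v; apply/eqP; rewrite -subr_eq0; apply/eqP.
have -> : bilin2 P Q S u v (x / Num.sqrt G) (y / Num.sqrt G)
    - k * bilin2 A B C u v (x / Num.sqrt G) (y / Num.sqrt G) =
  (u * (x * (P - k * A) + y * (Q - k * B)) + v * (x * (Q - k * B) + y * (S - k * C))) / Num.sqrt G.
  by rewrite /bilin2; field.
by rewrite h1 h2 !mulr0 addr0 mul0r.
Qed.

(** Simultaneous diagonalization: each root has a unit eigenvector, and the symmetry of the second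
    form makes eigenvectors of distinct roots orthogonal for the first. *)
Lemma diagonal_basis (A B C P Q S k1 k2 : R) : 0 < A -> 0 < A * C - B ^+ 2 -> k2 < k1 ->
  k1 + k2 = meanc A B C P Q S -> k1 * k2 = gaussc A B C P Q S ->
  exists a0 a1 b0 b1 : R,
    [/\ bilin2 A B C a0 a1 a0 a1 = 1, bilin2 A B C a0 a1 b0 b1 = 0 & bilin2 A B C b0 b1 b0 b1 = 1] /\
    [/\ bilin2 P Q S a0 a1 a0 a1 = k1, bilin2 P Q S a0 a1 b0 b1 = 0 & bilin2 P Q S b0 b1 b0 b1 = k2].
Proof.
move=> A0 D0 k21 hM hG; rewrite /meanc in hM; rewrite /gaussc in hG.
have D0' : A * C - B ^+ 2 != 0 by rewrite gt_eqF.
have hM' : (k1 + k2) * (A * C - B ^+ 2) = C * P - 2 * B * Q + A * S by rewrite hM divfK.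
have hG' : k1 * k2 * (A * C - B ^+ 2) = P * S - Q ^+ 2 by rewrite hG divfK.
have root k : (k - k1) * (k - k2) = 0 -> (P - k * A) * (S - k * C) = (Q - k * B) ^+ 2.
  move=> hk; apply/eqP; rewrite -subr_eq0; apply/eqP.
  have -> : (P - k * A) * (S - k * C) - (Q - k * B) ^+ 2 =
    P * S - Q ^+ 2 - k * (C * P - 2 * B * Q + A * S) + k ^+ 2 * (A * C - B ^+ 2) by ring.
  rewrite -hM' -hG'.
  have -> : k1 * k2 * (A * C - B ^+ 2) - k * ((k1 + k2) * (A * C - B ^+ 2)) +
    k ^+ 2 * (A * C - B ^+ 2) = (k - k1) * (k - k2) * (A * C - B ^+ 2) by ring.
  by rewrite hk mul0r.
have [a0 [a1 [aa ha]]] := unit_eigenvector A0 D0 (root k1 ltac:(by rewrite subrr mul0r)).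
have [b0 [b1 [bb hb]]] := unit_eigenvector A0 D0 (root k2 ltac:(by rewrite subrr mulr0)).
have sym X Y Z u v x y : bilin2 X Y Z u v x y = bilin2 X Y Z x y u v by rewrite /bilin2; ring.
have ab : bilin2 A B C a0 a1 b0 b1 = 0.
  have h : (k1 - k2) * bilin2 A B C a0 a1 b0 b1 = 0.
    by rewrite mulrBl -hb [in X in X - _]sym -ha (sym P) subrr.
  by apply/eqP; move/eqP: h; rewrite mulf_eq0 subr_eq0 gt_eqF.
exists a0, a1, b0, b1; split; split => //.
- by rewrite ha aa mulr1.
- by rewrite hb ab mulr0.
- by rewrite hb bb mulr1.
Qed.

End diagonalization.

(** * Coordinate changes with a prescribed second order jet *)

Section normal_parametrization.
Context {R : realType}.
Local Notation E := ('rV[R]_2 * R)%type.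
Local Notation e0 := (espace (0 : 'I_2)).
Local Notation e1 := (espace (1 : 'I_2)).

Lemma derive_scale {V W : normedModType R} (x : V -> R) (w : W) p v :
  smooth_at x p -> 'D_v (fun q => x q *: w) p = 'D_v x p *: w.
Proof.
move=> /smooth_at_differentiable dx.
by rewrite deriveE ?diffZl -?deriveE //; exact: differentiableZl.
Qed.

Let X (P : E) : R := P.1 0 0.
Let Y (P : E) : R := P.1 0 1.

Let sX P : smooth_at X P. Proof. exact: (smooth_at_coord 0 (smooth_at_fst P)). Qed.
Let sY P : smooth_at Y P. Proof. exact: (smooth_at_coord 1 (smooth_at_fst P)). Qed.

Lemma derive_linear {V W : normedModType R} (f : V -> W) p v :
  linear f -> continuous f -> 'D_v f p = f v.
Proof.
move=> lf cf; pose L := GRing.isLinear.Build _ _ _ _ f lf.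
pose f' : {linear V -> W} := HB.pack f L.
have d : differentiable f' p by apply: linear_differentiable; exact: cf.
by apply: (etrans (deriveE v d)); rewrite (@diff_lin _ _ _ f' p).
Qed.

Let dX v P : 'D_v X P = v.1 0 0.
Proof.
apply: derive_linear; first by move=> k a b; rewrite /X /= !mxE.
by move=> Q; exact: smooth_at_continuous (sX Q).
Qed.

Let dY v P : 'D_v Y P = v.1 0 1.
Proof.
apply: derive_linear; first by move=> k a b; rewrite /Y /= !mxE.
by move=> Q; exact: smooth_at_continuous (sY Q).
Qed.

Lemma espaceE (i j : 'I_2) : (espace i : E).1 0 j = (i == j)%:R.
Proof. by rewrite /espace mxE eqxx eq_sym. Qed.

Lemma derive_snd_espace i (P : E) : 'D_(espace i) (fun Q : E => Q.2) P = 0.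
Proof.
by apply: (etrans (derive_linear _ _ _ _)) => // Q; exact: smooth_at_continuous (smooth_at_snd Q).
Qed.

Let poly1 (c a b : 'rV[R]_2) P := c + X P *: a + Y P *: b.

Let s_poly1 c a b P : smooth_at (poly1 c a b) P.
Proof.
exact: (smooth_atD (smooth_atD (smooth_at_cst c P) (smooth_atZl a (sX P)))
  (smooth_atZl b (sY P))).
Qed.

Let d_poly1 c a b v P : 'D_v (poly1 c a b) P = v.1 0 0 *: a + v.1 0 1 *: b.
Proof.
have s0 := smooth_at_cst c P; have s1 := smooth_atZl a (sX P).
have s2 := smooth_atZl b (sY P).
apply: (etrans (deriveDs v (smooth_atD s0 s1) s2)).
apply: (etrans (congr2 +%R (deriveDs v s0 s1) (derive_scale b v (sY P)))).
rewrite derive_cst add0r dY; congr (_ + _).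
by apply: (etrans (derive_scale a v (sX P))); rewrite dX.
Qed.

Let XX P := 2^-1 * (X P * X P).
Let XY P := X P * Y P.
Let YY P := 2^-1 * (Y P * Y P).
Let sXX P : smooth_at XX P. Proof. exact: (smooth_atcM _ (smooth_atM (sX P) (sX P))). Qed.
Let sXY P : smooth_at XY P. Proof. exact: (smooth_atM (sX P) (sY P)). Qed.
Let sYY P : smooth_at YY P. Proof. exact: (smooth_atcM _ (smooth_atM (sY P) (sY P))). Qed.

Let dXX v P : 'D_v XX P = v.1 0 0 * X P.
Proof.
apply: (etrans (derivecMs _ v (smooth_atM (sX P) (sX P)))).
apply: (etrans (congr1 (fun x => _ * x) (deriveMs v (sX P) (sX P)))); rewrite dX.
by move: (X P) (v.1 0 0) => x y; field.
Qed.

Let dYY v P : 'D_v YY P = v.1 0 1 * Y P.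
Proof.
apply: (etrans (derivecMs _ v (smooth_atM (sY P) (sY P)))).
apply: (etrans (congr1 (fun x => _ * x) (deriveMs v (sY P) (sY P)))); rewrite dY.
by move: (Y P) (v.1 0 1) => x y; field.
Qed.

Let dXY v P : 'D_v XY P = v.1 0 0 * Y P + X P * v.1 0 1.
Proof. by apply: (etrans (deriveMs v (sX P) (sY P))); rewrite dX dY. Qed.

(** A quadratic polynomial in the space variables, constant in time; the factors [2^-1] make [qa]
    and [qb] themselves the pure second derivatives. *)
Lemma quadratic_param (v0 a b qa qm qb : 'rV[R]_2) (t : R) :
  exists psi : 'rV[R]_2 -> 'rV[R]_2, let f := fun P : E => psi P.1 in
  [/\ (forall P, smooth_at f P), psi 0 = v0, 'D_e0 f (0, t) = a & 'D_e1 f (0, t) = b] /\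
  [/\ 'D_e0 ('D_e0 f) (0, t) = qa, 'D_e0 ('D_e1 f) (0, t) = qm &
      'D_e1 ('D_e1 f) (0, t) = qb].
Proof.
pose psi (u : 'rV[R]_2) := v0 + u 0 0 *: a + u 0 1 *: b + (2^-1 * (u 0 0 * u 0 0)) *: qa
  + (u 0 0 * u 0 1) *: qm + (2^-1 * (u 0 1 * u 0 1)) *: qb.
exists psi; pose f P := poly1 v0 a b P + XX P *: qa + XY P *: qm + YY P *: qb.
have -> : (fun P : E => psi P.1) = f by [].
have s0 P := s_poly1 v0 a b P; have s1 P := smooth_atZl qa (sXX P).
have s2 P := smooth_atZl qm (sXY P); have s3 P := smooth_atZl qb (sYY P).
have sf P : smooth_at f P := smooth_atD (smooth_atD (smooth_atD (s0 P) (s1 P)) (s2 P)) (s3 P).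
have df v P : 'D_v f P = v.1 0 0 *: a + v.1 0 1 *: b + (v.1 0 0 * X P) *: qa
    + (v.1 0 0 * Y P + X P * v.1 0 1) *: qm + (v.1 0 1 * Y P) *: qb.
  apply: (etrans (deriveDs v (smooth_atD (smooth_atD (s0 P) (s1 P)) (s2 P)) (s3 P))).
  apply: (etrans (congr2 +%R (etrans (deriveDs v (smooth_atD (s0 P) (s1 P)) (s2 P))
    (congr2 +%R (deriveDs v (s0 P) (s1 P)) (derive_scale qm v (sXY P))))
    (derive_scale qb v (sYY P)))).
  rewrite dXY dYY; congr (_ + _ + _ + _); first exact: d_poly1.
  by apply: (etrans (derive_scale qa v (sXX P))); rewrite dXX.
have e00 : (e0 : E).1 0 0 = 1 by rewrite espaceE.
have e01 : (e0 : E).1 0 1 = 0 by rewrite espaceE.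
have e10 : (e1 : E).1 0 0 = 0 by rewrite espaceE.
have e11 : (e1 : E).1 0 1 = 1 by rewrite espaceE.
have d0 : 'D_e0 f = poly1 a qa qm.
  apply/funext => P; apply: (etrans (df e0 P)); rewrite e00 e01.
  by rewrite !mulr0 !mul0r !mul1r !scale0r !scale1r !addr0.
have d1 : 'D_e1 f = poly1 b qm qb.
  apply/funext => P; apply: (etrans (df e1 P)); rewrite e10 e11.
  by rewrite !mulr1 !mul0r !mul1r !scale0r !scale1r !add0r !addr0.
have X0 : X (0, t) = 0 by rewrite /X mxE.
have Y0 : Y (0, t) = 0 by rewrite /Y mxE.
split; split => //.
- by rewrite /psi !mxE !mulr0 !scale0r !addr0.
- by apply: (etrans (congr1 (fun g => g (0, t)) d0)); rewrite /poly1 X0 Y0 !scale0r !addr0.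
- by apply: (etrans (congr1 (fun g => g (0, t)) d1)); rewrite /poly1 X0 Y0 !scale0r !addr0.
- rewrite d0; apply: (etrans (d_poly1 _ _ _ _ _)).
  by rewrite e00 e01 scale1r scale0r addr0.
- rewrite d1; apply: (etrans (d_poly1 _ _ _ _ _)).
  by rewrite e00 e01 scale1r scale0r addr0.
- rewrite d1; apply: (etrans (d_poly1 _ _ _ _ _)).
  by rewrite e10 e11 scale1r scale0r add0r.
Qed.

End normal_parametrization.

Section critical_point.
Context {R : realType}.
Local Notation E := ('rV[R]_2 * R)%type.
Local Notation e0 := (espace (0 : 'I_2)).
Local Notation e1 := (espace (1 : 'I_2)).

(* q is chosen so as to cancel the tangential part of the acceleration. *)
Lemma normal_acceleration (W0 W1 W00 W01 W11 n A B Z : 'rV[R]_3)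
    (c0 c1 d0 d1 q0 q1 a0 a1 b0 b1 k : R) (X : 'rV[R]_3) :
  A = a0 *: W0 + a1 *: W1 -> B = b0 *: W0 + b1 *: W1 ->
  dotv A A = 1 -> dotv B B = 1 -> dotv n n = 1 ->
  dotv A B = 0 -> dotv A n = 0 -> dotv B n = 0 ->
  X = (c0 * d0) *: W00 + (c0 * d1 + c1 * d0) *: W01 + (c1 * d1) *: W11 ->
  q0 = - dotv X A * a0 - dotv X B * b0 -> q1 = - dotv X A * a1 - dotv X B * b1 ->
  bilin2 (- dotv W00 n) (- dotv W01 n) (- dotv W11 n) c0 c1 d0 d1 = k ->
  (forall m, dotv Z m = q0 * dotv W0 m + c0 * (d0 * dotv W00 m + d1 * dotv W01 m)
     + (q1 * dotv W1 m + c1 * (d0 * dotv W01 m + d1 * dotv W11 m))) ->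
  Z = - k *: n.
Proof.
move=> AE BE AA BB nn AB An Bn XE q0E q1E hk hZ.
have key m : dotv Z m = dotv X m - dotv X A * dotv A m - dotv X B * dotv B m.
  rewrite hZ q0E q1E; move: (dotv X A) (dotv X B) => x y.
  by rewrite AE BE XE !(dotvDl, dotvZl); ring.
apply: (orthonormal_eq AA BB nn AB An Bn).
- by rewrite key AA (dotvC B A) AB dotvZl (dotvC n A) An; ring.
- by rewrite key AB BB dotvZl (dotvC n B) Bn; ring.
- rewrite key An Bn dotvZl nn -hk XE !(dotvDl, dotvZl) /bilin2; ring.
Qed.

Lemma bilin2C (A B C x0 x1 y0 y1 : R) : bilin2 A B C x0 x1 y0 y1 = bilin2 A B C y0 y1 x0 x1.
Proof. by rewrite /bilin2; ring. Qed.

Lemma dotv_comb2_eq0 (x y : R) (u v m : 'rV[R]_3) : dotv u m = 0 -> dotv v m = 0 ->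
  dotv (x *: u + y *: v) m = 0.
Proof. by move=> um vm; rewrite dotv_comb2 um vm !mulr0 addr0. Qed.

Lemma bilin2_dotv (W0 W1 : 'rV[R]_3) (x0 x1 y0 y1 : R) :
  bilin2 (dotv W0 W0) (dotv W0 W1) (dotv W1 W1) x0 x1 y0 y1 =
  dotv (x0 *: W0 + x1 *: W1) (y0 *: W0 + y1 *: W1).
Proof. by rewrite /bilin2 !(dotvDl, dotvDr, dotvZl, dotvZr) (dotvC W1 W0); ring. Qed.

Lemma smooth_at_comp_pair_scalar {V : normedModType R} m (f : V -> 'rV[R]_m) (h : V -> R)
    (g : 'rV[R]_m * R -> R) p :
  smooth_at f p -> smooth_at h p -> smooth_at g (f p, h p) ->
  smooth_at (fun q => g (f q, h q)) p.
Proof.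
move=> sf sh sg.
have sg1 : smooth_at (fun P => \row_(i < 1) g P) (f p, h p).
  by apply: smooth_at_rV => i; apply: smooth_at_eq sg => P; rewrite mxE.
have := smooth_at_coord 0 (smooth_at_comp_pair sf sh sg1).
by apply: smooth_at_eq => q; rewrite mxE.
Qed.

Lemma orthonormal_det_neq0 (A B C a0 a1 b0 b1 : R) :
  bilin2 A B C a0 a1 a0 a1 = 1 -> bilin2 A B C a0 a1 b0 b1 = 0 ->
  bilin2 A B C b0 b1 b0 b1 = 1 -> a0 * b1 - a1 * b0 != 0.
Proof.
move=> aa ab bb; apply/negP => /eqP J0.
have : bilin2 A B C a0 a1 a0 a1 * bilin2 A B C b0 b1 b0 b1 - bilin2 A B C a0 a1 b0 b1 ^+ 2
  = (a0 * b1 - a1 * b0) ^+ 2 * (A * C - B ^+ 2) by rewrite /bilin2; ring.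
rewrite aa ab bb J0 expr0n mul0r mulr1 subr0 => /eqP; by rewrite oner_eq0.
Qed.

(** Reduces to [pinching_decreases] by a time-independent change of coordinates, which affects
    neither ['D_etime] nor the slice on which the maximum is taken. *)
Lemma critical_decrease (W n : E -> 'rV[R]_3) (P0 : E) (s : E -> R) (phi : R -> R) (al : R) :
  let H P := mean_at W (n P) e0 e1 P in
  let K P := gauss_at W (n P) e0 e1 P in
  (\forall P \near P0, frame_facts W n P) ->
  smooth_at s P0 -> smooth_at phi (s P0) ->
  (\forall P \near P0, 4 * K P = H P * H P * (1 - s P * s P)) ->
  (\forall P \near P0, P.2 = P0.2 -> 'D_etime W P = - (H P `^ al * phi (s P)) *: n P) ->
  (\forall P \near P0, P.2 = P0.2 -> s P <= s P0) ->
  1 < al -> 0 < s P0 < 1 -> 0 < phi (s P0) ->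
  0 < al * phi (s P0) + (1 - s P0) * 'D_1 phi (s P0) ->
  0 < al * phi (s P0) - (1 + s P0) * 'D_1 phi (s P0) ->
  al * s P0 <= 1 ->
  'D_etime s P0 < 0.
Proof.
move=> H K nF ss sphi KsE flow smax al1 /andP[s0 s1] phi0 par1 par2 pinch.
have [[sW sn D0] [nn nW0 nW1 M0]] := nbhs_singleton nF.
(* The curvatures are recovered from [H] and [s]; the relation [KsE] makes their product [K P0], and
   [s P0 > 0] keeps them apart. *)
pose k1 := H P0 * (1 + s P0) / 2; pose k2 := H P0 * (1 - s P0) / 2.
have k12 : k1 + k2 = H P0 by rewrite /k1 /k2; field.
have k12' : k1 * k2 = K P0.
  apply: (@mulfI _ 4); first by rewrite pnatr_eq0.
  by rewrite (nbhs_singleton KsE) /k1 /k2; field.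
have k20 : 0 < k2 by apply: divr_gt0 => //; apply: mulr_gt0 => //; rewrite subr_gt0.
have k21 : k2 < k1.
  have sN : 1 - s P0 < 1 + s P0 by rewrite ltrD2l (lt_trans _ s0) // oppr_lt0.
  have h : H P0 * (1 - s P0) < H P0 * (1 + s P0) by rewrite ltr_pM2l.
  by rewrite /k1 /k2 ltr_pM2r // invr_gt0.
have A0 := first_det_norm_gt0 D0.
have [a0 [a1 [b0 [b1 [[aa ab bb] [haa hab hbb]]]]]] := diagonal_basis A0 D0 k21 k12 k12'.
have J0 := orthonormal_det_neq0 aa ab bb.
pose W0 := 'D_e0 W P0; pose W1 := 'D_e1 W P0.
pose W00 := 'D_e0 ('D_e0 W) P0; pose W01 := 'D_e0 ('D_e1 W) P0; pose W11 := 'D_e1 ('D_e1 W) P0.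
pose A := a0 *: W0 + a1 *: W1; pose B := b0 *: W0 + b1 *: W1.
have AA : dotv A A = 1 := etrans (esym (bilin2_dotv _ _ _ _ _ _)) aa.
have AB : dotv A B = 0 := etrans (esym (bilin2_dotv _ _ _ _ _ _)) ab.
have BB : dotv B B = 1 := etrans (esym (bilin2_dotv _ _ _ _ _ _)) bb.
have W0n : dotv W0 (n P0) = 0 := etrans (dotvC _ _) nW0.
have W1n : dotv W1 (n P0) = 0 := etrans (dotvC _ _) nW1.
have An : dotv A (n P0) = 0 := dotv_comb2_eq0 a0 a1 W0n W1n.
have Bn : dotv B (n P0) = 0 := dotv_comb2_eq0 b0 b1 W0n W1n.
pose acc c0 c1 d0 d1 : 'rV[R]_3 :=
  (c0 * d0) *: W00 + (c0 * d1 + c1 * d0) *: W01 + (c1 * d1) *: W11.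
pose q0 X : R := - dotv X A * a0 - dotv X B * b0.
pose q1 X : R := - dotv X A * a1 - dotv X B * b1.
pose row2 (x y : R) : 'rV[R]_2 := x *: delta_mx 0 0 + y *: delta_mx 0 1.
have r0 x y : row2 x y 0 0 = x by rewrite /row2 !mxE /= mulr1 mulr0 addr0.
have r1 x y : row2 x y 0 1 = y by rewrite /row2 !mxE /= mulr1 mulr0 add0r.
pose qq X := row2 (q0 X) (q1 X).
(* The linear part of the coordinate change is the orthonormal principal basis. The quadratic part
   removes the tangential component of each second derivative, which makes the Christoffel symbols
   vanish at [p]. *)
have [psi1 [[spsi psi0 dpa dpb] [dpaa dpm dpbb]]] := quadratic_param P0.1 (row2 a0 a1) (row2 b0 b1)
  (qq (acc a0 a1 a0 a1)) (qq (acc b0 b1 a0 a1)) (qq (acc b0 b1 b0 b1)) P0.2.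
pose psi (P : E) := psi1 P.1; pose tau (P : E) := P.2.
pose p : E := (0, P0.2).
have stau P : smooth_at tau P := smooth_at_snd P.
have PE : (psi p, tau p) = P0 by rewrite /psi /tau /= psi0 -surjective_pairing.
have tau0 i P : 'D_(espace i) tau P = 0 := derive_snd_espace i P.
have ntau i : \forall q \near p, 'D_(espace i) tau q = 0 by near=> q; exact: tau0.
pose Psi P := (psi P, tau P).
pose Y P := W (Psi P).
have pull (F : E -> Prop) : (\forall P \near P0, F P) -> \forall q \near p, F (Psi q).
  by move=> h; apply: (near_reparam (spsi p) (stau p)); rewrite PE.
have sWp : smooth_at W (psi p, tau p) by rewrite PE.
have snp : smooth_at n (psi p, tau p) by rewrite PE.
have sY : smooth_at Y p := smooth_at_comp_pair (spsi p) (stau p) sWp.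
have sN : smooth_at (fun q => n (Psi q)) p := smooth_at_comp_pair (spsi p) (stau p) snp.
have sHP : smooth_at H P0 := smooth_at_mean sW sn D0.
have sKP : smooth_at K P0 := smooth_at_gauss sW sn D0.
have sH : smooth_at (fun q => H (Psi q)) p.
  by apply: smooth_at_comp_pair_scalar (spsi p) (stau p) _; rewrite PE.
have sK : smooth_at (fun q => K (Psi q)) p.
  by apply: smooth_at_comp_pair_scalar (spsi p) (stau p) _; rewrite PE.
have sS : smooth_at (fun q => s (Psi q)) p.
  by apply: smooth_at_comp_pair_scalar (spsi p) (stau p) _; rewrite PE.
have nF' := pull _ nF.
have dY i : \forall q \near p, 'D_(espace i) Y q =
    ('D_(espace i) psi q) 0 0 *: 'D_e0 W (Psi q) + ('D_(espace i) psi q) 0 1 *: 'D_e1 W (Psi q).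
  move: nF'; apply: filterS => q [[sWq _ _] _].
  exact: derive_reparam sWq (spsi q) (stau q) (tau0 i q).
have nY i : \forall q \near p, dotv (n (Psi q)) ('D_(espace i) Y q) = 0.
  move: nF' (dY i); apply: filterS2 => q [_ [_ nq0 nq1 _]] dq.
  apply: (etrans (congr1 (dotv _) dq)); apply: (etrans (dotvC _ _)).
  exact: (dotv_comb2_eq0 _ _ (etrans (dotvC _ _) nq0) (etrans (dotvC _ _) nq1)).
have sPsip : Psi p = P0 := PE.
have Y0 : 'D_e0 Y p = A.
  apply: (etrans (nbhs_singleton (dY 0))).
  by rewrite sPsip (_ : 'D_e0 psi p = row2 a0 a1) // r0 r1.
have Y1 : 'D_e1 Y p = B.
  apply: (etrans (nbhs_singleton (dY 1))).
  by rewrite sPsip (_ : 'D_e1 psi p = row2 b0 b1) // r0 r1.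
have second i j : forall c0 c1 d0 d1 x0 x1, 'D_(espace j) psi p = row2 c0 c1 ->
    'D_(espace i) psi p = row2 d0 d1 -> 'D_(espace i) ('D_(espace j) psi) p = row2 x0 x1 ->
    forall m, dotv ('D_(espace i) ('D_(espace j) Y) p) m =
      x0 * dotv W0 m + c0 * (d0 * dotv W00 m + d1 * dotv W01 m)
     + (x1 * dotv W1 m + c1 * (d0 * dotv W01 m + d1 * dotv W11 m)).
  move=> c0 c1 d0 d1 x0 x1 hc hd hx m.
  have := derive2_reparam sWp (spsi p) (stau p) m (ntau j) (ntau i).
  by rewrite hc hd hx !r0 !r1 PE.
have D00 : 'D_e0 ('D_e0 Y) p = - k1 *: n P0.
  exact: (normal_acceleration erefl erefl AA BB nn AB An Bn erefl erefl erefl haa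
    (second 0 0 _ _ _ _ _ _ dpa dpa dpaa)).
have hba : bilin2 (- dotv W00 (n P0)) (- dotv W01 (n P0)) (- dotv W11 (n P0)) b0 b1 a0 a1 = 0.
  exact: etrans (bilin2C _ _ _ _ _ _ _) hab.
have D01 : 'D_e0 ('D_e1 Y) p = - 0 *: n P0.
  exact: (normal_acceleration erefl erefl AA BB nn AB An Bn erefl erefl erefl hba
    (second 0 1 _ _ _ _ _ _ dpb dpa dpm)).
have D11 : 'D_e1 ('D_e1 Y) p = - k2 *: n P0.
  exact: (normal_acceleration erefl erefl AA BB nn AB An Bn erefl erefl erefl hbb
    (second 1 1 _ _ _ _ _ _ dpb dpb dpbb)).
(* The curvature functions agree in both coordinate systems wherever the Jacobian is nonzero, hence
   near [p]; equality at [p] alone could not be differentiated. *)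
have nMG : \forall q \near p,
    H (Psi q) = mean_at Y (n (Psi q)) e0 e1 q /\ K (Psi q) = gauss_at Y (n (Psi q)) e0 e1 q.
  pose J q := ('D_e0 psi q) 0 0 * ('D_e1 psi q) 0 1 - ('D_e0 psi q) 0 1 * ('D_e1 psi q) 0 0.
  have c i j := smooth_at_coord j (smooth_at_derive (espace i) (spsi p)).
  have sJ : smooth_at J p := smooth_atB (smooth_atM (c 0 0) (c 1 1)) (smooth_atM (c 0 1) (c 1 0)).
  have Jp : J p = a0 * b1 - a1 * b0.
    by rewrite /J (_ : 'D_e0 psi p = row2 a0 a1) // (_ : 'D_e1 psi p = row2 b0 b1) // !r0 !r1.
  have JJ : 0 < J p * J p by rewrite Jp -expr2 exprn_even_gt0.
  have nJ := smooth_at_near_gt (smooth_atM sJ sJ) JJ.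
  move: nF' nJ; apply: filterS2 => q [[sWq _ Dq] [_ nq0 nq1 _]] Jq.
  have Jq0 : J q != 0.
    by apply/negP => /eqP h; move: Jq; rewrite h mulr0 ltxx.
  have nt i : \forall q' \near q, 'D_(espace i) tau q' = 0 by near=> q'; exact: tau0.
  have Dq0 : first_det W e0 e1 (Psi q) != 0 by rewrite gt_eqF.
  have [eH eK] := mean_gauss_reparam sWq (spsi q) (stau q) (nt 0) (nt 1)
    (etrans (dotvC _ _) nq0) (etrans (dotvC _ _) nq1) Jq0 Dq0.
  by split; [exact: esym eH|exact: esym eK].
have smaxp : \forall q \near p, q.2 = P0.2 -> s (Psi q) <= s (Psi p).
  by rewrite sPsip; exact: (pull _ smax).
have flowp : \forall q \near p, q.2 = P0.2 ->
    'D_etime Y q = - (H (Psi q) `^ al * phi (s (Psi q))) *: n (Psi q).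
  move: (pull _ flow); apply: filterS => -[u t] fl /= tE.
  exact: (etrans (derive_time_reparam W psi1 u t) (fl tE)).
have closed i : forall (q : E) (r : R), q.2 = P0.2 -> (r *: espace i + q : E).2 = P0.2.
  by move=> q r <-; rewrite /= [r *: 0]mulr0 add0r.
have fin := @pinching_decreases R _ Y (fun q => n (Psi q)) e0 e1 etime p
  [set q | q.2 = P0.2] (fun q => H (Psi q)) (fun q => K (Psi q)) (fun q => s (Psi q)) phi al k1 k2
  sY sN sH sK sS.
have tE : 'D_etime (fun q => s (Psi q)) p = 'D_etime s P0.
  apply: (etrans (derive_time_reparam s psi1 0 P0.2)).
  by rewrite psi0 -surjective_pairing.
rewrite -tE; apply: fin.
- by rewrite sPsip.
- by move: nF'; apply: filterS => q [_ []].
- exact: nY.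
- exact: nY.
- exact: (etrans (congr2 (@dotv R 3) Y0 Y0) AA).
- exact: (etrans (congr2 (@dotv R 3) Y0 Y1) AB).
- exact: (etrans (congr2 (@dotv R 3) Y1 Y1) BB).
- by rewrite sPsip.
- by apply: (etrans D01); rewrite oppr0 scale0r.
- by rewrite sPsip.
- by [].
- exact: closed.
- exact: closed.
- exact: flowp.
- by move: nMG; apply: filterS => q [].
- by move: nMG; apply: filterS => q [].
- exact: (pull _ KsE).
- exact: smaxp.
- exact: al1.
- exact: k20.
- exact: k21.
- rewrite sPsip k12 /k1 /k2; field; by rewrite gt_eqF.
- by rewrite sPsip.
- by rewrite sPsip.
- by rewrite sPsip.
- rewrite -subr_ge0 (_ : _ - _ = H P0 * (1 - al * s P0)); last by rewrite /k1 /k2; field.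
  by rewrite mulr_ge0 ?subr_ge0 // ltW.
Unshelve. all: by end_near. Qed.

End critical_point.

(** * Homogeneous speeds *)

Section speed.
Context {R : realType}.
Variables (al : R) (F : R * R -> R).
Hypotheses (al1 : 1 < al) (Fsmooth : smooth_on (@pos_cone R) F)
  (Fhom : forall l a b : R, 0 < l -> 0 < a -> 0 < b -> F (l * a, l * b) = l `^ al * F (a, b))
  (Fmono : forall p, @pos_cone R p -> 0 < 'D_(1, 0) F p /\ 0 < 'D_(0, 1) F p).

Lemma near_pos_cone (p : R * R) : pos_cone p -> \forall q \near p, pos_cone q.
Proof.
move=> [p1 p2].
have h1 := smooth_at_near_gt (smooth_at_fst p) p1.
have h2 := smooth_at_near_gt (smooth_at_snd p) p2.
exact: filterI h1 h2.
Qed.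

Lemma smooth_at_speed p : pos_cone p -> smooth_at F p.
Proof.
move=> pp; have [U [g [oU Up Cg gE]]] := Fsmooth pp.
have sg : smooth_at g p by exists U.
apply: smooth_at_ext sg.
have nU : \forall q \near p, U q by exact: open_nbhs_nbhs.
by move: nU (near_pos_cone pp); apply: filterS2 => q Uq qq; rewrite gE.
Qed.

Lemma derive_speed_comb p (a b : R) : pos_cone p ->
  'D_(a, b) F p = a * 'D_(1, 0) F p + b * 'D_(0, 1) F p.
Proof.
move=> pp; have dF := smooth_at_differentiable (smooth_at_speed pp).
have -> : (a, b) = a *: ((1, 0) : R * R) + b *: ((0, 1) : R * R).
  by congr pair; [change (a = a * 1 + b * 0)|change (b = a * 0 + b * 1)]; ring.
exact: derive_comb.
Qed.

(** Euler's identity: both sides are the derivative at [r = 1] of the two expressions that [Fhom]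
    gives for [F] at [(r a, r b)]. *)
Lemma euler_speed (a b : R) : 0 < a -> 0 < b ->
  a * 'D_(1, 0) F (a, b) + b * 'D_(0, 1) F (a, b) = al * F (a, b).
Proof.
move=> a0 b0; have pp : pos_cone (a, b) by [].
rewrite -(derive_speed_comb a b pp).
pose v : R * R := (a, b).
have vE : 1 *: v + 0 = v by rewrite scale1r addr0.
have dv : derivable F (1 *: v + 0) v.
  by rewrite vE; exact: smooth_at_derivable (smooth_at_speed pp).
have [_ e1] := is_derive_line dv; rewrite vE in e1.
have s1 : smooth_at (fun r : R => r) 1 by apply: smooth_at_lin => // r; exact: cvg_id.
have e2 : 'D_1 (fun r : R => F (r *: v + 0)) 1 = 'D_1 (fun r : R => r `^ al * F v) (1 : R).
  apply: near_eq_derive; have := smooth_at_near_gt s1 (@ltr01 R).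
  apply: filterS => r r0; rewrite addr0; exact: Fhom.
have sp : smooth_at (fun r : R => r `^ al) 1 by exact: smooth_at_powR.
have e3 : 'D_1 (fun r : R => r `^ al * F v) (1 : R) = al * F v.
  apply: (etrans (deriveMs _ sp (smooth_at_cst (F v) (1 : R)))).
  rewrite derive_cst mulr0 addr0 derive_powRs // powR1 mulr1 derive_id; by rewrite mulr1.
exact: etrans (esym e1) (etrans e2 e3).
Qed.

(* By homogeneity F (a, b) = (a + b)^al * speed_profile ((a - b) / (a + b)). *)
Definition speed_profile (s : R) : R := F ((1 + s) / 2, (1 - s) / 2).

Lemma profile_cone (s : R) : -1 < s -> s < 1 -> pos_cone ((1 + s) / 2, (1 - s) / 2).
Proof. by move=> h1 h2; split; rewrite /= divr_gt0 //; lra. Qed.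

Lemma profileE (s : R) : speed_profile s = F (s *: ((2^-1, - 2^-1) : R * R) + (2^-1, 2^-1)).
Proof.
rewrite /speed_profile; congr (F _); congr pair.
  by change ((1 + s) / 2 = s * 2^-1 + 2^-1); field.
by change ((1 - s) / 2 = s * - 2^-1 + 2^-1); field.
Qed.

Lemma profile_pointE (s : R) :
  s *: ((2^-1, - 2^-1) : R * R) + (2^-1, 2^-1) = ((1 + s) / 2, (1 - s) / 2).
Proof.
congr pair.
  by change (s * 2^-1 + 2^-1 = (1 + s) / 2); field.
by change (s * - 2^-1 + 2^-1 = (1 - s) / 2); field.
Qed.

Lemma smooth_at_profile (s : R) : -1 < s -> s < 1 -> smooth_at speed_profile s.
Proof.
move=> h1 h2.
have s1 : smooth_at (fun r : R => r) s by apply: smooth_at_lin => // r; exact: cvg_id.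
have sc (c : R) : smooth_at (fun _ : R => c) s by exact: smooth_at_cst.
have sa : smooth_at (fun r : R => (1 + r) / 2) s := smooth_atM (smooth_atD (sc 1) s1) (sc 2^-1).
have sb : smooth_at (fun r : R => (1 - r) / 2) s := smooth_atM (smooth_atB (sc 1) s1) (sc 2^-1).
exact: smooth_at_comp2 sa sb (smooth_at_speed (profile_cone h1 h2)).
Qed.

Lemma derive_profile (s : R) : -1 < s -> s < 1 -> 'D_1 speed_profile s =
  ('D_(1, 0) F ((1 + s) / 2, (1 - s) / 2) - 'D_(0, 1) F ((1 + s) / 2, (1 - s) / 2)) / 2.
Proof.
move=> h1 h2; have pp := profile_cone h1 h2.
pose v : R * R := (2^-1, - 2^-1); pose p : R * R := (2^-1, 2^-1).
have dv : derivable F (s *: v + p) v.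
  by rewrite profile_pointE; exact: smooth_at_derivable (smooth_at_speed pp).
have [_ e1] := is_derive_line dv.
have e2 : 'D_1 speed_profile s = 'D_1 (fun r : R => F (r *: v + p)) s.
  by apply: near_eq_derive; near=> r; exact: profileE.
apply: (etrans e2); apply: (etrans e1); rewrite profile_pointE.
apply: (etrans (derive_speed_comb _ _ pp)).
by move: ('D_(1, 0) F _) ('D_(0, 1) F _) => x y; field.
Unshelve. all: by end_near. Qed.

(** By Euler's identity the last two expressions are exactly the partial derivatives of [F] at the
    point of the profile, so they state parabolicity of the flow; positivity of the profile is
    Euler's identity itself. *)
Lemma profile_facts (s : R) : -1 < s -> s < 1 ->
  [/\ 0 < speed_profile s, 0 < al * speed_profile s + (1 - s) * 'D_1 speed_profile s &
      0 < al * speed_profile s - (1 + s) * 'D_1 speed_profile s].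
Proof.
move=> h1 h2; have pp := profile_cone h1 h2; have [F1 F2] := Fmono pp.
have eu := euler_speed pp.1 pp.2; rewrite (derive_profile h1 h2).
have eu' : al * speed_profile s = (1 + s) / 2 * 'D_(1, 0) F ((1 + s) / 2, (1 - s) / 2) +
    (1 - s) / 2 * 'D_(0, 1) F ((1 + s) / 2, (1 - s) / 2) by exact: esym eu.
have [a0 b0] := pp; rewrite /= in a0 b0.
move: F1 F2 eu'; clear eu; move: ('D_(1, 0) F _) ('D_(0, 1) F _) (speed_profile s) => x y f x0 y0 e.
have xy0 : 0 < (1 + s) / 2 * x + (1 - s) / 2 * y.
  by apply: addr_gt0; exact: mulr_gt0.
rewrite e; split.
- by rewrite -e pmulr_rgt0 // in xy0; exact: lt_trans al1.
- by rewrite (_ : _ + _ + _ = x) //; field.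
- by rewrite (_ : _ + _ - _ = y) //; field.
Qed.

Lemma speed_profileE (h s : R) : 0 < h -> -1 < s -> s < 1 ->
  F (h * (1 + s) / 2, h * (1 - s) / 2) = h `^ al * speed_profile s.
Proof.
move=> h0 h1 h2; have [a0 b0] := profile_cone h1 h2.
by rewrite -!mulrA; exact: Fhom.
Qed.

End speed.

Lemma valid_time_right {R : realType} (T : \bar R) (t : R) : 0 <= t -> (t%:E < T)%E ->
  \forall h \near (0 : R), 0 < h -> 0 <= t + h /\ ((t + h)%:E < T)%E.
Proof.
move=> t0 tT.
have [d d0 dT] : exists2 d : R, 0 < d & forall h, h < d -> ((t + h)%:E < T)%E.
  case: T tT => [u| |] tT.
  - exists (u - t); first by move: tT; rewrite lte_fin subr_gt0.
    by move=> h hd; rewrite lte_fin -ltrBrDl.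
  - by exists 1 => // h _; rewrite ltry.
  - by [].
have n := @nbhs0_lt R R d d0.
by move: n; apply: filterS => h hd h0; split;
  [rewrite addr_ge0 // ltW|apply: dT; rewrite (le_lt_trans (ler_norm h))].
Qed.

(** Limits are compared from the right, where all small time steps are valid, also at time 0. The
    extension [W] has a two-sided time derivative, so its right limit determines it. *)
Lemma flow_chart {R : realType} (F : R * R -> R) (T : \bar R)
    (x nu : 'rV[R]_3 -> R -> 'rV[R]_3) (eps : R)
    (W : 'rV[R]_2 * R -> 'rV[R]_3) (P : 'rV[R]_2 * R) (k1 k2 : R) :
  curvature_flow F T x nu -> eps * eps = 1 -> valid_time T P -> smooth_at W P ->
  (\forall Q \near P, valid_time T Q -> x (stereo eps Q.1) Q.2 = W Q) ->
  principal_curvatures (x^~ P.2) (nu^~ P.2) (stereo eps P.1) k1 k2 ->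
  'D_etime W P = - F (k1, k2) *: nu (stereo eps P.1) P.2.
Proof.
move=> flow ee vP sW xW pc.
have := flow _ _ _ _ (valid_spacetime ee vP) pc; set z := stereo eps P.1; set t := P.2 => c1.
have c2 : h^-1 *: (W (h *: etime + P) - W P) @[h --> (0 : R)^'] --> 'D_etime W P.
  exact: cvg_derive (smooth_at_derivable sW).
have c1' : h^-1 *: (x z (t + h) - x z t) @[h --> (0 : R)^'+] --> - F (k1, k2) *: nu z t.
  apply: cvg_trans c1 => B nB; have nB' : \forall h \near (0 : R), h != 0 -> 0 <= t + h ->
    B (h^-1 *: (x z (t + h) - x z t)) := nB.
  change (\forall h \near (0 : R), 0 < h -> B (h^-1 *: (x z (t + h) - x z t))).
  by move: nB'; apply: filterS => h hB h0; apply: hB; rewrite ?gt_eqF // addr_ge0 ?(ltW h0) // vP.1.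
have c2' : h^-1 *: (x z (t + h) - x z t) @[h --> (0 : R)^'+] --> 'D_etime W P.
  apply: cvg_trans c2 => B nB; have nB' : \forall h \near (0 : R), h != 0 ->
    B (h^-1 *: (W (h *: etime + P) - W P)) := nB.
  change (\forall h \near (0 : R), 0 < h -> B (h^-1 *: (x z (t + h) - x z t))).
  have nx : \forall h \near (0 : R), valid_time T (h *: etime + P) ->
      x (stereo eps (h *: etime + P).1) (h *: etime + P).2 = W (h *: etime + P).
    have cl : h *: etime + P @[h --> (0 : R)] --> P by exact: cvg_line.
    exact: cl xW.
  have nv := valid_time_right vP.1 vP.2.
  near=> h => h0.
  have hE : h *: etime + P = (P.1, P.2 + h).
    by case: (P) => a b; congr pair; [change (h *: 0 + a = a); rewrite scaler0 add0r
                                     |change (h * 1 + b = b + h); rewrite mulr1 addrC].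
  have e1 : x z (t + h) = W (h *: etime + P).
    have e : valid_time T (h *: etime + P) ->
      x (stereo eps (h *: etime + P).1) (h *: etime + P).2 = W (h *: etime + P) by near: h.
    rewrite -e hE //; have v : 0 < h -> 0 <= P.2 + h /\ ((P.2 + h)%:E < T)%E by near: h.
    exact: v.
  have e2 : x z t = W P by exact: (nbhs_singleton xW).
  have b : h != 0 -> B (h^-1 *: (W (h *: etime + P) - W P)) by near: h.
  by rewrite e1 e2; apply: b; rewrite gt_eqF.
exact: cvg_unique c2' c1'.
Unshelve. all: by end_near. Qed.

(** * The maximum principle *)

(** Both sides of the first inequality are nonnegative; it is squared, divided by [H * H], and
    rewritten with [(k1 - k2)^2 = H^2 - 4 K]. *)
Lemma gap_lt {R : realType} (H K k1 k2 l : R) : 0 < l -> 0 < H ->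
  k1 + k2 = H -> k1 * k2 = K ->
  (l * (k1 + k2) < `|k1 - k2|) = (l * l < 1 - 4 * K * (H * H)^-1).
Proof.
move=> l0 H0 kH kK; have H00 : H != 0 by rewrite gt_eqF.
have HH : 0 < H * H by exact: mulr_gt0.
rewrite -(@ltr_pXn2r _ 2) ?nnegrE // ?normr_ge0 //; last by rewrite kH ltW // mulr_gt0.
rewrite real_normK ?num_real // -(ltr_pM2r HH (l * l)) kH -kK -kH.
by congr (_ < _); [ring|field; rewrite kH].
Qed.

(** The time derivative stays negative on a ball. From a later point of the ball the vertical
    segment down to the time [P0.2] remains inside, and along it [f] decreases in time, so the bound
    on the slice propagates upwards. *)
Lemma time_decrease {R : realType} (f : 'rV[R]_2 * R -> R) P0 (c : R) :
  smooth_at f P0 -> 'D_etime f P0 < 0 ->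
  (\forall P \near P0, P.2 = P0.2 -> f P <= c) ->
  \forall P \near P0, P0.2 < P.2 -> f P <= c.
Proof.
move=> sf f0 fc.
have n1 : \forall P \near P0, smooth_at f P /\ 'D_etime f P < 0.
  exact: filterI (smooth_at_near sf) (smooth_at_near_lt (smooth_at_derive etime sf) f0).
have /nbhs_ballP[d /= d0 dH] : \forall P \near P0, (smooth_at f P /\ 'D_etime f P < 0) /\
    (P.2 = P0.2 -> f P <= c) by exact: filterI n1 fc.
apply/nbhs_ballP; exists d => //= P [P1 P2] tP.
pose p : 'rV[R]_2 * R := (P.1, P0.2); pose h := P.2 - P0.2.
have h0 : 0 < h by rewrite subr_gt0.
have sE s : s *: etime + p = (P.1, P0.2 + s).
  by congr pair; [change (s *: 0 + P.1 = P.1); rewrite scaler0 add0r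
                 |change (s * 1 + P0.2 = P0.2 + s); rewrite mulr1 addrC].
have inb s : 0 <= s <= h -> ball P0 d (s *: etime + p).
  move=> /andP[s0 sh]; rewrite sE; split => //.
  move: P2; rewrite -!ball_normE /ball_ /= => P2.
  have e : P0.2 - (P0.2 + s) = - s by ring.
  have e' : P0.2 - P.2 = - h by rewrite opprB.
  rewrite e normrN ger0_norm //; apply: le_lt_trans sh _.
  by move: P2; rewrite e' normrN gtr0_norm.
have df s : 0 <= s <= h -> differentiable f (s *: etime + p).
  by move=> /inb/dH[[? _] _]; exact: smooth_at_differentiable.
have [c' /andP[c0 ch] E] := line_MVT h0 df.
have c'h : 0 <= c' <= h by rewrite !ltW.
have [[_ neg] _] := dH _ (inb _ c'h).
have fp : f p <= c.
  have h00 : (0 : R) <= 0 <= h by rewrite lexx ltW.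
  have [_ H] := dH _ (inb _ h00); move: H; rewrite sE addr0; exact.
have PE : h *: etime + p = P by rewrite sE /h addrC subrK -surjective_pairing.
rewrite PE in E.
have : f P - f p < 0 by rewrite E pmulr_rlt0.
by rewrite subr_lt0 => /ltW; move=> h1; exact: le_trans h1 fp.
Qed.

Lemma le_eq_or_lt {R : realType} (a b : R) : a <= b -> a = b \/ a < b.
Proof. by rewrite le_eqVlt => /orP[/eqP|]; [left|right]. Qed.

Lemma sqrt_mul_self {R : realType} (a : R) : 0 < a -> a = Num.sqrt a * Num.sqrt a.
Proof. by move=> a0; rewrite -expr2 sqr_sqrtr // ltW. Qed.

Lemma sqrt_mulr_self {R : realType} (a : R) : 0 < a -> Num.sqrt (a * a) = a.
Proof. by move=> a0; rewrite -expr2 sqrtr_sqr gtr0_norm. Qed.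

Lemma sphere2_compact {R : realType} : compact (@sphere2 R).
Proof.
have sE : @sphere2 R = (fun z => dotv z z) @^-1` [set 1] by [].
apply: bounded_closed_compact; last first.
  rewrite sE; apply: closed_comp; last exact: closed_eq.
  move=> z _; apply: smooth_at_continuous; apply: smooth_at_dotv;
    by apply: smooth_at_lin => // ? ?.
exists 1; split; first exact: num_real.
move=> M M1 z /= zS; apply: le_trans (ltW M1).
rewrite /sphere2 /= dotv3E in zS.
rewrite [leLHS]/Num.Def.normr /= mx_normrE; apply: bigmax_le => // -[i j] _ /=.
rewrite -(@ler_pXn2r _ 2) ?nnegrE // real_normK ?num_real // expr1n (ord1 i) -zS.
have sq (a : R) : 0 <= a * a by rewrite -expr2 sqr_ge0.
have [] : [\/ j = 0, j = 1 | j = 2%:R].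
  by case: j => -[|[|[|//]]] jlt; [constructor 1|constructor 2|constructor 3]; apply/val_inj.
- by move=> ->; rewrite expr2 -addrA lerDl addr_ge0.
- by move=> ->; rewrite expr2 addrAC lerDr addr_ge0.
- by move=> ->; rewrite expr2 lerDr addr_ge0.
Qed.

Section pinched_flow.
Context {R : realType}.
Local Notation E := ('rV[R]_2 * R)%type.
Local Notation e0 := (espace (0 : 'I_2)).
Local Notation e1 := (espace (1 : 'I_2)).
Local Notation sphere2 := (@sphere2 R).
Variables (al : R) (F : R * R -> R).
Hypotheses (al1 : 1 < al) (Fsmooth : smooth_on (@pos_cone R) F)
  (Fhom : forall l a b : R, 0 < l -> 0 < a -> 0 < b -> F (l * a, l * b) = l `^ al * F (a, b))
  (Fmono : forall p, @pos_cone R p -> 0 < 'D_(1, 0) F p /\ 0 < 'D_(0, 1) F p).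
Variables (T : \bar R) (x nu : 'rV[R]_3 -> R -> 'rV[R]_3).
Hypotheses (xsmooth : smooth_on (spacetime T) (fun p => x p.1 p.2))
  (xembedding : forall t : R, 0 <= t -> (t%:E < T)%E -> sphere_embedding (x^~ t))
  (nunormal : forall t : R, 0 <= t -> (t%:E < T)%E ->
     outward_unit_normal (x^~ t) (nu^~ t))
  (xconvex : forall t : R, 0 <= t -> (t%:E < T)%E -> strictly_convex (x^~ t) (nu^~ t))
  (xflow : curvature_flow F T x nu).
Variables (l : R).
Hypotheses (l0 : 0 < l) (l1 : l < 1) (lal : al * l <= 1).

Local Notation PC z t := (principal_curvatures (x^~ t) (nu^~ t) z).

(* With l = (r - 1) / (r + 1) this says that the ratio of the curvatures exceeds r. *)
Definition unpinched z t := exists k1 k2, PC z t k1 k2 /\ l * (k1 + k2) < `|k1 - k2|.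

(* (k1 - k2)^2 / (k1 + k2)^2 *)
Definition gap (W n : E -> 'rV[R]_3) (P : E) : R :=
  1 - 4 * gauss_at W (n P) e0 e1 P * (mean_at W (n P) e0 e1 P * mean_at W (n P) e0 e1 P)^-1.

(** Turns a condition on the unordered pair of curvatures into a strict inequality for a smooth
    function, hence into an open condition. *)
Lemma unpinched_gap eps W n P : frame_facts W n P -> surface_facts x nu eps W n P ->
  unpinched (stereo eps P.1) P.2 <-> l * l < gap W n P.
Proof.
move=> [_ [_ _ _ H0]] [_ _ pc K0 D]; split.
  move=> [k1 [k2 [/pc[kH kK]]]].
  by move=> h; move: (h); rewrite (gap_lt l0 H0 kH kK).
move=> h; have D' : 0 <= mean_at W (n P) e0 e1 P ^+ 2 - 4 * gauss_at W (n P) e0 e1 P.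
  by rewrite subr_ge0.
have [k1 [k2 [kH kK]]] := quadratic_roots D'.
exists k1, k2; split; first exact/pc.
by move: h; rewrite -(gap_lt l0 H0 kH kK).
Qed.

Lemma smooth_at_gap W n P : frame_facts W n P -> smooth_at (gap W n) P.
Proof.
move=> [[sW sn D0] [_ _ _ M0]].
have sM := smooth_at_mean sW sn D0; have sK := smooth_at_gauss sW sn D0.
have MM : 0 < mean_at W (n P) e0 e1 P  * mean_at W (n P) e0 e1 P by exact: mulr_gt0.
have sV : smooth_at (fun Q => (mean_at W (n Q) e0 e1 Q * mean_at W (n Q) e0 e1 Q)^-1) P.
  exact: (smooth_atV _ (smooth_atM sM sM)).
have sP := smooth_atM (smooth_atM (smooth_at_cst (4 : R) P) sK) sV.
exact: smooth_atB (smooth_at_cst (1 : R) P) sP.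
Qed.

Lemma gap_mean_gauss W n P : frame_facts W n P ->
  4 * gauss_at W (n P) e0 e1 P =
  mean_at W (n P) e0 e1 P * mean_at W (n P) e0 e1 P * (1 - gap W n P).
Proof.
move=> [_ [_ _ _ M0]]; rewrite /gap.
move: M0; move: (mean_at _ _ _ _ _) (gauss_at _ _ _ _ _) => H K H0.
by field; rewrite gt_eqF.
Qed.

(** The curvatures are [H (1 + s) / 2] and [H (1 - s) / 2], at which homogeneity splits [F] into a
    power of [H] and the profile. *)
Lemma gap_flow eps W n P s : eps * eps = 1 -> valid_time T P -> frame_facts W n P ->
  surface_facts x nu eps W n P ->
  (\forall Q \near P, valid_time T Q -> surface_facts x nu eps W n Q) ->
  gap W n P = s * s -> 0 <= s -> s < 1 ->
  'D_etime W P = - (mean_at W (n P) e0 e1 P `^ al * speed_profile F s) *: n P.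
Proof.
move=> ee vP fr su suN gs s0 s1; have KE := gap_mean_gauss fr.
have [[sW _ _] [_ _ _ H0]] := fr; have [_ nE pc _ _] := su.
have xW : \forall Q \near P, valid_time T Q -> x (stereo eps Q.1) Q.2 = W Q.
  by move: suN; apply: filterS => Q h v; have [] := h v.
have pck : PC (stereo eps P.1) P.2 (mean_at W (n P) e0 e1 P * (1 + s) / 2)
    (mean_at W (n P) e0 e1 P * (1 - s) / 2).
  apply/pc; move: KE; rewrite gs; move: (mean_at _ _ _ _ _) (gauss_at _ _ _ _ _) => H K e.
  split; first by field.
  by apply: (@mulfI _ 4); rewrite ?pnatr_eq0 // e; field.
apply: etrans (flow_chart xflow ee vP sW xW pck) _.
have sN : -1 < s by apply: lt_le_trans s0; rewrite oppr_lt0.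
by rewrite nE (speed_profileE Fhom H0 sN s1).
Qed.

#[local] Opaque gap.

(** Below the level continuity suffices. At the level, [l > 0] makes the root of the gap smooth near
    [P0], and the hypothesis makes [P0] a local spatial maximum of it with value [l <= 1 / al]; its
    time derivative is then negative and [time_decrease] applies. *)
Lemma gap_decrease eps W n P0 : eps * eps = 1 -> valid_time T P0 ->
  (\forall P \near P0, frame_facts W n P) ->
  (\forall P \near P0, valid_time T P -> surface_facts x nu eps W n P) ->
  (\forall P \near P0, P.2 = P0.2 -> gap W n P <= l * l) ->
  \forall P \near P0, P0.2 < P.2 -> gap W n P <= l * l.
Proof.
move=> ee v0 nfr nsu nle.
have sg := smooth_at_gap (nbhs_singleton nfr).
have nle0 : P0.2 = P0.2 -> gap W n P0 <= l * l := nbhs_singleton nle.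
have [gl|gl] := le_eq_or_lt (nle0 erefl); last first.
  have n1 := smooth_at_near_lt sg gl.
  by move: n1; apply: filterS => P h _; exact: ltW.
have g0 : 0 < gap W n P0 by rewrite gl mulr_gt0.
pose s P := Num.sqrt (gap W n P).
have ss : smooth_at s P0 by exact: smooth_at_sqrt.
have sP0 : s P0 = l by rewrite /s gl sqrt_mulr_self.
have ng := smooth_at_near_gt sg g0.
have sq P : 0 < gap W n P -> gap W n P = s P * s P.
  exact: sqrt_mul_self.
have le_s P : gap W n P <= l * l -> s P <= l.
  by move=> h; rewrite -sP0; apply: ler_wsqrtr; rewrite gl.
have smax : \forall P \near P0, P.2 = P0.2 -> s P <= s P0.
  by rewrite sP0; move: nle; apply: filterS => P h e; exact: le_s (h e).
have [lN l1'] : -1 < l /\ l < 1 by split => //; apply: lt_trans l0; rewrite oppr_lt0.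
have [ph0 ph1 ph2] := profile_facts al1 Fsmooth Fhom Fmono lN l1'.
have sph := smooth_at_profile Fsmooth lN l1'.
have KE : \forall P \near P0, 4 * gauss_at W (n P) e0 e1 P =
    mean_at W (n P) e0 e1 P * mean_at W (n P) e0 e1 P * (1 - s P * s P).
  by move: nfr ng; apply: filterS2 => P fr gP; rewrite (gap_mean_gauss fr) (sq P gP).
have nsl := smooth_at_near_lt ss (eq_ind_r (fun y => y < 1) l1 sP0).
have nA : \forall P \near P0, frame_facts W n P /\ 0 < gap W n P by exact: filterI nfr ng.
have nB : \forall P \near P0, s P < 1 /\
    \forall Q \near P, valid_time T Q -> surface_facts x nu eps W n Q.
  exact: filterI nsl (near_join nsu).
have fl : \forall P \near P0, P.2 = P0.2 -> 'D_etime W P =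
    - (mean_at W (n P) e0 e1 P `^ al * speed_profile F (s P)) *: n P.
  move: nA nB; apply: filterS2 => P [fr gP] [sP1 suN] tE.
  have vP : valid_time T P by rewrite /valid_time tE.
  exact: (gap_flow ee vP fr (nbhs_singleton suN vP) suN (sq P gP) (sqrtr_ge0 _) sP1).
have ds : 'D_etime s P0 < 0.
  apply: (critical_decrease nfr ss _ KE fl smax al1); rewrite sP0 //.
  by rewrite l0.
have := time_decrease ss ds smax; rewrite sP0.
move: ng; apply: filterS2 => P gP h tP.
rewrite (sq P gP); apply: ler_pM; [exact: sqrtr_ge0|exact: sqrtr_ge0|exact: h|exact: h].
Qed.

Lemma surface_facts_curvatures eps W n P : surface_facts x nu eps W n P ->
  exists k1 k2, PC (stereo eps P.1) P.2 k1 k2.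
Proof.
move=> [_ _ pc _ D]; have D' : 0 <= mean_at W (n P) e0 e1 P ^+ 2 - 4 * gauss_at W (n P) e0 e1 P.
  by rewrite subr_ge0.
by have [k1 [k2 k12]] := quadratic_roots D'; exists k1, k2; exact/pc.
Qed.

Lemma chart_at_sphere_point z t : sphere2 z -> 0 <= t -> (t%:E < T)%E ->
  exists eps v (W n : E -> 'rV[R]_3),
    [/\ eps * eps = 1, 0 < 1 + eps * z 0 2%:R, v = unstereo eps z & stereo eps v = z] /\
    [/\ valid_time T (v, t), (\forall P \near (v, t), frame_facts W n P) &
        (\forall P \near (v, t), valid_time T P -> surface_facts x nu eps W n P)].
Proof.
move=> zS t0 tT; have [eps ee z2] := sphere_pole zS.
have vv : valid_time T (unstereo eps z, t) by [].
have [W [n [h1 h2]]] := local_surface xsmooth xembedding nunormal xconvex ee vv.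
exists eps, (unstereo eps z), W, n; split; last by split.
by split => //; exact: unstereoK.
Qed.

(** Transfers a property valid near a point of the chart to the points of the sphere and the times
    in a product of balls, in which compactness and infima are handled. *)
Lemma near_unstereo (eps : R) (z : 'rV[R]_3) (t : R) (Q : set E) : eps * eps = 1 -> 0 < 1 + eps * z 0 2%:R ->
  (\forall P \near (unstereo eps z, t), Q P) ->
  exists2 d : R, 0 < d & forall y r, ball z d y -> ball t d r -> sphere2 y ->
    stereo eps (unstereo eps y) = y /\ Q (unstereo eps y, r).
Proof.
move=> ee z2 /nbhs_ballP[d /= d0 dQ].
have su := smooth_at_unstereo z2.
have cu : unstereo eps y @[y --> z] --> unstereo eps z := smooth_at_continuous su.
have n1 : \forall y \near z, ball (unstereo eps z) d (unstereo eps y).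
  exact: cu (nbhsx_ballx _ _ d0).
have sc : smooth_at (fun y : 'rV[R]_3 => 1 + eps * y 0 2%:R) z.
  apply: smooth_atD (smooth_at_cst (1 : R) z) _; apply: smooth_atcM.
  by apply: (@smooth_at_coord _ _ _ id); apply: smooth_at_lin => // ? ?.
have n2 := smooth_at_near_gt sc z2.
have /nbhs_ballP[d' /= d'0 dH] : \forall y \near z, ball (unstereo eps z) d (unstereo eps y) /\
    0 < 1 + eps * y 0 2%:R by exact: filterI n1 n2.
exists (Num.min d d'); first by rewrite lt_min d0.
move=> y r yz rt yS.
have yz' : ball z d' y by apply: le_ball yz; rewrite ge_min lexx orbT.
have rt' : ball t d r by apply: le_ball rt; rewrite ge_min lexx.
have [h1 h2] := dH _ yz'; split; first exact: unstereoK.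
by apply: dQ; split.
Qed.

Lemma unpinched_near z t : sphere2 z -> 0 <= t -> (t%:E < T)%E -> unpinched z t ->
  exists2 d : R, 0 < d & forall r, ball t d r -> 0 <= r -> (r%:E < T)%E -> unpinched z r.
Proof.
move=> zS t0 tT; have [eps [v [W [n [[ee z2 vE zE] [vv nfr nsu]]]]]] := chart_at_sphere_point zS t0 tT.
have su := nbhs_singleton nsu vv; have fr := nbhs_singleton nfr.
rewrite -{1}zE => /(unpinched_gap fr su) g.
have ng := smooth_at_near_gt (smooth_at_gap fr) g.
have nA : \forall P \near (v, t), (frame_facts W n P /\ l * l < gap W n P) /\
   (valid_time T P -> surface_facts x nu eps W n P).
  exact: filterI (filterI nfr ng) nsu.
rewrite vE in nA; have [d d0 dH] := near_unstereo ee z2 nA.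
exists d => // r rt r0 rT; have [e [[fr' g'] su']] := dH z r (ballxx _ d0) rt zS.
have vr : valid_time T (unstereo eps z, r) by [].
have := (unpinched_gap fr' (su' vr)).2 g'; by rewrite /= e.
Qed.

(** The local step of the maximum principle: the bound on the whole slice at time [t] gives the
    hypothesis of [gap_decrease], whatever the point [z]. *)
Lemma pinched_near z t : sphere2 z -> 0 <= t -> (t%:E < T)%E ->
  (forall y, sphere2 y -> ~ unpinched y t) ->
  exists2 d : R, 0 < d & forall y r, ball z d y -> ball t d r -> sphere2 y ->
    t < r -> (r%:E < T)%E -> ~ unpinched y r.
Proof.
move=> zS t0 tT np; have [eps [v [W [n [[ee z2 vE zE] [vv nfr nsu]]]]]] := chart_at_sphere_point zS t0 tT.
have nA : \forall P \near (v, t), frame_facts W n P /\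
   (valid_time T P -> surface_facts x nu eps W n P) by exact: filterI nfr nsu.
have nle : \forall P \near (v, t), P.2 = (v, t).2 -> gap W n P <= l * l.
  move: nA; apply: filterS => P [fr su] tE; rewrite leNgt; apply/negP => g.
  have vP : valid_time T P by rewrite /valid_time tE.
  have := (unpinched_gap fr (su vP)).2 g; rewrite tE; apply: np; exact: stereo_sphere.
have nd := gap_decrease ee vv nfr nsu nle.
have nB : \forall P \near (v, t), (frame_facts W n P /\
   (valid_time T P -> surface_facts x nu eps W n P)) /\ ((v, t).2 < P.2 -> gap W n P <= l * l).
  exact: filterI nA nd.
rewrite vE in nB; have [d d0 dH] := near_unstereo ee z2 nB.
exists d => // y r yz rt yS tr rT; have [e [[fr su] g]] := dH y r yz rt yS.
have vr : valid_time T (unstereo eps y, r) by split => //; exact: le_trans t0 (ltW tr).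
rewrite -{1}e => /(unpinched_gap fr (su vr)).
by rewrite ltNge (g tr).
Qed.

(** Compactness of the sphere, in the form of near-coverings, makes the length of the time interval
    uniform in the point. *)
Lemma pinched_right t : 0 <= t -> (t%:E < T)%E -> (forall y, sphere2 y -> ~ unpinched y t) ->
  exists2 d : R, 0 < d & forall y r, sphere2 y -> t < r -> r < t + d -> (r%:E < T)%E ->
    ~ unpinched y r.
Proof.
move=> t0 tT np.
pose P (d : R) (y : 'rV[R]_3) := sphere2 y -> forall r, t < r -> r < t + d -> (r%:E < T)%E ->
  ~ unpinched y r.
have cov : near_covering sphere2 by exact: (compact_near_coveringP _).1 sphere2_compact.
have [d [d0 dP]] : exists d, 0 < d /\ (sphere2 `<=` P d).
  have n : \forall d \near (0 : R)^'+, sphere2 `<=` P d.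
    apply: (cov R (0 : R)^'+ P _) => y yS; have [d d0 dH] := pinched_near yS t0 tT np.
    near=> y' d'; have d'd : d' < d by near: d'; exact: nbhs_right_lt.
    have yy' : ball y d y' by near: y'; exact: nbhsx_ballx.
    move=> y'S r tr rd rT; apply: (dH y' r) => //.
    rewrite -ball_normE /ball_ /= distrC gtr0_norm ?subr_gt0 // ltrBlDl.
    by apply: lt_trans rd _; rewrite ltrD2l.
  have n' : \forall d \near (0 : R)^'+, 0 < d by exact: nbhs_right_gt.
  by have [d [h1 h2]] := filter_ex (filterI n' n); exists d.
exists d => // y r yS; exact: dP.
Unshelve. all: by end_near. Qed.

Lemma pinching_preserved t1 : (forall y, sphere2 y -> ~ unpinched y 0) ->
  0 <= t1 -> (t1%:E < T)%E -> forall y, sphere2 y -> ~ unpinched y t1.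
Proof.
move=> np0 t10 t1T y1 y1S u1.
pose S : set R := [set t | [/\ 0 <= t, t <= t1 & exists2 y, sphere2 y & unpinched y t]].
have S1 : S t1 by split => //; exists y1.
have lS : lbound S 0 by move=> t [].
have hS : has_inf S by split; [exists t1|exists 0].
pose tau := inf S.
have tau0 : 0 <= tau by apply: lb_le_inf => //; exists t1.
have tau1 : tau <= t1 by apply: ge_inf => //; exists 0.
have lt_T t : t <= t1 -> (t%:E < T)%E by move=> tt; apply: le_lt_trans t1T; rewrite lee_fin.
(* The infimum is not itself a time of violation: at time 0 by hypothesis, later because violation
   is open in time and would occur earlier as well. *)
have nptau y : sphere2 y -> ~ unpinched y tau.
  move=> yS uy; have tau_gt0 : 0 < tau.
    rewrite lt_neqAle tau0 andbT; apply/eqP => e; apply: (np0 y yS); by rewrite e.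
  have [d d0 dH] := unpinched_near yS tau0 (lt_T _ tau1) uy.
  pose r := Num.max 0 (tau - d / 2).
  have r_tau : r < tau by rewrite gt_max tau_gt0 ltrBlDr ltrDl divr_gt0.
  have r0 : 0 <= r by rewrite le_max lexx.
  have rb : ball tau d r.
    rewrite -ball_normE /ball_ /= gtr0_norm ?subr_gt0 // ltrBlDl -ltrBlDr.
    by rewrite lt_max ltrD2l ltrN2 ltr_pdivrMr // ltr_pMr // ltr1n orbT.
  have rt1 : r <= t1 by exact: le_trans (ltW r_tau) tau1.
  have Sr : S r by split=> //; exists y => //; exact: dH rb r0 (lt_T r rt1).
  by move: r_tau; rewrite ltNge ge_inf //; exists 0.
(* The bound therefore holds at [tau] and, by the uniform step, for a while after it, whereas an
   infimum has elements of [S] arbitrarily close. *)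
have [d d0 dH] := pinched_right tau0 (lt_T _ tau1) nptau.
have [t [t0 tt1 [y yS uy]] td] := inf_adherent d0 hS.
have tau_t : tau <= t by apply: ge_inf; [exists 0|split => //; exists y].
move: tau_t; rewrite le_eqVlt => /orP[/eqP e|tau_t].
  by apply: (nptau y yS); rewrite e.
exact: (dH y t yS tau_t td (lt_T _ tt1) uy).
Qed.

End pinched_flow.

(** * From the preserved level to the pinching ratio *)

Lemma ratio_le {R : realType} (k1 k2 p : R) : 0 < k1 -> 0 < k2 -> 1 < p ->
  (Num.max k1 k2 / Num.min k1 k2 <= p) = (`|k1 - k2| <= (p - 1) / (p + 1) * (k1 + k2)).
Proof.
wlog k12 : k1 k2 / k2 <= k1 => [hwlog k10 k20 p1|k10 k20 p1].
  case/orP: (le_total k2 k1) => [/hwlog->//|/hwlog h].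
  by rewrite maxC minC distrC [k1 + k2]addrC; exact: h.
have p10 : 0 < p + 1 by rewrite addr_gt0 // (lt_trans _ p1).
rewrite max_l // min_r // ler_pdivrMr // ger0_norm ?subr_ge0 // mulrAC ler_pdivlMr //.
rewrite -subr_ge0 -[RHS]subr_ge0.
have -> : (p - 1) * (k1 + k2) - (k1 - k2) * (p + 1) = 2 * (p * k2 - k1) by ring.
by rewrite pmulr_rge0.
Qed.

Lemma ratio_ge1 {R : realType} (k1 k2 : R) : 0 < k1 -> 0 < k2 ->
  1 <= Num.max k1 k2 / Num.min k1 k2.
Proof.
move=> k10 k20; rewrite ler_pdivlMr ?lt_min ?k10 // mul1r.
by rewrite ge_min le_max lexx.
Qed.

Theorem mainTheorem4 (R : realType) (alpha : R) (halpha : 1 < alpha)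
    (F : R * R -> R)
    (Fsmooth : smooth_on (@pos_cone R) F)
    (Fsym : forall a b : R, 0 < a -> 0 < b -> F (a, b) = F (b, a))
    (Fhom : forall l a b : R, 0 < l -> 0 < a -> 0 < b ->
       F (l * a, l * b) = l `^ alpha * F (a, b))
    (Fmono : forall p, @pos_cone R p ->
       0 < 'D_(1, 0) F p /\ 0 < 'D_(0, 1) F p)
    (T : \bar R) (hT : (0 < T)%E)
    (x nu : 'rV[R]_3 -> R -> 'rV[R]_3)
    (xsmooth : smooth_on (spacetime T) (fun p => x p.1 p.2))
    (xembedding : forall t : R, 0 <= t -> (t%:E < T)%E ->
       sphere_embedding (x^~ t))
    (nunormal : forall t : R, 0 <= t -> (t%:E < T)%E ->
       outward_unit_normal (x^~ t) (nu^~ t))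
    (xconvex : forall t : R, 0 <= t -> (t%:E < T)%E ->
       strictly_convex (x^~ t) (nu^~ t))
    (xflow : curvature_flow F T x nu)
    (hpinching : (pinching_ratio (x^~ 0%R) (nu^~ 0%R) <=
       (1 + 2 / (alpha - 1))%R%:E)%E) :
  forall t : R, 0 < t -> (t%:E < T)%E ->
    (pinching_ratio (x^~ t) (nu^~ t) <=
     pinching_ratio (x^~ 0%R) (nu^~ 0%R))%E.
Proof.
move=> t t0 tT.
apply: ub_ereal_sup => _ [z [k1 [k2 [zS pc ->]]]].
have [k10 k20] := xconvex t (ltW t0) tT z k1 k2 zS pc.
have ratio0 y c1 c2 : @sphere2 R y -> principal_curvatures (x^~ 0) (nu^~ 0) y c1 c2 ->
    ((Num.max c1 c2 / Num.min c1 c2)%:E <= pinching_ratio (x^~ 0%R) (nu^~ 0%R))%E.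
  by move=> yS c; apply: ereal_sup_ubound; exists y, c1, c2.
(* One pair of curvatures at time 0 shows that the supremum is at least 1; in particular it is not
   the value of an empty supremum. *)
have [c1 [c2 pc0]] : exists c1 c2, principal_curvatures (x^~ 0) (nu^~ 0) z c1 c2.
  have [eps [v [W [n [[ee z2 _ zE] [vv fr su]]]]]] :=
    chart_at_sphere_point xsmooth xembedding nunormal xconvex zS (lexx 0) hT.
  have [c1 [c2 h]] := surface_facts_curvatures (nbhs_singleton su vv).
  by exists c1, c2; rewrite -zE.
have [c10 c20] := xconvex 0 (lexx 0) hT z c1 c2 zS pc0.
have := ratio0 z c1 c2 zS pc0.
case: (pinching_ratio _ _) hpinching ratio0 => [p| |] //.
rewrite !lee_fin => pr ratio0 /(le_trans (ratio_ge1 c10 c20)) p1.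
have al0 : 0 < alpha - 1 by rewrite subr_gt0.
(* The level [l] attached to [q] must be positive, so [q > 1] is required here; the initial ratio
   [p] may be 1. *)
have main q : 1 < q -> p <= q -> q <= 1 + 2 / (alpha - 1) ->
    Num.max k1 k2 / Num.min k1 k2 <= q.
  move=> q1 pq qr; pose l := (q - 1) / (q + 1).
  have q10 : 0 < q + 1 by rewrite addr_gt0 // (lt_trans _ q1).
  have l0 : 0 < l by rewrite divr_gt0 // subr_gt0.
  have l1 : l < 1 by rewrite ltr_pdivrMr // mul1r ltrD2l gt0_cp.
  have lal : alpha * l <= 1.
    (* The bound [q <= r0(alpha)] multiplied by [alpha - 1] reads [alpha * (q - 1) <= q + 1]. *)
    rewrite mulrA ler_pdivrMr // mul1r.
    have h : q * (alpha - 1) <= (1 + 2 / (alpha - 1)) * (alpha - 1) by rewrite ler_pM2r.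
    have e : (1 + 2 / (alpha - 1)) * (alpha - 1) = alpha + 1 by field; rewrite gt_eqF.
    rewrite -subr_ge0; move: h; rewrite e -subr_ge0.
    by have -> : alpha + 1 - q * (alpha - 1) = q + 1 - alpha * (q - 1) by ring.
  have np0 y : @sphere2 R y -> ~ unpinched x nu l y 0.
    move=> yS [d1 [d2 [pcy]]]; apply/negP; rewrite -leNgt.
    have [d10 d20] := xconvex 0 (lexx 0) hT y d1 d2 yS pcy.
    rewrite -(ratio_le d10 d20 q1); apply: le_trans pq.
    by have := ratio0 y d1 d2 yS pcy; rewrite lee_fin.
  have := pinching_preserved halpha Fsmooth Fhom Fmono xsmooth xembedding nunormal xconvex
    xflow l0 l1 lal np0 (ltW t0) tT zS.
  rewrite (ratio_le k10 k20 q1) leNgt => np; apply/negP => h; apply: np.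
  by exists k1, k2.
move: p1; rewrite le_eqVlt => /orP[/eqP p1|p1]; last by exact: main.
(* For a round initial surface, [p = 1], the bound is approached through [q = 1 + d]; the cap
   [2 / (alpha - 1)] on [d] keeps [q] within [r0(alpha)]. *)
apply/ler_addgt0Pr => e e0.
pose d := Num.min e (2 / (alpha - 1)).
have d0 : 0 < d by rewrite lt_min e0 divr_gt0.
apply: (@le_trans _ _ (1 + d)); last by rewrite -p1 lerD2l ge_min lexx.
apply: main.
- by rewrite ltrDl.
- by rewrite -p1 lerDl ltW.
- by rewrite lerD2l ge_min lexx orbT.
Qed.
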